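(* Let $\alpha\in\mathbb{T}$ be irrational and $\beta\in\mathbb{T}$ be non-zero. Then the topological dynamical system $S:X_{\alpha,\beta}\to X_{\alpha,\beta}$ satisfies a PNT.
   Context: $\mathbb{T}=\mathbb{R}/\mathbb{Z}$, identified with $[0,1)$, and $T:\mathbb{T}\to\mathbb{T}$ is the rotation $Tx=x+\alpha$. Let $A_0=[0,\beta)$ and $A_1=[\beta,1)$. For $x\in\mathbb{T}$ let $\bar{x}\in\{0,1\}^{\mathbb{Z}}$ be its code: $\bar{x}(k)=i$ if and only if $T^kx\in A_i$. $X_{\alpha,\beta}\subset\{0,1\}^{\mathbb{Z}}$ is the closure of $\{\bar{x}:x\in\mathbb{T}\}$, and $S$ is the left shift. A topological dynamical system $(X,R)$ satisfies a PNT if for every $y\in X$ and every $f\in C(X)$ the limit $\lim_{N\to\infty}\frac{1}{\pi(N)}\sum_{p<N}f(R^py)$ exists, where $p$ runs over primes and $\pi(N)$ is the number of primes up to $N$. *)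

(* Defs.v *)
From mathcomp Require Import all_boot all_order all_algebra.
From mathcomp Require Import all_classical all_reals.
From mathcomp Require Import topology normedtype sequences.
From mathcomp Require Import complex zify.

Set Implicit Arguments.
Unset Strict Implicit.
Unset Printing Implicit Defensive.

Import Order.TTheory GRing.Theory Num.Theory.
Import numFieldNormedType.Exports.

Local Open Scope classical_set_scope.
Local Open Scope ring_scope.

Definition prime_pi (N : nat) : nat := count prime (iota 0 N.+1).

(* C(X) is the space of complex-valued continuous functions; [R[i]^o] is [R[i]]
   with the topology of its norm.  The junk value [0^-1 = 0] only occurs for
   [N < 2]. *)
Definition satisfies_PNT (R : realType) (X : topologicalType) (T : X -> X) :=
  forall (y : X) (f : X -> R[i]^o), continuous f ->
  exists l : R[i]^o,
    (fun N : nat => ((prime_pi N)%:R^-1 *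
       \sum_(0 <= p < N | prime p) f (iter p T y) : R[i]^o)) @ \oo --> l.

Section Rotation.
Context {R : realType}.
Implicit Types (alpha x : R) (k : int).

Definition frac x : R := x - (Num.floor x)%:~R.

(* The circle R/Z is identified with [0, 1). *)
Definition rotation alpha x : R := frac (x + alpha).

(* On [0, 1), [rotation (- alpha)] is the inverse of [rotation alpha]; see
   [rotationK]. *)
Definition rotation_iter alpha k x : R :=
  match k with
  | Posz n => iter n (rotation alpha) x
  | Negz n => iter n.+1 (rotation (- alpha)) x
  end.

Lemma frac_id x : x \in `[0, 1[ -> frac x = x.
Proof.
rewrite in_itv /= => x01; rewrite /frac.
by rewrite (@floor_def _ x 0) ?subr0// add0r.
Qed.

Lemma fracDz x (m : int) : frac (x + m%:~R) = frac x.
Proof.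
rewrite /frac floorDrz// intrKfloor intrD opprD addrACA.
by rewrite subrr addr0.
Qed.

Lemma rotationK alpha x :
  x \in `[0, 1[ -> rotation (- alpha) (rotation alpha x) = x.
Proof.
move=> x01; rewrite /rotation {2}/frac addrAC addrK -mulrNz fracDz.
exact: frac_id.
Qed.

Lemma rotation_itv alpha x : rotation alpha x \in `[0, 1[.
Proof.
rewrite in_itv /= /rotation /frac subr_ge0 ltrBlDl floor_le /=.
by have := floorD1_gt (x + alpha); rewrite intrD.
Qed.

Lemma rotation_iterSr alpha k x : x \in `[0, 1[ ->
  rotation_iter alpha k (rotation alpha x) = rotation_iter alpha (k + 1) x.
Proof.
move=> x01; case: k => n /=.
  by rewrite -iterSr addn1.
rewrite -iterS iterSr rotationK//; case: n => [//|n].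
by have -> : (Negz n.+1 + 1 = Negz n)%R by rewrite !NegzE; lia.
Qed.

End Rotation.

(* Bi-infinite binary sequences with the product topology; [true] is the
   symbol 1. *)
Definition full_shift : topologicalType := {ptws int -> bool}.

Definition shift (y : full_shift) : full_shift := fun k => y (k + 1).

Section Coding.
Context {R : realType}.
Implicit Types (alpha beta x : R).

Definition code alpha beta x : full_shift :=
  fun k => rotation_iter alpha k x \in `[beta, 1[.

Definition Xset alpha beta : set full_shift :=
  closure [set code alpha beta x | x in `[0, 1[].

Lemma shift_continuous : continuous shift.
Proof.
move=> y; apply/cvg_sup => k.
move=> U [V [[W oW <-]] /= Wy WU].
have /(_ W) := @proj_continuous int (fun=> bool) (k + 1) y.
by move=> h; apply: filterS WU _; apply: h; exact: open_nbhs_nbhs.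
Qed.

Lemma shift_code alpha beta x : x \in `[0, 1[ ->
  shift (code alpha beta x) = code alpha beta (rotation alpha x).
Proof.
by move=> x01; apply/funext => k; rewrite /shift /code rotation_iterSr.
Qed.

Lemma shift_Xset alpha beta y : Xset alpha beta y -> Xset alpha beta (shift y).
Proof.
move=> Xy B /shift_continuous /Xy [_ [[x x01 <-] /= Bx]].
exists (shift (code alpha beta x)); split => //.
exists (rotation alpha x); first exact: rotation_itv.
by rewrite shift_code.
Qed.

Definition shift_on alpha beta (y : set_type (Xset alpha beta)) :
    set_type (Xset alpha beta) :=
  exist _ (shift (val y)) (mem_set (shift_Xset (set_valP y))).

End Coding.

(* Main.v *)
Require Import Defs.
From mathcomp Require Import all_boot all_order all_algebra.
From mathcomp Require Import all_classical all_reals topology.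
From mathcomp Require Import normedtype sequences exp trigo.
From mathcomp Require Import complex zify ring lra.
Import Order.TTheory GRing.Theory Num.Theory.
Import numFieldNormedType.Exports.
Local Open Scope ring_scope.
Set Implicit Arguments.
Unset Strict Implicit.
Unset Printing Implicit Defensive.

(** An element [y] of [Xset alpha beta] is a limit of codes; by compactness of
    the circle there is [x] with [y n = 1] iff [frac (x + n * alpha) >= beta] for
    all large [n].  A continuous function on the subshift depends, up to [eps], on
    finitely many coordinates, so [f (S^p y)] is close to [h (x + p * alpha)] where
    [h] is, up to [eps], locally constant off finitely many points of the circle.
    Approximating [h] by Fejer sums reduces the claim to Vinogradov's theorem
    [sum_(p <= N) e(p alpha) = o(pi(N))] for every irrational [alpha].

    Since [alpha] may be a Liouville number, the usual bounds with powers of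
    [log N] do not suffice.  We write [Lambda = mu * log], so that the sum over
    [Lambda] becomes the sum of [mu(d) log(m) e(d m alpha)] over [d m <= N].
    - Bounded [m]: [sum_(d <= x) mu(d) e(d m alpha) = o(x)] (Davenport), by the
      Turan-Kubilius inequality and bilinear argument of Daboussi and Katai.
    - [m > K] and [q] not dividing [d], where [q <= N^(1/3) < q'] are the
      denominators of successive best approximations of [alpha]: the sum over [m]
      is geometric; one uses [q] for [d <= q'/4] and [q'] for larger [d].  The
      total is [O(N K^(-1/4)) + o(N)].
    - [q | d]: here [mu(q) (mu 1_(., q) * log) = mu(q) (Lambda * 1_S)] with [S] the
      integers all of whose prime factors divide [q], and Chebyshev's bound gives
      [O(N q^(-1/2))], where [q] tends to infinity with [N]. *)

(** * Arithmetic functions *)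

(** The classical bounds for [sum Lambda(n) e(n alpha)] lose powers of [log N] and need a
    denominator above such a power. Some irrational [alpha] have successive denominators of which
    the one is far below [log N] and the next far above [N], so no step may lose even one logarithm.
    For fixed [d], with [u = N / d], the sum over [m] is at most [u log u] and also
    [O(log u / ||d alpha||)]. The geometric mean of these, [O(u^(3/4) ||d alpha||^(-1/2))], has an
    exponent below [1]; over blocks of [q] consecutive [d] it becomes a Riemann sum that ends where
    [N / d = K], whence [N K^(-1/4)]. No such saving exists for [q | d], where trivial bounds would
    leave [log^2 N / q]; hence the detour through the primes of [q]. The cut [N^(1/3)] balances two
    needs: the values [d < q] cost [q^2 log N], which must be [o(N)], and the residues close to [0]
    modulo [q'], bounded trivially, require [N <= q'^3]. The choices are made in this order: [K];
    then Davenport's theorem for the finitely many [m alpha] with [m <= K]; then a lower bound for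
    [q]; and [N] last. *)

Lemma sum_multiples (V : nmodType) (a N : nat) (G : nat -> V) : (0 < a)%N ->
  \sum_(1 <= n < N.+1 | (a %| n)%N) G n
    = \sum_(1 <= b < (N %/ a).+1) G (a * b)%N.
Proof.
move=> a0; elim: N => [|N IH]; first by rewrite div0n !big_geq.
rewrite big_mkcond big_nat_recr //= -big_mkcond IH divnS //.
case: ifPn => [aN|_]; last by rewrite add0n addr0.
rewrite add1n [RHS]big_nat_recr //=; congr (_ + G _).
have := divnS N a0; rewrite aN add1n => <-.
by rewrite mulnC divnK.
Qed.

(** Writing [n = d (n %/ d)] turns a Dirichlet convolution summed up to [N] into a sum over the
    lattice points under the hyperbola [a b <= N]. *)
Lemma sum_divisors (V : nmodType) (N : nat) (F : nat -> nat -> V) :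
  \sum_(1 <= n < N.+1) \sum_(1 <= d < n.+1 | (d %| n)%N) F d (n %/ d)%N
  = \sum_(1 <= a < N.+1) \sum_(1 <= b < (N %/ a).+1) F a b.
Proof.
transitivity (\sum_(1 <= n < N.+1) \sum_(1 <= d < N.+1 | (d %| n)%N)
    F d (n %/ d)%N).
  apply: eq_big_nat => n /andP[n0 nN].
  rewrite (@big_cat_nat _ _ _ n.+1 1%N N.+1) //=.
  rewrite [X in _ = _ + X]big_nat_cond [X in _ = _ + X]big_pred0 ?addr0 //.
  move=> d; apply/negbTE/negP => /andP[/andP[nd _] dn].
  by have := dvdn_leq n0 dn; rewrite leqNgt nd.
rewrite (exchange_big_dep xpredT) //=.
apply: eq_big_nat => a /andP[a0 _].
rewrite (sum_multiples _ (fun n => F a (n %/ a)%N) a0).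
by apply: eq_bigr => b _; rewrite mulKn.
Qed.

(** An exponent above [1] annihilates the product. Since [primes 0] is empty, [mobius 0] is [1]; the
    sums below start at [1]. *)
Definition mobius (n : nat) : int :=
  \prod_(p <- primes n) (if logn p n == 1%N then -1 else 0).

Lemma mobius1 : mobius 1 = 1.
Proof. by rewrite /mobius big_nil. Qed.

Lemma mobius_norm n : `|mobius n| <= 1.
Proof.
rewrite /mobius; elim/big_rec: _ => [|p x _ xle]; first by rewrite normr1.
rewrite normrM; apply: mulr_ile1 => //; case: ifP => _;
 by rewrite ?normrN ?normr1 ?normr0.
Qed.

Lemma mobiusM m n : (0 < m)%N -> (0 < n)%N -> coprime m n ->
  mobius (m * n) = mobius m * mobius n.
Proof.
move=> m0 n0 mn; rewrite /mobius.
have perm : perm_eq (primes (m * n)) (primes m ++ primes n).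
  apply: uniq_perm; rewrite ?primes_uniq //.
    rewrite cat_uniq !primes_uniq andbT /=.
    by rewrite -(coprime_has_primes m0 n0).
  by move=> p; rewrite mem_cat primesM.
rewrite (perm_big _ perm) big_cat /=; congr (_ * _).
  apply: eq_big_seq => p; rewrite mem_primes => /and3P[pp _ pm].
  rewrite lognM // (_ : logn p n = 0%N) ?addn0 //.
  apply/eqP; rewrite -leqn0 leqNgt logn_gt0 mem_primes pp n0 /=.
  apply/negP => pn; have : (p %| gcdn m n)%N by rewrite dvdn_gcd pm.
  by rewrite (eqP mn) dvdn1 => /eqP p1; rewrite p1 in pp.
apply: eq_big_seq => p; rewrite mem_primes => /and3P[pp _ pn].
rewrite lognM // (_ : logn p m = 0%N) ?add0n //.
apply/eqP; rewrite -leqn0 leqNgt logn_gt0 mem_primes pp m0 /=.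
apply/negP => pm; have : (p %| gcdn m n)%N by rewrite dvdn_gcd pm.
by rewrite (eqP mn) dvdn1 => /eqP p1; rewrite p1 in pp.
Qed.

Lemma mobius_prime p : prime p -> mobius p = -1.
Proof.
by move=> pp; rewrite /mobius primes_prime // big_seq1 logn_prime // !eqxx.
Qed.

Lemma mobius_eq0 p n : prime p -> (0 < n)%N -> (1 < logn p n)%N ->
  mobius n = 0.
Proof.
move=> pp n0 l; rewrite /mobius (bigD1_seq p) ?primes_uniq //=; last first.
  by rewrite -logn_gt0 (ltn_trans _ l).
by rewrite (gtn_eqF l) mul0r.
Qed.

Lemma mobiusM_ncoprime m n : (0 < m)%N -> (0 < n)%N -> ~~ coprime m n ->
  mobius (m * n) = 0.
Proof.
move=> m0 n0 mn.
have g1 : (1 < gcdn m n)%N by rewrite ltn_neqAle eq_sym mn gcdn_gt0 m0.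
have pp := pdiv_prime g1; have := pdiv_dvd (gcdn m n).
rewrite dvdn_gcd => /andP[pm pn].
apply: (mobius_eq0 pp); rewrite ?muln_gt0 ?m0 // lognM //.
rewrite (_ : 2%N = 1 + 1)%N // leq_add // logn_gt0 mem_primes pp ?m0 ?n0 //.
Qed.

(** Smoothness refers to the set of primes of [q], not to their size: for [n > 0] it means that [n]
    divides a power of [q]. *)
Definition smooth (q n : nat) := all (fun p => p %| q)%N (primes n).

(** If a prime [p] divides [n] but not [q], the divisors [b] and [p b] with [p] not dividing [b]
    cancel in pairs, and [mobius (p b) = 0] when [p] divides [b]. Otherwise [1] is the only divisor
    of [n] coprime to [q]. *)
Lemma sum_mobius_coprime (q n : nat) : (0 < n)%N ->
  \sum_(1 <= d < n.+1 | (d %| n)%N && coprime d q) mobius d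
    = (smooth q n)%:R.
Proof.
move=> n0; have [sm|] := boolP (smooth q n).
  rewrite big_mkcond big_ltn // dvd1n coprime1n /= mobius1.
  rewrite big_nat big1 ?addr0 // => d /andP[d1 dn].
  case: ifP => // /andP[ddn dq].
  have pp := pdiv_prime d1; have pd := pdiv_dvd d.
  have pn : pdiv d \in primes n.
    by rewrite mem_primes pp n0 (dvdn_trans pd).
  have pq := allP sm _ pn.
  have : (pdiv d %| gcdn d q)%N by rewrite dvdn_gcd pd.
  by rewrite (eqP dq) dvdn1 => /eqP p1; rewrite p1 in pp.
case/allPn => p; rewrite mem_primes => /and3P[pp _ pn] pq.
have p0 := prime_gt0 pp.
rewrite (bigID (fun d => p %| d)%N) /=.
set n' := (n %/ p)%N; have nE : n = (p * n')%N by rewrite mulnC divnK.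
have n'0 : (0 < n')%N by rewrite divn_gt0 // dvdn_leq.
have cpq : coprime p q by rewrite prime_coprime.
rewrite (eq_bigl (fun d => (p %| d)%N && ((d %| n)%N && coprime d q))); last first.
  by move=> d; rewrite andbC.
rewrite big_mkcondr /= sum_multiples // -/n'.
rewrite [X in _ + X](_ : _ =
   \sum_(1 <= b < n'.+1 | [&& (b %| n')%N, coprime b q & ~~ (p %| b)%N])
     mobius b); last first.
  rewrite (@big_cat_nat _ _ _ n'.+1 1%N n.+1) //=; last by rewrite ltnS leq_div.
  rewrite [X in _ + X]big_nat_cond [X in _ + X]big_pred0 ?addr0; last first.
    move=> d; apply/negbTE/negP => /andP[/andP[nd _] /andP[/andP[dn dq] pd]].
    have : (d %| n')%N.
      by rewrite -(@Gauss_dvdr _ p) -?nE // coprime_sym prime_coprime.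
    by move/(dvdn_leq n'0); rewrite leqNgt nd.
  apply: eq_bigl => d; rewrite -andbA; have [pd|pd] := boolP (p %| d)%N.
    by rewrite !andbF.
  by rewrite nE Gauss_dvdr // coprime_sym prime_coprime.
rewrite [X in _ + X]big_mkcond /= -big_split /= big_nat big1 // => b /andP[b0 _].
rewrite nE dvdn_pmul2l // coprimeMl cpq /=.
case: (b %| n')%N => //=; case: (coprime b q) => //=.
have [pb|pb] /= := boolP (p %| b)%N.
  by rewrite mobiusM_ncoprime ?addr0 // prime_coprime // negbK.
by rewrite mobiusM ?prime_coprime // mobius_prime // mulN1r addNr.
Qed.

(** * The von Mangoldt function *)

Section VonMangoldt.
Context {R : realType}.

(** The inner sum detects [n = p ^ k]; at most one pair contributes, and the bounds on [p] and [k]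
    lose nothing since [k < p ^ k]. *)
Definition vonMangoldt (n : nat) : R :=
  \sum_(1 <= p < n.+1 | prime p) \sum_(1 <= k < n.+1 | (p ^ k)%N == n)
    ln p%:R.

Lemma ln_nat_ge0 n : 0 <= ln n%:R :> R.
Proof.
by case: n => [|n]; [rewrite ln0 // | rewrite ln_ge0 // ler1n].
Qed.

Lemma ler_ln_nat m n : (0 < m)%N -> (m <= n)%N -> ln m%:R <= ln n%:R :> R.
Proof.
move=> m0 mn; rewrite ler_ln ?posrE ?ltr0n ?ler_nat //.
exact: leq_trans mn.
Qed.

Lemma vonMangoldt_ge0 n : 0 <= vonMangoldt n.
Proof.
by do 2![apply: sumr_ge0 => ? _]; exact: ln_nat_ge0.
Qed.

Lemma vonMangoldt_widen n N : (0 < n)%N -> (n <= N)%N ->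
  vonMangoldt n = \sum_(1 <= p < N.+1 | prime p)
    \sum_(1 <= k < N.+1 | (p ^ k)%N == n) ln p%:R.
Proof.
move=> n0 nN; rewrite (@big_cat_nat _ _ _ n.+1 1%N N.+1) //=.
rewrite [X in _ = _ + X]big_nat_cond [X in _ = _ + X]big1 ?addr0; last first.
  move=> p /andP[/andP[np _] pp]; rewrite big_nat_cond big_pred0 // => k.
  apply/negbTE/negP => /andP[/andP[k0 _] /eqP pk].
  have : (p ^ 1 <= p ^ k)%N by rewrite leq_exp2l // prime_gt1.
  by rewrite expn1 pk leqNgt np.
rewrite /vonMangoldt; apply: eq_bigr => p pp.
rewrite (@big_cat_nat _ _ _ n.+1 1%N N.+1) //=.
rewrite [X in _ = _ + X]big_nat_cond [X in _ = _ + X]big_pred0 ?addr0 // => k.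
apply/negbTE/negP => /andP[/andP[nk _] /eqP pk].
have := ltn_expl k (prime_gt1 pp).
by rewrite pk ltnNge => /negP; apply; exact: ltnW.
Qed.

Lemma sum_vonMangoldt N (G : nat -> R) :
  \sum_(1 <= n < N.+1) vonMangoldt n * G n =
  \sum_(1 <= p < N.+1 | prime p) \sum_(1 <= k < N.+1 | (p ^ k <= N)%N)
     ln p%:R * G (p ^ k)%N.
Proof.
transitivity (\sum_(1 <= n < N.+1) \sum_(1 <= p < N.+1 | prime p)
    \sum_(1 <= k < N.+1 | (p ^ k)%N == n) ln p%:R * G n).
  apply: eq_big_nat => n /andP[n0 nN].
  rewrite (vonMangoldt_widen n0 nN) mulr_suml; apply: eq_bigr => p _.
  by rewrite mulr_suml.
rewrite (exchange_big_dep prime) //=; apply: eq_bigr => p pp.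
rewrite (exchange_big_dep xpredT) //= pp [RHS]big_mkcond /=.
apply: eq_big_nat => k /andP[k0 kN].
rewrite big_mkcond /=; case: ifPn => [pkN|]; last first.
  rewrite -ltnNge => Npk; rewrite big_nat big1 // => n /andP[_ nN].
  by case: eqP => // pkn; rewrite -pkn ltnS leqNgt Npk in nN.
rewrite (bigD1_seq (p ^ k)%N) ?iota_uniq //=; last first.
  by rewrite mem_index_iota ltnS pkN expn_gt0 prime_gt0.
rewrite eqxx big1 ?addr0 // => n nn.
by rewrite eq_sym (negbTE nn).
Qed.

Lemma ln_prod (s : seq nat) (F : nat -> nat) : (forall p, 0 < F p)%N ->
  ln (\prod_(p <- s) F p)%N%:R = \sum_(p <- s) ln (F p)%:R :> R.
Proof.
move=> F0; elim: s => [|p s IH]; first by rewrite !big_nil ln1.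
rewrite !big_cons natrM lnM ?posrE ?ltr0n ?F0 ?IH //.
by apply: prodn_gt0.
Qed.

Lemma sum_logn n : (0 < n)%N ->
  \sum_(1 <= p < n.+1 | prime p) ln p%:R *+ logn p n = ln n%:R :> R.
Proof.
move=> n0; rewrite -[in RHS](partnT n0) /partn ln_prod; last first.
  by move=> p; exact: pfactor_gt0.
rewrite [RHS]big_ltn // (lognE 0) /= ln1 add0r big_mkcond /=.
apply: eq_big_nat => p /andP[p0 _]; case: ifPn => [pp|npp].
  by rewrite natrX lnXn // ltr0n.
by rewrite lognE (negbTE npp) expn0 ln1.
Qed.

Lemma sum_vonMangoldt_divisors n : (0 < n)%N ->
  \sum_(1 <= d < n.+1 | (d %| n)%N) vonMangoldt d = ln n%:R.
Proof.
move=> n0; transitivity (\sum_(1 <= d < n.+1) vonMangoldt d * (d %| n)%N%:R).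
  by rewrite big_mkcond; apply: eq_bigr => d _; case: ifP; rewrite ?mulr1 ?mulr0.
rewrite sum_vonMangoldt -sum_logn //; apply: eq_bigr => p pp.
rewrite logn_count_dvd // [RHS](_ : _ =
    \sum_(1 <= k < n.+1) ln p%:R * (p ^ k %| n)%N%:R); last first.
  rewrite big_nat_recr //= (_ : (p ^ n %| n)%N = false) ?mulr0 ?addr0.
    by rewrite -mulr_sumr -natr_sum mulr_natr.
  by apply/negbTE/negP => /(dvdn_leq n0); rewrite leqNgt ltn_expl ?prime_gt1.
rewrite [LHS]big_mkcond; apply: eq_bigr => k _; case: ifPn => // pkn.
rewrite (_ : (p ^ k %| n)%N = false) ?mulr0 //.
by apply: contraNF pkn => /(dvdn_leq n0).
Qed.

Lemma vonMangoldt_prime p : prime p -> vonMangoldt p = ln p%:R.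
Proof.
move=> pp; have p1 := prime_gt1 pp.
have sum1 : vonMangoldt 1 = 0 :> R.
  by rewrite -[RHS]ln1 -(@sum_vonMangoldt_divisors 1%N) // big_mkcond big_nat1 dvdnn.
rewrite -sum_vonMangoldt_divisors ?prime_gt0 // big_mkcond big_nat_recr ?prime_gt0 //=.
rewrite dvdnn big_nat big1 ?add0r // => d /andP[d0 dp].
case: ifP => // dvp; case/primeP: pp => _ /(_ _ dvp) /orP[/eqP -> //|/eqP dpE].
by rewrite dpE ltnn in dp.
Qed.

End VonMangoldt.

(** * Chebyshev's bounds *)

Section Chebyshev.
Context {R : realType}.

Definition chebyshev_psi (N : nat) : R := \sum_(1 <= n < N.+1) vonMangoldt n.

Lemma ler_chebyshev_psi m n : (m <= n)%N -> chebyshev_psi m <= chebyshev_psi n.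
Proof.
move=> mn; rewrite /chebyshev_psi (@big_cat_nat _ _ _ m.+1 1%N n.+1) //= lerDl.
by apply: sumr_ge0 => i _; exact: vonMangoldt_ge0.
Qed.

(** Legendre's formula. The common range up to [M] lets [N!], [h!] and [(N - h)!] be compared term
    by term in [ln_bin]. *)
Lemma ln_fact N M : (N <= M)%N ->
  ln N`!%:R = \sum_(1 <= a < M.+1) vonMangoldt a * (N %/ a)%:R :> R.
Proof.
move=> NM; rewrite (@big_cat_nat _ _ _ N.+1 1%N M.+1) //=.
rewrite [X in _ = _ + X]big_nat [X in _ = _ + X]big1 ?addr0; last first.
  by move=> a /andP[Na _]; rewrite divn_small // mulr0.
transitivity (\sum_(1 <= n < N.+1) ln n%:R : R).
  elim: N {NM} => [|N IH]; first by rewrite big_geq // ln1.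
  rewrite big_nat_recr //= factS natrM lnM ?posrE ?ltr0n ?fact_gt0 //.
  by rewrite IH addrC.
transitivity (\sum_(1 <= n < N.+1) \sum_(1 <= d < n.+1 | (d %| n)%N)
    vonMangoldt d : R).
  by apply: eq_big_nat => n /andP[n0 _]; rewrite sum_vonMangoldt_divisors.
rewrite (sum_divisors N (fun d _ => vonMangoldt d : R)).
by apply: eq_bigr => a _; rewrite sumr_const_nat subn1 mulr_natr.
Qed.

(** By [divnD] the difference of the three quotients by [a] is a carry, [0] or [1]. Keeping only
    certain carries bounds [chebyshev_psi] from above, replacing all of them by [1] bounds it from
    below. *)
Lemma ln_bin N h : (h <= N)%N ->
  ln 'C(N, h)%:R = \sum_(1 <= a < N.+1) vonMangoldt a *
     (a <= h %% a + (N - h) %% a)%N%:R :> R.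
Proof.
move=> hN; apply/eqP; rewrite -(addKr (ln (h`! * (N - h)`!)%:R) (ln 'C(N, h)%:R)).
rewrite -lnM ?posrE ?ltr0n ?bin_gt0 ?muln_gt0 ?fact_gt0 //.
rewrite -natrM [(_ * 'C(_, _))%N]mulnC bin_fact //.
rewrite natrM lnM ?posrE ?ltr0n ?fact_gt0 //.
rewrite (@ln_fact N N) // (@ln_fact h N) // (@ln_fact (N - h) N) ?leq_subr //.
rewrite -big_split /= addrC subr_eq -big_split /=; apply/eqP.
apply: eq_big_nat => a /andP[a0 _]; rewrite -!mulrDr -!natrD.
by rewrite -[in LHS](subnKC hN) divnD // addnC.
Qed.

Lemma bin_le_exp2 n m : ('C(n, m) <= 2 ^ n)%N.
Proof.
elim: n m => [|n IH] [|m]; rewrite ?bin0 ?expn_gt0 //.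
by rewrite binS expnS mul2n -addnn leq_add.
Qed.

Lemma central_bin_ge h : (2 ^ h <= 'C(h.*2, h))%N.
Proof.
elim: h => [//|h IH]; rewrite doubleS binS expnS mul2n -addnn leq_add //.
  by rewrite binS (leq_trans IH) // leq_addl.
case: h IH => [//|h] IH; rewrite binS (leq_trans IH) // leq_addr //.
Qed.

(** For [uphalf N < a <= N] both [N./2] and [N - N./2] are below [a] and their sum is not, so the
    carry is [1]; and ['C(N, N./2) <= 2 ^ N] with [ln 2 <= 1]. *)
Lemma chebyshev_psi_half N :
  chebyshev_psi N <= chebyshev_psi (uphalf N) + N%:R.
Proof.
have hN : (N./2 <= N)%N by lia.
have ln2N : ln 'C(N, N./2)%:R <= N%:R :> R.
  apply: (@le_trans _ _ (ln (2 ^ N)%N%:R)).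
    by rewrite ler_ln ?posrE ?ltr0n ?bin_gt0 ?expn_gt0 // ler_nat bin_le_exp2.
  rewrite natrX lnXn // -[X in _ <= X]mul1r -[X in X <= _]mulr_natr ler_wpM2r //.
  by have := @le_ln1Dx R 1; rewrite (_ : 1 + 1 = 2) //; apply; lra.
apply: le_trans (lerD (lexx _) ln2N); rewrite (ln_bin hN).
rewrite /chebyshev_psi (@big_cat_nat _ _ _ (uphalf N).+1 1%N N.+1) //=; last by lia.
rewrite lerD2l (@big_cat_nat _ _ _ (uphalf N).+1 1%N N.+1) //=; last by lia.
rewrite -[X in X <= _]add0r lerD ?sumr_ge0 // => [i _|].
  by rewrite mulr_ge0 ?vonMangoldt_ge0.
rewrite le_eqVlt; apply/orP; left; apply/eqP.
apply: eq_big_nat => a /andP[ua aN].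
by rewrite !modn_small ?subnKC -?[(a <= N)%N]ltnS ?aN ?mulr1 //; lia.
Qed.

Lemma chebyshev_psi_le N : chebyshev_psi N <= 4 * N%:R.
Proof.
have [n] := ubnP N; elim: n N => // n IH [|[|N]] Nn.
- by rewrite /chebyshev_psi big_geq // mulr0.
- rewrite /chebyshev_psi big_nat1.
  have := @sum_vonMangoldt_divisors R 1 isT; rewrite big_mkcond big_nat1 dvdnn ln1 => ->.
  by rewrite mulr1.
(* The constant [4] absorbs the rounding up: [4 * uphalf n + n <= 4 * n] for [n >= 2]. *)
apply: le_trans (chebyshev_psi_half _) _.
have uN : (uphalf N.+2 < n)%N by lia.
apply: (le_trans (lerD (IH _ uN) (lexx _))).
by rewrite -natrM -natrD -natrM ler_nat; lia.
Qed.

Lemma chebyshev_psi_ge N : N./2%:R * ln 2 <= chebyshev_psi N.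
Proof.
apply: le_trans (ler_chebyshev_psi (_ : N./2.*2 <= N)%N); last by lia.
have hN : (N./2 <= N./2.*2)%N by lia.
apply: (@le_trans _ _ (ln 'C(N./2.*2, N./2)%:R)).
  rewrite mulr_natl -lnXn // -natrX ler_ln ?posrE ?ltr0n ?bin_gt0 ?expn_gt0 //.
  by rewrite ler_nat central_bin_ge.
rewrite (ln_bin hN); apply: ler_sum => a _.
by rewrite ler_piMr ?vonMangoldt_ge0 //; case: (_ <= _)%N.
Qed.

Lemma sum_prime_powers_le p N : prime p -> (p <= N)%N ->
  \sum_(1 <= k < N.+1 | (p ^ k <= N)%N) ln p%:R <= ln N%:R :> R.
Proof.
move=> pp pN; have p1 := prime_gt1 pp; have p0 := prime_gt0 pp.
have N0 : (0 < N)%N := leq_trans p0 pN.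
set t := trunc_log p N.
apply: (@le_trans _ _ (\sum_(1 <= k < t.+1) ln p%:R)); last first.
  rewrite sumr_const_nat subn1 /= -lnXn ?ltr0n // -natrX ler_ln_nat ?expn_gt0 ?p0 //.
  exact: trunc_logP.
rewrite (eq_bigl (fun k => k <= t)%N); last first.
  move=> k; apply/idP/idP => [|kt]; first exact: trunc_log_max.
  by apply: leq_trans (trunc_logP p1 N0); rewrite leq_exp2l.
have tN : (t <= N)%N by apply: ltnW; apply: leq_trans (ltn_expl t p1) (trunc_logP p1 N0).
rewrite (@big_cat_nat _ _ _ t.+1 1%N N.+1) //= [X in _ + X]big_nat_cond.
rewrite [X in _ + X]big_pred0 ?addr0; last by move=> k; lia.
rewrite big_mkcond /=; apply: ler_sum => k _; case: ifP => // _.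
exact: ln_nat_ge0.
Qed.

Lemma prime_piE N : (prime_pi N)%:R = \sum_(1 <= p < N.+1 | prime p) 1 :> R.
Proof.
rewrite /prime_pi -sum1_count natr_sum -[iota 0 N.+1]/(index_iota 0 N.+1).
by rewrite [LHS]big_mkcond big_ltn //= add0r [RHS]big_mkcond.
Qed.

Lemma chebyshev_psi_prime_pi N : chebyshev_psi N <= (prime_pi N)%:R * ln N%:R.
Proof.
rewrite prime_piE mulr_suml /chebyshev_psi.
rewrite (eq_bigr (fun n => vonMangoldt n * 1)) => [|n _]; last by rewrite mulr1.
rewrite (sum_vonMangoldt N (fun=> 1)) big_nat_cond [leRHS]big_nat_cond.
apply: ler_sum => p /andP[/andP[p0 pN] pp]; rewrite mul1r.
under eq_bigr do rewrite mulr1.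
exact: sum_prime_powers_le.
Qed.

(** A nonprime in the support of [vonMangoldt] is [p ^ k] with [k >= 2], so [p <= s]; the powers of
    one prime contribute at most [ln N]. *)
Lemma sum_vonMangoldt_nonprime_le N s : (N < s.+1 ^ 2)%N ->
  \sum_(1 <= n < N.+1 | ~~ prime n) vonMangoldt n <= s%:R * ln N%:R :> R.
Proof.
move=> Ns; rewrite big_mkcond.
rewrite (eq_bigr (fun n => vonMangoldt n * (~~ prime n)%:R)); last first.
  by move=> n _; case: ifP; rewrite ?mulr1 ?mulr0.
rewrite sum_vonMangoldt.
have -> : s%:R * ln N%:R = \sum_(1 <= p < s.+1) ln N%:R :> R.
  by rewrite sumr_const_nat subn1 mulr_natl.
apply: (@le_trans _ _ (\sum_(1 <= p < N.+1 | prime p && (p <= s)%N) ln N%:R)).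
  rewrite big_nat_cond [leRHS]big_nat_cond [leRHS]big_mkcond /=.
  rewrite [leLHS]big_mkcond; apply: ler_sum => p _.
  case: ifPn => [/andP[/andP[p0 pN] pp]|]; last first.
    by move=> _; case: ifP => // _; exact: ln_nat_ge0.
  rewrite p0 pN pp /=; case: ifPn => [_|].
    apply: le_trans (sum_prime_powers_le pp _) => //.
    apply: ler_sum => k _.
    by rewrite ler_piMr ?ln_nat_ge0 //; case: (prime _).
  rewrite -ltnNge => sp.
  rewrite big_nat_cond big1 // => k /andP[/andP[k0 kN] pkN].
  case: k k0 kN pkN => // -[|k] _ _; first by rewrite expn1 pp mulr0.
  move=> pkN; have : (s.+1 ^ 2 <= N)%N.
    apply: leq_trans pkN; apply: (@leq_trans (p ^ 2)); first by rewrite leq_exp2r.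
    by rewrite leq_exp2l // prime_gt1.
  by rewrite leqNgt Ns.
have lnN := @ln_nat_ge0 R N.
case: (leqP s N) => [sN|Ns'].
  rewrite (@big_cat_nat _ _ _ s.+1 1%N N.+1) //= [X in _ + X]big_nat_cond.
  rewrite [X in _ + X]big_pred0 ?addr0; last by move=> k; lia.
  by rewrite big_mkcond; apply: ler_sum => k _; case: ifP.
rewrite (@big_cat_nat _ _ _ N.+1 1%N s.+1) //=; last exact: ltnW.
rewrite -[leLHS]addr0; apply: lerD; last by apply: sumr_ge0.
by rewrite big_mkcond; apply: ler_sum => k _; case: ifP.
Qed.

End Chebyshev.

(** * Smooth numbers *)

Section SmoothSums.
Context {R : realType}.

(** A partial Euler product. The bound [P = (1 - 1/p)^(-1) B] satisfies [P = P / p + B]: the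
    summands divisible by [p] are [1/p] times a shorter sum of the same kind, the others involve
    only [ps]. *)
Lemma sum_smooth_le (ps : seq nat) X : all prime ps ->
  \sum_(1 <= s < X.+1 | all (mem ps) (primes s)) (s%:R^-1 : R)
   <= \prod_(p <- ps) (1 - p%:R^-1)^-1.
Proof.
elim: ps X => [|p ps IH] X /=.
  move=> _; rewrite big_nil big_nat_cond big_mkcond /=.
  case: X => [|X]; first by rewrite big_geq.
  rewrite big_ltn //= invr1 big_nat big1 ?addr0 // => s /andP[s1 sX].
  have : pdiv s \in primes s by rewrite mem_primes pdiv_prime // pdiv_dvd andbT; lia.
  by case: (primes s) => //= p l _; rewrite andbF.
move=> /andP[pp aps]; rewrite big_cons.
set B := \prod_(_ <- _) _.
have p1 : (1 : R) < p%:R by rewrite ltr1n prime_gt1.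
have pi1 : 0 < 1 - p%:R^-1 :> R by rewrite subr_gt0 invf_lt1 // (lt_trans ltr01).
have B0 : 0 <= B.
  rewrite /B big_seq; apply: prodr_ge0 => r /(allP aps) pr.
  by rewrite invr_ge0 subr_ge0 invf_le1 ?ltr0n ?prime_gt0 // ler1n prime_gt0.
have [n] := ubnP X; elim: n X => // n IHn X Xn.
case: X Xn => [|X] Xn.
  by rewrite big_geq // mulr_ge0 // invr_ge0 ltW.
rewrite (bigID (fun s => p %| s)%N) /=.
have -> : (1 - p%:R^-1)^-1 * B = p%:R^-1 * ((1 - p%:R^-1)^-1 * B) + B.
  by field; rewrite !gt_eqF // ?subr_gt0 // (lt_trans ltr01).
apply: lerD.
  under eq_bigl do rewrite andbC.
  rewrite big_mkcondr sum_multiples ?prime_gt0 //=.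
  have Xpn : (X.+1 %/ p < n)%N.
    exact: leq_trans (ltn_Pdiv (prime_gt1 pp) _) _.
  apply: le_trans (ler_wpM2l _ (IHn _ Xpn)); last by rewrite invr_ge0.
  rewrite mulr_sumr [leRHS]big_mkcond /=; apply: ler_sum_nat => b /andP[b0 _].
  rewrite natrM invfM; case: ifP => [h|_]; last by case: ifP; rewrite ?divr_ge0 ?mulr_ge0 ?invr_ge0.
  rewrite ifT //; apply/allP => r rb; apply: (allP h).
  by rewrite (primesM _ (prime_gt0 pp) b0); apply/orP; right.
rewrite big_mkcondr /=; apply: (le_trans _ (IH X.+1 aps)).
rewrite [leRHS]big_mkcond [leLHS]big_mkcond /=; apply: ler_sum_nat => s /andP[s0 _].
case: ifP => [h|_]; last by case: ifP; rewrite // invr_ge0.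
case: ifPn => [ps'|_]; last by case: ifP; rewrite // invr_ge0.
rewrite ifT //; apply/allP => r rs.
have := allP h _ rs; rewrite inE => /orP[/eqP rp|//].
by move: rs; rewrite rp mem_primes (negbTE ps') !andbF.
Qed.

(** The left side is [q / phi(q)]. In its square, [(p / (p - 1)) ^ 2 <= p] for [p >= 3], while
    [p = 2] gives [4 = 2 p]; and the product of the primes of [q] is at most [q]. *)
Lemma prod_primes_le q : (0 < q)%N ->
  \prod_(p <- primes q) (1 - p%:R^-1)^-1 <= Num.sqrt (2 * q%:R) :> R.
Proof.
move=> q0; set P := \prod_(_ <- _) _.
have P0 : 0 <= P.
  rewrite /P big_seq; apply: prodr_ge0 => r; rewrite mem_primes => /andP[pr _].
  by rewrite invr_ge0 subr_ge0 invf_le1 ?ltr0n ?prime_gt0 // ler1n prime_gt0.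
rewrite -(ler_pXn2r (_ : 0 < 2)%N) ?nnegrE ?sqrtr_ge0 // sqr_sqrtr ?mulr_ge0 //.
have prodq : (\prod_(p <- primes q) p <= q)%N.
  rewrite [leqRHS](prod_prime_decomp q0) prime_decompE big_map /=.
  rewrite big_seq [leqRHS]big_seq; apply: leq_prod => p pq.
  rewrite -[leqLHS]expn1 leq_pexp2l ?logn_gt0 //.
  by move: pq; rewrite mem_primes => /andP[/prime_gt0].
have Ple : P ^+ 2 <= \prod_(p <- primes q) ((if p == 2 then 2 else 1) * p%:R).
  rewrite /P -prodrXl big_seq [leRHS]big_seq; apply: ler_prod => p.
  rewrite mem_primes => /andP[pp _]; rewrite exprn_even_ge0 //=.
  have p2 : 2 <= p%:R :> R by rewrite ler_nat prime_gt1.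
  have -> : (1 - p%:R^-1)^-1 = p%:R / (p%:R - 1) :> R.
    by field; rewrite !gt_eqF //; lra.
  rewrite expr_div_n ler_pdivrMr ?exprn_gt0 //; last by lra.
  case: eqP => [->|/eqP pn2]; first by lra.
  have p3 : 3 <= p%:R :> R by rewrite ler_nat ltn_neqAle eq_sym pn2 prime_gt1.
  by rewrite mul1r expr2 ler_pM2l; nra.
apply: le_trans Ple _; rewrite big_split /=; apply: ler_pM => //.
- by apply: prodr_ge0 => p _; case: ifP.
- by apply: prodr_ge0.
- have [h2|h2] := boolP (2 \in primes q).
    rewrite (bigD1_seq 2) ?primes_uniq //= big1 ?mulr1 // => i /negbTE -> //.
  rewrite big_seq big1 ?ler1n // => i iq; case: eqP => // i2.
  by rewrite i2 (negbTE h2) in iq.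
- by rewrite -natr_prod ler_nat.
Qed.

(** Euler's argument: [ln X] is below the harmonic sum, this is below the Euler product over the
    primes up to [X], and that is at most [exp(2 sum 1/p)]. Hence the double exponential as
    witness. *)
Lemma sum_inv_primes_unbounded (A : R) : exists X : nat,
  A <= \sum_(1 <= p < X.+1 | prime p) p%:R^-1.
Proof.
pose X := (Num.truncn (expR (expR (2 * A)))).+1.
have XA : expR (2 * A) <= ln X.+1%:R.
  rewrite -[leLHS]expRK ler_ln ?posrE ?expR_gt0 // (le_trans (ltW (truncnS_gt _))) //.
  by rewrite ler_nat.
have harm : ln X.+1%:R <= \sum_(1 <= s < X.+1) s%:R^-1 :> R.
  elim: X {XA} => [|n IH]; first by rewrite ln1 big_geq.
  rewrite big_nat_recr //=.
  have -> : n.+2%:R = n.+1%:R * (1 + n.+1%:R^-1) :> R.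
    by rewrite mulrDr mulr1 divff ?pnatr_eq0 // natr1.
  have i0 : 0 < n.+1%:R^-1 :> R by rewrite invr_gt0.
  rewrite lnM ?posrE ?addr_gt0 //.
  by apply: lerD => //; apply: le_ln1Dx; apply: lt_trans i0; rewrite ltrN10.
pose s := [seq p <- iota 1 X | prime p].
have prs : all prime s by apply/allP => p; rewrite mem_filter => /andP[].
exists X; have -> : \sum_(1 <= p < X.+1 | prime p) p%:R^-1 = \sum_(p <- s) p%:R^-1 :> R.
  by rewrite /s big_filter /index_iota subn1.
have smX := sum_smooth_le X prs.
have : \prod_(p <- s) (1 - p%:R^-1)^-1 <= expR (2 * \sum_(p <- s) p%:R^-1) :> R.
  rewrite mulr_sumr expR_sum big_seq [leRHS]big_seq; apply: ler_prod => p /(allP prs) pp.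
  have p1 : (1 : R) < p%:R by rewrite ltr1n prime_gt1.
  have p0 : 0 < p%:R :> R by rewrite (lt_trans ltr01).
  have p2 : 0 < p%:R - 1 :> R by rewrite subr_gt0.
  rewrite invr_ge0 subr_ge0 invf_le1 // ltW //=.
  have -> : (1 - p%:R^-1)^-1 = 1 + (p%:R - 1)^-1 :> R by field; rewrite !gt_eqF.
  apply: le_trans (expR_ge1Dx _) _; rewrite ler_expR.
  rewrite -[leLHS]mul1r ler_pdivrMr // mulrAC ler_pdivlMr // mul1r.
  have : 2 <= p%:R :> R by rewrite ler_nat prime_gt1.
  lra.
move=> le2; rewrite -(ler_pM2l (_ : 0 < 2)) // -ler_expR.
apply: le_trans XA (le_trans harm (le_trans _ (le_trans smX le2))).
rewrite [leRHS]big_mkcond; apply: ler_sum_nat => n /andP[n0 nX].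
rewrite ifT //; apply/allP => p; rewrite mem_primes => /and3P[pp _ pn].
rewrite -[mem s p]/(p \in s) mem_filter pp mem_iota prime_gt0 //= add1n; apply: leq_ltn_trans nX.
exact: dvdn_leq pn.
Qed.
End SmoothSums.

(** * The circle *)

Section Circle.
Context {R : realType}.
Implicit Types (t x y : R) (z w : R[i]).

(** The norm of [R[i]] has values in [R[i]]; this is the same modulus in the totally ordered field
    [R]. *)
Definition cabs z : R := complex.Re `|z|.

Lemma cabsE z : (cabs z)%:C%C = `|z|.
Proof. by rewrite /cabs normc_def. Qed.

Lemma cabs_ge0 z : 0 <= cabs z.
Proof. by rewrite -ler0c cabsE. Qed.

Lemma cabsD z w : cabs (z + w) <= cabs z + cabs w.
Proof. by rewrite -lecR rmorphD /= !cabsE ler_normD. Qed.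

Lemma cabsM z w : cabs (z * w) = cabs z * cabs w.
Proof. by apply: complexI; rewrite rmorphM /= !cabsE normrM. Qed.

Lemma cabsN z : cabs (- z) = cabs z.
Proof. by apply: complexI; rewrite !cabsE normrN. Qed.

Lemma cabsB z w : cabs (z - w) <= cabs z + cabs w.
Proof. by rewrite -(cabsN w) cabsD. Qed.

Lemma cabs_distrC z w : cabs (z - w) = cabs (w - z).
Proof. by rewrite -cabsN opprB. Qed.

Lemma cabs0 : cabs 0 = 0 :> R.
Proof. by apply: complexI; rewrite cabsE normr0. Qed.

Lemma cabs1 : cabs 1 = 1 :> R.
Proof. by apply: complexI; rewrite cabsE normr1. Qed.

Lemma cabs_real x : cabs x%:C%C = `|x|.
Proof. by apply: complexI; rewrite cabsE normc_def /= expr0n addr0 sqrtr_sqr. Qed.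

Lemma cabs_int (k : int) : cabs k%:~R = `|k%:~R|.
Proof. by rewrite -(rmorph_int (real_complex R)) cabs_real. Qed.

Lemma cabs_sum (I : Type) (r : seq I) (P : pred I) (F : I -> R[i]) :
  cabs (\sum_(i <- r | P i) F i) <= \sum_(i <- r | P i) cabs (F i).
Proof.
elim/big_rec2: _ => [|i y z _ le]; first by rewrite cabs0.
exact: le_trans (cabsD _ _) (lerD (lexx _) le).
Qed.

Lemma cabs_sqr z : (cabs z ^+ 2)%:C%C = z * z^*%C.
Proof. by rewrite rmorphXn /= cabsE sqr_normc. Qed.

Lemma Re_le_cabs z : `|complex.Re z| <= cabs z.
Proof. by rewrite -lecR cabsE normc_ge_Re. Qed.

Lemma Im_le_cabs z : `|complex.Im z| <= cabs z.
Proof.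
case: z => a b; rewrite /cabs normc_def /= -sqrtr_sqr ler_wsqrtr //.
by rewrite lerDr sqr_ge0.
Qed.

Definition circ t : R[i] := Complex (cos (2 * pi * t)) (sin (2 * pi * t)).

Lemma circ0 : circ 0 = 1.
Proof. by rewrite /circ mulr0 cos0 sin0. Qed.

Lemma circD x y : circ (x + y) = circ x * circ y.
Proof.
rewrite /circ mulrDr cosD sinD; apply/eqP; rewrite eq_complex /=.
by rewrite eqxx addrC /= addrC.
Qed.

Lemma circN x : circ (- x) = (circ x)^*%C.
Proof. by rewrite /circ mulrN cosN sinN. Qed.

Lemma cabs_circ x : cabs (circ x) = 1.
Proof. by rewrite /cabs normc_def /= cos2Dsin2 sqrtr1. Qed.

Lemma circ1 : circ 1 = 1.
Proof. by rewrite /circ mulr1 mulr_natl cos2pi sin2pi. Qed.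

Lemma circMn x n : circ (n%:R * x) = circ x ^+ n.
Proof.
elim: n => [|n IH]; first by rewrite mul0r circ0.
by rewrite -natr1 mulrDl mul1r circD IH exprSr.
Qed.

Lemma circ_nat n : circ n%:R = 1.
Proof. by rewrite -[n%:R]mulr1 circMn circ1 expr1n. Qed.

Lemma circ_int (k : int) : circ k%:~R = 1.
Proof.
case: k => n; first by rewrite -pmulrn circ_nat.
by rewrite NegzE mulrNz circN -pmulrn circ_nat conjc1.
Qed.

Lemma circDint x (k : int) : circ (x + k%:~R) = circ x.
Proof. by rewrite circD circ_int mulr1. Qed.

Definition nint t : int := Num.floor (t + 2^-1).
(** The distance to the nearest integer, usually written [||t||]: the norm of the circle group. *)
Definition nd t : R := `|t - (nint t)%:~R|.

Lemma nd_ge0 t : 0 <= nd t. Proof. exact: normr_ge0. Qed.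

Lemma nd_le_half t : nd t <= 2^-1.
Proof.
have := floor_le (t + 2^-1); have := floorD1_gt (t + 2^-1).
by rewrite /nd /nint intrD ler_norml; lra.
Qed.

Lemma nd_le t (k : int) : nd t <= `|t - k%:~R|.
Proof.
have [<-//|nk] := eqVneq (nint t) k.
apply: le_trans (nd_le_half t) _; have := nd_le_half t; rewrite /nd.
set m := nint t in nk *; have : 1 <= `|m%:~R - k%:~R| :> R.
  by rewrite -intrB -intr_norm (ler_int _ 1) -gtz0_ge1 normr_gt0 subr_eq0.
have : `|m%:~R - k%:~R| <= `|t - m%:~R| + `|t - k%:~R|.
  by rewrite (distrC t) (le_trans _ (ler_normD _ _)) // addrA subrK.
lra.
Qed.

Lemma nd_int (k : int) : nd k%:~R = 0.
Proof. by apply/le_anti; rewrite nd_ge0 andbT (le_trans (nd_le _ k)) ?subrr ?normr0. Qed.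

Lemma nd_eq0 t : nd t = 0 -> exists k : int, t = k%:~R.
Proof. by move/normr0_eq0/eqP; rewrite subr_eq0 => /eqP; exists (nint t). Qed.

Lemma ndD x y : nd (x + y) <= nd x + nd y.
Proof.
apply: le_trans (nd_le _ (nint x + nint y)) _; rewrite intrD opprD addrACA.
exact: ler_normD.
Qed.

Lemma ndN x : nd (- x) = nd x.
Proof.
have le u : nd (- u) <= nd u.
  by apply: le_trans (nd_le _ (- nint u)) _; rewrite mulrNz opprK addrC distrC.
by apply/le_anti; rewrite le /= -{1}[x]opprK le.
Qed.

Lemma nd_norm x : nd x <= `|x|.
Proof. by have := nd_le x 0; rewrite subr0. Qed.

Lemma ndB x y : nd (x - y) <= nd x + nd y.
Proof. by rewrite -(ndN y) ndD. Qed.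

Lemma ndDint x (k : int) : nd (x + k%:~R) = nd x.
Proof.
have le u (j : int) : nd (u + j%:~R) <= nd u.
  by rewrite (le_trans (ndD _ _)) // nd_int addr0.
by apply/le_anti; rewrite le /= -{1}[x](addrK k%:~R) -mulrNz le.
Qed.

Lemma circ_sub1_double t : cabs (circ (2 * t) - 1) <= 2 * cabs (circ t - 1).
Proof.
rewrite (_ : circ (2 * t) - 1 = (circ t - 1) * (circ t + 1)); last first.
  by rewrite circMn subr_sqr_1.
rewrite cabsM mulrC ler_wpM2r ?cabs_ge0 //.
by apply: le_trans (cabsD _ _) _; rewrite cabs_circ cabs1.
Qed.

(** Since [|e(2t) - 1| <= 2 |e(t) - 1|], doubling reduces to [1/4 <= t <= 1/2], where [e(t)] has
    nonpositive real part and the modulus is at least [1]. *)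
Lemma circ_sub1_ge_half t : 0 <= t <= 2^-1 -> 2 * t <= cabs (circ t - 1).
Proof.
move=> /andP[t0 t1].
have quarter x : 4^-1 <= x -> x <= 2^-1 -> 2 * x <= cabs (circ x - 1).
  move=> x0 x1; apply: (@le_trans _ _ 1); first by lra.
  apply: le_trans (Re_le_cabs _) => /=.
  have pi0 := @pi_gt0 R.
  rewrite (_ : 2 * pi * x = (2 * pi * x - pi / 2) + pi / 2); last by rewrite subrK.
  rewrite cosDpihalf; set u := 2 * pi * x - pi / 2.
  have u0 : 0 <= sin u by apply: sin_ge0_pi; rewrite /u; nra.
  by rewrite -opprD normrN ger0_norm ?lerDr // addr_ge0.
move: t0; rewrite le_eqVlt => /orP[/eqP <-|t0].
  by rewrite mulr0 cabs_ge0.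
have [n nt] : exists n, 4^-1 <= 2 ^+ n * t.
  exists (Num.truncn (4^-1 / t)).+1; rewrite -ler_pdivrMr //.
  apply: le_trans (ltW (truncnS_gt _)) _.
  by rewrite -natrX ler_nat ltnW // ltn_expl.
elim: n t t0 t1 nt => [|n IH] x x0 x1; first by rewrite mul1r => xq; exact: quarter.
move=> xn; have [xq|xq] := leP 4^-1 x; first exact: quarter.
rewrite -(ler_pM2l (_ : 0 < 2)) //; apply: le_trans (circ_sub1_double x).
by apply: IH; [lra|lra|rewrite mulrA -exprSr].
Qed.

Lemma circ_sub1_ge t : 2 * nd t <= cabs (circ t - 1).
Proof.
set s := t - (nint t)%:~R.
have -> : circ t = circ s by rewrite /s -mulrNz circDint.
have -> : cabs (circ s - 1) = cabs (circ `|s| - 1).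
  have [s0|s0] := leP 0 s; first by rewrite ger0_norm.
  rewrite ltr0_norm // circN -[X in _ = cabs (_ - X)]conjc1 -rmorphB.
  by apply: complexI; rewrite !cabsE normcJ.
by apply: circ_sub1_ge_half; rewrite normr_ge0 nd_le_half.
Qed.

(** The geometric sum is at most [2 / |e(t) - 1|], to which [circ_sub1_ge] applies. *)
Lemma sum_circ_le t (a b : nat) : 0 < nd t ->
  cabs (\sum_(a <= m < b) circ (m%:R * t)) <= (nd t)^-1.
Proof.
move=> t0; have [ab|ba] := leqP a b; last first.
  by rewrite big_geq ?cabs0 ?invr_ge0 ?nd_ge0 // ltnW.
have c0 : 0 < cabs (circ t - 1) by apply: lt_le_trans (circ_sub1_ge t); rewrite mulr_gt0.
have E : (circ t - 1) * \sum_(a <= m < b) circ (m%:R * t)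
    = circ (b%:R * t) - circ (a%:R * t).
  rewrite mulr_sumr -(@telescope_sumr _ _ _ (fun m => circ (m%:R * t))) //.
  apply: eq_bigr => m _; rewrite mulrBl mul1r -circD -natr1 mulrDl mul1r.
  by rewrite [t + _]addrC.
have : cabs (circ t - 1) * cabs (\sum_(a <= m < b) circ (m%:R * t)) <= 2.
  by rewrite -cabsM E (le_trans (cabsB _ _)) // !cabs_circ.
move=> le2; rewrite -[leRHS]mul1r ler_pdivlMr //.
have := circ_sub1_ge t; have := cabs_ge0 (\sum_(a <= m < b) circ (m%:R * t)).
nra.
Qed.

Lemma abel_bound (l : nat -> R) (z : nat -> R[i]) (U : R) (a b : nat) :
  (a <= b)%N -> {homo l : m n / (m <= n)%N >-> m <= n} -> 0 <= l a ->
  (forall c, cabs (\sum_(a <= m < c) z m) <= U) ->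
  cabs (\sum_(a <= m < b.+1) (l m)%:C%C * z m) <= 2 * U * l b.
Proof.
move=> ab lmono la ZU.
pose Z c := \sum_(a <= m < c) z m.
have -> : \sum_(a <= m < b.+1) (l m)%:C%C * z m = (l b)%:C%C * Z b.+1
    - \sum_(a <= m < b) (l m.+1 - l m)%:C%C * Z m.+1.
  elim: b ab => [|b IH] ab.
    rewrite /Z; case: a ab {la ZU Z} => // _; rewrite !big_nat1 big_geq // subr0 //.
  rewrite big_nat_recr //=; move: ab; rewrite leq_eqVlt => /orP[/eqP ab|ab].
    rewrite [\sum_(a <= i < b.+1) _ * _]big_geq; last by rewrite ab.
    by rewrite [X in _ - X]big_geq ?ab // subr0 add0r /Z ab big_nat1.
  rewrite IH // [X in _ = _ - X]big_nat_recr //= /Z.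
  rewrite (@big_nat_recr _ _ _ b.+1 a) //=; last exact: ltnW.
  by rewrite rmorphB /=; ring.
have U0 : 0 <= U by apply: le_trans (ZU a); rewrite cabs_ge0.
have lb : 0 <= l b by apply: le_trans la _; apply: lmono.
apply: le_trans (cabsB _ _) _; rewrite -mulrA mulrDl mul1r; apply: lerD.
  by rewrite cabsM cabs_real ger0_norm // mulrC ler_wpM2r //; exact: ZU.
apply: le_trans (cabs_sum _ _ _) _.
apply: (@le_trans _ _ (\sum_(a <= m < b) U * (l m.+1 - l m))).
  apply: ler_sum => m _; rewrite cabsM cabs_real ger0_norm ?subr_ge0 ?lmono //.
  by rewrite mulrC ler_wpM2r ?subr_ge0 ?lmono //; exact: ZU.
by rewrite -mulr_sumr telescope_sumr // ler_wpM2l // gerBl.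
Qed.

End Circle.

(** * Davenport's theorem *)

Section Davenport.
Context {R : realType}.

Lemma sqr_sum_le N (x : nat -> R) :
  (\sum_(1 <= n < N.+1) x n) ^+ 2 <= N%:R * \sum_(1 <= n < N.+1) x n ^+ 2.
Proof.
case: N => [|N]; first by rewrite !big_geq // mulr0 expr0n.
set S := \sum_(_ <= n < _) x n; set Q := \sum_(_ <= n < _) x n ^+ 2.
have : 0 <= \sum_(1 <= n < N.+2) (N.+1%:R * x n - S) ^+ 2.
  by apply: sumr_ge0 => n _; exact: sqr_ge0.
have -> : \sum_(1 <= n < N.+2) (N.+1%:R * x n - S) ^+ 2
    = N.+1%:R * (N.+1%:R * Q - S ^+ 2).
  transitivity (\sum_(1 <= n < N.+2) (N.+1%:R ^+ 2 * x n ^+ 2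
      + ((- 2 * N.+1%:R * S) * x n + S ^+ 2))).
    by apply: eq_bigr => n _; ring.
  rewrite !big_split /= -!mulr_sumr -/S -/Q sumr_const_nat subn1 /= -mulr_natl.
  ring.
by rewrite pmulr_rge0 ?ltr0n // subr_ge0.
Qed.

Lemma sum_inv_sqr_le X : \sum_(1 <= p < X.+1 | prime p) p%:R ^- 2 <= 1 :> R.
Proof.
(* The induction runs on a stronger bound, since [1 / p ^ 2 <= 1 / (p - 1) - 1 / p] telescopes. *)
suff H : \sum_(1 <= p < X.+1 | prime p) p%:R ^- 2 <= 1 - X%:R^-1 :> R.
  by apply: le_trans H _; rewrite gerBl invr_ge0.
elim: X => [|X IH]; first by rewrite big_geq // invr0 subr0.
rewrite big_mkcond big_nat_recr //= -big_mkcond.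
case: X IH => [|X] IH; first by rewrite big_geq // add0r invr1 subrr.
case: ifP => _; last first.
  rewrite addr0; apply: le_trans IH _.
  by rewrite lerD2l lerN2 lef_pV2 ?posrE ?ltr0n // ler_nat.
apply: le_trans (lerD IH (lexx _)) _.
rewrite -addrA lerD2l -subr_ge0.
have x0 : 0 < X.+1%:R :> R by rewrite ltr0n.
rewrite -[X.+2%:R]natr1; set x := X.+1%:R in x0 *.
rewrite (_ : _ - _ = ((x + 1) ^+ 2 * x)^-1); last first.
  by field; rewrite !gt_eqF //; lra.
by rewrite invr_ge0 mulr_ge0 ?sqr_ge0; lra.
Qed.

Lemma natdiv_le (N p : nat) : (N %/ p)%:R <= N%:R / p%:R :> R.
Proof.
case: p => [|p]; first by rewrite divn0 invr0 mulr0.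
by rewrite ler_pdivlMr ?ltr0n // -natrM ler_nat leq_divM.
Qed.

Lemma natdiv_ge (N p : nat) : (0 < p)%N -> N%:R / p%:R - 1 <= (N %/ p)%:R :> R.
Proof.
move=> p0; rewrite lerBlDr ler_pdivrMr ?ltr0n // natr1 -natrM ler_nat.
by rewrite ltnW // ltn_ceil.
Qed.

Lemma count_multiples (p N : nat) : (0 < p)%N ->
  \sum_(1 <= n < N.+1) (p %| n)%N%:R = (N %/ p)%:R :> R.
Proof.
move=> p0; rewrite (eq_bigr (fun n => if (p %| n)%N then 1 else 0)); last first.
  by move=> n _; case: ifP.
by rewrite -big_mkcond /= (sum_multiples _ (fun=> 1)) // sumr_const_nat subn1.
Qed.

Lemma sum_delta_le (P : pred nat) (p X : nat) (c : R) : 0 <= c ->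
  \sum_(1 <= r < X.+1 | P r) (if r == p then c else 0) <= c.
Proof.
move=> c0; apply: (@le_trans _ _ (\sum_(1 <= r < X.+1) (if r == p then c else 0))).
  rewrite big_mkcond; apply: ler_sum => r _.
  by case: (P r) => //; case: ifP.
have [pX|pX] := boolP (p \in index_iota 1 X.+1).
  rewrite (bigD1_seq p) ?iota_uniq //= eqxx big1 ?addr0 // => r /negbTE -> //.
rewrite big_seq big1 // => r rX; case: eqP => // rp.
by rewrite -rp rX in pX.
Qed.

Section TuranKubilius.
Context (X N : nat).
Let A : R := \sum_(1 <= p < X.+1 | prime p) p%:R^-1.
Let omega (n : nat) : R := \sum_(1 <= p < X.+1 | prime p) (p %| n)%N%:R.

(** Expanding the square, distinct primes [p] and [r] have [N %/ (p r) <= N / (p r)] common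
    multiples, so the second moment is bounded without a rounding error; only the first moment has
    one, at the price of [2 A X]. *)
Lemma turan_kubilius :
  \sum_(1 <= n < N.+1) (omega n - A) ^+ 2 <= N%:R * A + 2 * A * X%:R.
Proof.
have A0 : 0 <= A by apply: sumr_ge0 => p _; rewrite invr_ge0.
have S1 : N%:R * A - X%:R <= \sum_(1 <= n < N.+1) omega n.
  rewrite /omega exchange_big /= /A mulr_sumr lerBlDr.
  rewrite [X in _ <= _ + X](_ : _ = \sum_(1 <= p < X.+1) 1); last first.
    by rewrite sumr_const_nat subn1.
  apply: (@le_trans _ _ (\sum_(1 <= p < X.+1 | prime p)
      (\sum_(1 <= n < N.+1) (p %| n)%N%:R + 1))).
    apply: ler_sum => p pp; rewrite count_multiples ?prime_gt0 // -lerBlDr.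
    by rewrite natdiv_ge // prime_gt0.
  rewrite big_split /= lerD2l big_mkcond; apply: ler_sum => p _.
  by case: ifP.
have S2 : \sum_(1 <= n < N.+1) omega n ^+ 2 <= N%:R * A + N%:R * A ^+ 2.
  have -> : \sum_(1 <= n < N.+1) omega n ^+ 2 =
      \sum_(1 <= p < X.+1 | prime p) \sum_(1 <= r < X.+1 | prime r)
        \sum_(1 <= n < N.+1) (p %| n)%N%:R * (r %| n)%N%:R.
    transitivity (\sum_(1 <= n < N.+1) \sum_(1 <= p < X.+1 | prime p)
        \sum_(1 <= r < X.+1 | prime r) ((p %| n)%N%:R * (r %| n)%N%:R : R)).
      apply: eq_bigr => n _; rewrite expr2 mulr_suml; apply: eq_bigr => p _.
      by rewrite mulr_sumr.
    rewrite exchange_big /=; apply: eq_bigr => p _.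
    by rewrite exchange_big.
  apply: (@le_trans _ _ (\sum_(1 <= p < X.+1 | prime p)
     (N%:R / p%:R + \sum_(1 <= r < X.+1 | prime r) N%:R / p%:R / r%:R))).
    apply: ler_sum => p pp; have p0 := prime_gt0 pp.
    have Np : 0 <= N%:R / p%:R :> R by rewrite divr_ge0.
    apply: le_trans (lerD (sum_delta_le prime p X Np) (lexx _)).
    rewrite -big_split /=; apply: ler_sum => r pr; case: eqP => [->|/eqP rp].
      rewrite -[leLHS]addr0; apply: lerD; last by rewrite !divr_ge0.
      rewrite (eq_bigr (fun n => (p %| n)%N%:R)); last first.
        by move=> n _; case: (p %| n)%N; rewrite ?mulr1 ?mulr0.
      by rewrite count_multiples // natdiv_le.
    rewrite add0r (eq_bigr (fun n => (p * r %| n)%N%:R)); last first.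
      move=> n _; rewrite -natrM mulnb Gauss_dvd //.
      by rewrite prime_coprime // dvdn_prime2 // eq_sym.
    rewrite count_multiples ?muln_gt0 ?p0 ?prime_gt0 //.
    by apply: le_trans (natdiv_le _ _) _; rewrite natrM invfM mulrA.
  rewrite big_split /= -mulr_sumr -/A lerD2l.
  rewrite (eq_bigr (fun p => N%:R * A * p%:R^-1)) => [|p _].
    by rewrite -mulr_sumr -/A expr2 mulrA.
  by rewrite -mulr_sumr -/A mulrAC.
have -> : \sum_(1 <= n < N.+1) (omega n - A) ^+ 2 =
    \sum_(1 <= n < N.+1) omega n ^+ 2 - 2 * A * \sum_(1 <= n < N.+1) omega n
      + N%:R * A ^+ 2.
  transitivity (\sum_(1 <= n < N.+1) (omega n ^+ 2 + ((- (2 * A)) * omega n + A ^+ 2))).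
    by apply: eq_bigr => n _; ring.
  rewrite !big_split /= -mulr_sumr sumr_const_nat subn1 /=.
  by rewrite -[_ ^+ 2 *+ _]mulr_natl mulNr addrA.
have : 2 * A * (N%:R * A - X%:R) <= 2 * A * \sum_(1 <= n < N.+1) omega n.
  by rewrite ler_wpM2l // mulr_ge0.
move: S2; set s2 := \sum_(_ <= n < _) _ ^+ 2; set s1 := \sum_(_ <= n < _) _.
nra.
Qed.

End TuranKubilius.
End Davenport.

(** * The bilinear argument of Daboussi and Katai *)

Section Katai.
Context {R : realType}.

(** Irrationality in the form in which the exponential sums use it: no geometric sum degenerates. *)
Definition aperiodic (alpha : R) := forall k : nat, (0 < k)%N -> 0 < nd (k%:R * alpha).

Definition mobius_sum (alpha : R) (N : nat) : R[i] :=
  \sum_(1 <= n < N.+1) (mobius n)%:~R * circ (n%:R * alpha).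

Lemma cabs_mobius_le n z : cabs ((mobius n)%:~R * z) <= cabs z :> R.
Proof.
rewrite cabsM cabs_int -intr_norm ler_piMl ?cabs_ge0 //.
by rewrite (ler_int _ _ 1) mobius_norm.
Qed.

Lemma conjcM_nat (n : nat) (z : R[i]) : (n%:R * z)^*%C = n%:R * z^*%C.
Proof. by rewrite -[RHS](congr1 (fun x => x * _) (conjc_nat R n)) -rmorphM. Qed.

Context (alpha : R) (alphaP : aperiodic alpha) (X : nat).
Let A : R := \sum_(1 <= p < X.+1 | prime p) p%:R^-1.
Let omega (n : nat) : R := \sum_(1 <= p < X.+1 | prime p) (p %| n)%N%:R.
(** The inner sum of a bilinear form in [m] and [p]. Cauchy-Schwarz removes the coefficients
    [mobius m], and only exponentials remain. *)
Let c N m : R[i] := \sum_(1 <= p < X.+1 | prime p)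
  (p * m <= N)%N%:R * circ ((p * m)%:R * alpha).

Let A_ge0 : 0 <= A.
Proof. by apply: sumr_ge0 => p _; rewrite invr_ge0. Qed.

Lemma sum_mul_le (S : pzRingType) (p N : nat) (G : nat -> S) : (0 < p)%N ->
  \sum_(1 <= m < N.+1) (p * m <= N)%N%:R * G m = \sum_(1 <= m < (N %/ p).+1) G m.
Proof.
move=> p0; rewrite (@big_cat_nat _ _ _ (N %/ p).+1 1%N N.+1) //=; last first.
  by rewrite ltnS leq_div.
rewrite [X in _ + X]big_nat [X in _ + X]big1 ?addr0; last first.
  move=> m /andP[pm mN]; rewrite leqNgt (_ : (N < p * m)%N) ?mul0r //.
  by rewrite mulnC -ltn_divLR.
apply: eq_big_nat => m /andP[m0 mN]; rewrite (_ : (p * m <= N)%N) ?mul1r //.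
by rewrite mulnC -leq_divRL.
Qed.

Lemma sum_omega_mobius N :
  \sum_(1 <= n < N.+1) (omega n)%:C%C * ((mobius n)%:~R * circ (n%:R * alpha))
  = \sum_(1 <= p < X.+1 | prime p) \sum_(1 <= m < (N %/ p).+1)
      (mobius (p * m))%:~R * circ ((p * m)%:R * alpha).
Proof.
transitivity (\sum_(1 <= n < N.+1) \sum_(1 <= p < X.+1 | prime p)
  (if (p %| n)%N then (mobius n)%:~R * circ (n%:R * alpha) else 0)).
  apply: eq_bigr => n _; rewrite /omega rmorph_sum /= mulr_suml.
  apply: eq_bigr => p _.
  by case: ifP => _; rewrite ?mul1r // mul0r.
rewrite exchange_big /=; apply: eq_bigr => p pp.
by rewrite -big_mkcond sum_multiples ?prime_gt0.
Qed.

(** [mobius (p m) = - mobius m] unless [p] divides [m], hence the plus sign between the sums. The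
    exceptions are multiples of [p ^ 2], at most [N / p ^ 2] for each [p] and [N] in all. *)
Lemma sum_omega_mobius_approx N :
  cabs (\sum_(1 <= n < N.+1) (omega n)%:C%C * ((mobius n)%:~R * circ (n%:R * alpha))
   + \sum_(1 <= m < N.+1) (mobius m)%:~R * c N m) <= N%:R.
Proof.
rewrite sum_omega_mobius.
have -> : \sum_(1 <= m < N.+1) (mobius m)%:~R * c N m =
    \sum_(1 <= p < X.+1 | prime p) \sum_(1 <= m < (N %/ p).+1)
      (mobius m)%:~R * circ ((p * m)%:R * alpha).
  rewrite /c; under eq_bigr do rewrite mulr_sumr.
  rewrite exchange_big /=; apply: eq_bigr => p pp; have p0 := prime_gt0 pp.
  by under eq_bigr do rewrite mulrCA; rewrite sum_mul_le.
rewrite -big_split /=; apply: le_trans (cabs_sum _ _ _) _.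
apply: (@le_trans _ _ (\sum_(1 <= p < X.+1 | prime p) N%:R * p%:R ^- 2)); last first.
  by rewrite -mulr_sumr ler_piMr // sum_inv_sqr_le.
apply: ler_sum => p pp; have p0 := prime_gt0 pp.
rewrite -big_split /=; apply: le_trans (cabs_sum _ _ _) _.
apply: (@le_trans _ _ (\sum_(1 <= m < (N %/ p).+1) (p %| m)%N%:R)).
  apply: ler_sum_nat => m /andP[m0 _]; rewrite -mulrDl cabsM cabs_circ mulr1.
  have [pm|pm] := boolP (p %| m)%N.
    rewrite mobiusM_ncoprime ?prime_coprime ?pm // add0r.
    by rewrite -[X in cabs X]mulr1 (le_trans (cabs_mobius_le _ _)) // cabs1.
  by rewrite mobiusM ?prime_coprime // mobius_prime // mulN1r mulrNz addNr cabs0.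
rewrite count_multiples // (le_trans (natdiv_le _ _)) //.
by rewrite expr2 invfM mulrA ler_wpM2r ?invr_ge0 // natdiv_le.
Qed.

(** The bound for the off-diagonal terms, independent of [N]. The pairs [p = r] contribute nothing
    to it, because [nd 0 = 0] and [0^-1 = 0]. *)
Let C : R := \sum_(1 <= p < X.+1 | prime p) \sum_(1 <= r < X.+1 | prime r)
  (nd ((p%:R - r%:R) * alpha))^-1.

(** In the expanded square a pair [p = r] gives at most [N / p]; for [p != r] the sum over
    [m <= N / maxn p r] is geometric with ratio [e((p - r) alpha)], different from [1]. *)
Lemma sum_sqr_c N : \sum_(1 <= m < N.+1) cabs (c N m) ^+ 2 <= N%:R * A + C.
Proof.
have -> : \sum_(1 <= m < N.+1) cabs (c N m) ^+ 2 =
  complex.Re (\sum_(1 <= p < X.+1 | prime p) \sum_(1 <= r < X.+1 | prime r)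
    \sum_(1 <= m < N.+1) (p * m <= N)%N%:R * (r * m <= N)%N%:R *
      circ (m%:R * ((p%:R - r%:R) * alpha))).
  transitivity (complex.Re (\sum_(1 <= m < N.+1) cabs (c N m) ^+ 2)%:C%C) => //.
  congr complex.Re; rewrite rmorph_sum /=.
  transitivity (\sum_(1 <= m < N.+1) \sum_(1 <= p < X.+1 | prime p)
     \sum_(1 <= r < X.+1 | prime r) (p * m <= N)%N%:R * (r * m <= N)%N%:R *
      circ (m%:R * ((p%:R - r%:R) * alpha))).
    apply: eq_bigr => m _; rewrite cabs_sqr /c mulr_suml; apply: eq_bigr => p _.
    rewrite rmorph_sum /= mulr_sumr; apply: eq_bigr => r _.
    rewrite conjcM_nat -circN mulrACA -circD; congr (_ * circ _).
    by rewrite !natrM; ring.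
  rewrite exchange_big /=; apply: eq_bigr => p _.
  by rewrite exchange_big.
apply: le_trans (ler_norm _) _; apply: le_trans (Re_le_cabs _) _.
apply: le_trans (cabs_sum _ _ _) _.
rewrite /A /C mulr_sumr -big_split /=; apply: ler_sum => p pp; have p0 := prime_gt0 pp.
apply: le_trans (cabs_sum _ _ _) _.
have Np : 0 <= N%:R / p%:R :> R by rewrite divr_ge0.
apply: le_trans (lerD (sum_delta_le prime p X Np) (lexx _)).
rewrite -big_split /=; apply: ler_sum => r pr; have r0 := prime_gt0 pr.
case: eqP => [->|/eqP rp].
  rewrite -[leLHS]addr0; apply: lerD; last by rewrite invr_ge0 nd_ge0.
  apply: le_trans (natdiv_le _ _).
  under eq_bigr do rewrite -mulrA; rewrite sum_mul_le //.
  apply: le_trans (cabs_sum _ _ _) _.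
  have -> : (N %/ p)%:R = \sum_(1 <= m < (N %/ p).+1) 1 :> R.
    by rewrite sumr_const_nat subn1.
  apply: ler_sum => m _; rewrite cabsM cabs_circ mulr1.
  by case: (_ <= _)%N; rewrite ?cabs1 ?cabs0.
rewrite add0r (eq_bigr (fun m => (maxn p r * m <= N)%N%:R *
    circ (m%:R * ((p%:R - r%:R) * alpha)))); last first.
  by move=> m _; rewrite -natrM mulnb -geq_max -maxnMl.
rewrite sum_mul_le ?leq_max ?p0 //; apply: sum_circ_le.
have [rp'|pr'|/eqP] := ltngtP r p; last by rewrite (negbTE rp).
  by rewrite -natrB 1?ltnW // alphaP // subn_gt0.
by rewrite -ndN -mulNr opprB -natrB 1?ltnW // alphaP // subn_gt0.
Qed.

(** Replacing the weight [A] by [omega] costs the first term, by Turan-Kubilius; passing to the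
    bilinear form costs the second; Cauchy-Schwarz applied to that form gives the third. *)
Lemma katai_bound N : A * cabs (mobius_sum alpha N) <=
  Num.sqrt (N%:R * (N%:R * A + 2 * A * X%:R)) + N%:R
   + Num.sqrt (N%:R * (N%:R * A + C)).
Proof.
set M := mobius_sum alpha N.
pose u n := (mobius n)%:~R * circ (n%:R * alpha) : R[i].
have -> : A * cabs M = cabs (A%:C%C * M) by rewrite cabsM cabs_real ger0_norm.
set W := \sum_(1 <= n < N.+1) (omega n)%:C%C * u n.
set V := \sum_(1 <= m < N.+1) (mobius m)%:~R * c N m.
have -> : A%:C%C * M = - (W - A%:C%C * M) + (W + V) - V by ring.
have u1 n : cabs (u n) <= 1 by rewrite (le_trans (cabs_mobius_le _ _)) // cabs_circ.
have sqrt_le (x y : R) : 0 <= x -> x ^+ 2 <= y -> x <= Num.sqrt y.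
  by move=> x0 xy; rewrite -(ger0_norm x0) -sqrtr_sqr ler_wsqrtr.
apply: le_trans (cabsB _ _) _; apply: lerD; last first.
  apply: (@le_trans _ _ (\sum_(1 <= m < N.+1) cabs (c N m))).
    by apply: le_trans (cabs_sum _ _ _) _; apply: ler_sum => m _; exact: cabs_mobius_le.
  apply: sqrt_le; first by apply: sumr_ge0 => m _; exact: cabs_ge0.
  by apply: le_trans (sqr_sum_le _ _) _; rewrite ler_wpM2l // sum_sqr_c.
apply: le_trans (cabsD _ _) _; apply: lerD; last exact: sum_omega_mobius_approx.
rewrite cabsN /W /M /mobius_sum mulr_sumr -sumrB.
apply: (@le_trans _ _ (\sum_(1 <= n < N.+1) `|omega n - A|)).
  apply: le_trans (cabs_sum _ _ _) _; apply: ler_sum => n _.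
  by rewrite -mulrBl -rmorphB cabsM cabs_real ler_piMr // u1.
apply: sqrt_le; first by apply: sumr_ge0.
apply: le_trans (sqr_sum_le _ _) _; rewrite ler_wpM2l //.
apply: le_trans (turan_kubilius X N); apply: ler_sum => n _.
by rewrite real_normK ?num_real.
Qed.

End Katai.

Theorem davenport (R : realType) (alpha eps : R) : aperiodic alpha -> 0 < eps ->
  exists N0, forall N, (N0 <= N)%N -> cabs (mobius_sum alpha N) <= eps * N%:R.
Proof.
move=> irr eps0.
(* For large [N] each root is at most [(3/2) N s] with [s = sqrt A], and [N <= N s]; dividing
   [4 N s] by [A = s ^ 2] leaves [4 N / s], so [s >= 4 / eps] is wanted. *)
have [X AX] := sum_inv_primes_unbounded (1 + (4 / eps) ^+ 2).
have := katai_bound irr X.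
set A : R := \sum_(1 <= p < X.+1 | prime p) _ in AX *.
set C : R := \sum_(1 <= p < X.+1 | prime p) _.
move=> kb; exists (maxn (2 * X) (Num.truncn C).+1) => N.
rewrite geq_max => /andP[XN CN].
have {}XN : 2 * X%:R <= N%:R :> R by rewrite -natrM ler_nat.
have {}CN : C <= N%:R.
  by apply: le_trans (ltW (truncnS_gt C)) _; rewrite ler_nat.
have e4 : 0 < 4 / eps by rewrite divr_gt0.
have A1 : 1 <= A by apply: le_trans AX; rewrite lerDl sqr_ge0.
have N0 : 0 <= N%:R :> R by [].
pose s := Num.sqrt A.
have sA : s ^+ 2 = A by rewrite sqr_sqrtr // (le_trans ler01).
have s1 : 1 <= s by rewrite -[leLHS]sqrtr1 /s ler_wsqrtr.
have s4 : 4 / eps <= s.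
  rewrite -(ger0_norm (ltW e4)) -sqrtr_sqr /s ler_wsqrtr //.
  by apply: le_trans AX; rewrite lerDr.
have sqb y : y <= 2 * N%:R ^+ 2 * A -> Num.sqrt y <= N%:R * (3 / 2 * s).
  move=> yle; apply: (@le_trans _ _ (Num.sqrt ((N%:R * (3 / 2 * s)) ^+ 2))).
    rewrite ler_wsqrtr //; apply: le_trans yle _; rewrite !exprMn sA.
    have NA : 0 <= N%:R ^+ 2 * A by rewrite mulr_ge0 ?sqr_ge0 // (le_trans ler01).
    nra.
  by rewrite sqrtr_sqr ger0_norm // mulr_ge0 // mulr_ge0 //; lra.
have b1 : Num.sqrt (N%:R * (N%:R * A + 2 * A * X%:R)) <= N%:R * (3 / 2 * s).
  apply: sqb; have : 0 <= N%:R * A * (N%:R - 2 * X%:R).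
    by rewrite mulr_ge0 ?subr_ge0 // mulr_ge0 // (le_trans ler01).
  by rewrite expr2; lra.
have b2 : Num.sqrt (N%:R * (N%:R * A + C)) <= N%:R * (3 / 2 * s).
  have NA : N%:R <= N%:R * A by rewrite ler_peMr.
  apply: sqb; have : 0 <= N%:R * (N%:R * A - C).
    by rewrite mulr_ge0 // subr_ge0 (le_trans CN).
  by rewrite expr2; lra.
have {kb}kb := kb N.
have h : s ^+ 2 * cabs (mobius_sum alpha N) <= 4 * N%:R * s.
  by rewrite sA; apply: le_trans kb _; nra.
have s0 : 0 < s by lra.
have {}h : s * cabs (mobius_sum alpha N) <= 4 * N%:R.
  by rewrite -(ler_pM2l s0); nra.
have es : 4 <= s * eps by move: s4; rewrite ler_pdivrMr.
rewrite -(ler_pM2l s0); apply: le_trans h _; nra.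
Qed.

(** * Rational approximation *)

Section Diophantine.
Context {R : realType}.

Lemma dirichlet (alpha : R) (M : nat) : (0 < M)%N ->
  exists2 d, (0 < d <= M)%N & nd (d%:R * alpha) < M%:R^-1.
Proof.
move=> M0; have Mr : 0 < M%:R :> R by rewrite ltr0n.
pose x (i : nat) : R := i%:R * alpha - (Num.floor (i%:R * alpha))%:~R.
have x0 i : 0 <= x i by rewrite subr_ge0 floor_le.
have x1 i : x i < 1 by have := floorD1_gt (i%:R * alpha); rewrite intrD /x; lra.
have fP i : (Num.truncn (M%:R * x i) < M)%N.
  by rewrite truncn_lt_nat ?gtr_pMr // mulr_ge0 // ltW.
pose f (i : 'I_M.+1) : 'I_M := Ordinal (fP i).
have /injectivePn [i [j ij fij]] : ~~ injectiveb f.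
  by apply/negP => /injectiveP /leq_card; rewrite !card_ord ltnn.
wlog ltij : i j ij fij / (i < j)%N.
  move=> H; have [|ji] := ltnP i j; first exact: H.
  apply: (H j i) => //; first by rewrite eq_sym.
  by rewrite ltn_neqAle ji andbT eq_sym.
exists (j - i)%N; first by rewrite subn_gt0 ltij /= (leq_trans (leq_subr _ _)) // -ltnS.
have -> : nd ((j - i)%:R * alpha) = nd (x j - x i).
  rewrite natrB 1?ltnW // /x.
  set fj := Num.floor _; set fi := Num.floor _.
  rewrite (_ : _ - _ - _ = (j%:R - i%:R) * alpha + (fi - fj)%:~R) ?ndDint //.
  by rewrite intrB; ring.
apply: le_lt_trans (nd_norm _) _.
have /(congr1 val) /= tE := fij.
have /andP[i1 i2] := truncn_itv (mulr_ge0 (ltW Mr) (x0 i)).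
have /andP[j1 j2] := truncn_itv (mulr_ge0 (ltW Mr) (x0 j)).
rewrite -tE in j1 j2; rewrite -natr1 in i2 j2.
rewrite -[ltRHS]mul1r ltr_pdivlMr // -(ger0_norm (ltW Mr)) -normrM.
by rewrite ltr_norml; apply/andP; split; lra.
Qed.

Lemma nd_approx (x : R) : exists a : int, `|x - a%:~R| = nd x.
Proof. by exists (nint x). Qed.

(* If g = gcd(a, q) > 1, then q/g approximates g times better than q. *)
Lemma coprime_of_minimal (alpha : R) (q : nat) (a : int) : (0 < q)%N ->
  `|q%:R * alpha - a%:~R| = nd (q%:R * alpha) -> 0 < nd (q%:R * alpha) ->
  (forall d, (0 < d < q)%N -> nd (q%:R * alpha) <= nd (d%:R * alpha)) ->
  coprimez a q%:Z.
Proof.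
move=> q0 aE nq qmin; rewrite /coprimez; set g := gcdz a q.
have g0 : 0 < g by rewrite /g /gcdz ltz_nat gcdn_gt0 /= q0 orbT.
apply/eqP; suff : ~ (1 < g) by clearbody g; lia.
move=> g1.
have /dvdzP[u uE] : (g %| a)%Z by exact: dvdz_gcdl.
have /dvdzP[v vE] : (g %| q%:Z)%Z by exact: dvdz_gcdr.
have v0 : 0 < v by nia.
have vq : v < q%:Z by nia.
case: v vE v0 vq => // v vE v0 vq.
have := qmin v; rewrite -ltz_nat v0 => /(_ vq).
apply/negP; rewrite -ltNge; apply: le_lt_trans (nd_le _ u) _.
have gr : 1 < g%:~R :> R by rewrite (ltr_int _ 1).
have qE : q%:R = v%:R * g%:~R :> R.
  by rewrite -[q%:R]/(q%:Z%:~R) vE intrM.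
have aqE : q%:R * alpha - a%:~R = g%:~R * (v%:R * alpha - u%:~R).
  by rewrite uE qE intrM; ring.
rewrite -aE aqE normrM (gtr0_norm (lt_trans ltr01 gr)) ltr_pMl // normr_gt0.
by apply: contraTneq nq => h; rewrite -aE aqE h mulr0 normr0 ltxx.
Qed.

(** [q] minimises [||d alpha||] over [d <= Q], and [q'] is the least integer that does better.
    Dirichlet's theorem at [q' - 1] then yields [||q alpha|| < 1 / (q' - 1) <= 2 / q']. *)
Lemma best_approximations (alpha : R) (Q : nat) : aperiodic alpha -> (0 < Q)%N ->
  exists q q' : nat, exists a a' : int,
  [/\ (0 < q <= Q)%N, (Q < q')%N, coprimez a q%:Z & coprimez a' q'%:Z] /\
  (`|q%:R * alpha - a%:~R| <= 2 / q'%:R) /\ (`|q'%:R * alpha - a'%:~R| <= 2 / q'%:R).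
Proof.
move=> irr Q0.
pose f (i : 'I_Q) : R := nd (i.+1%:R * alpha).
have [i _ imin] := @arg_minP _ _ _ (Ordinal Q0) xpredT f isT.
set q := i.+1; have q0 : (0 < q)%N by [].
have qQ : (q <= Q)%N by rewrite /q.
have qmin d : (0 < d <= Q)%N -> nd (q%:R * alpha) <= nd (d%:R * alpha).
  by case: d => // d /andP[_ dQ]; apply: (imin (Ordinal dQ)).
have nq := irr _ q0.
have exq' : exists d, (0 < d)%N && (nd (d%:R * alpha) < nd (q%:R * alpha)).
  pose M := (Num.truncn (nd (q%:R * alpha))^-1).+1.
  have [d /andP[d0 _] dM] := dirichlet alpha (ltn0Sn _ : 0 < M)%N.
  exists d; rewrite d0 (lt_trans dM) // -[ltRHS]invrK ltf_pV2 ?posrE ?invr_gt0 ?ltr0n //.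
  exact: truncnS_gt.
case: (ex_minnP exq') => q' /andP[q'0 q'lt] q'min.
have Qq' : (Q < q')%N.
  rewrite ltnNge; apply/negP => q'Q.
  by have := qmin q'; rewrite q'0 q'Q => /(_ isT); rewrite leNgt q'lt.
have q'1 : (0 < q'.-1)%N by lia.
have small : nd (q%:R * alpha) <= 2 / q'%:R.
  have [d /andP[d0 dq'] dM] := dirichlet alpha q'1.
  have : nd (q%:R * alpha) <= nd (d%:R * alpha).
    rewrite leNgt; apply/negP => lt; have := q'min d; rewrite d0 lt => /(_ isT).
    by lia.
  move=> /le_trans; apply; apply: le_trans (ltW dM) _.
  rewrite -[leLHS]mul1r ler_pdivrMr ?ltr0n // mulrAC ler_pdivlMr ?ltr0n // mul1r.
  by rewrite -natrM ler_nat; lia.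
have [a aE] := nd_approx (q%:R * alpha).
have [a' a'E] := nd_approx (q'%:R * alpha).
exists q, q', a, a'; split; last first.
  by rewrite aE a'E small (le_trans (ltW q'lt)).
split => //.
  apply: (coprime_of_minimal q0 aE nq) => d /andP[d0 dq].
  by apply: qmin; rewrite d0 (leq_trans (ltnW dq)).
apply: (coprime_of_minimal q'0 a'E (irr _ q'0)) => d /andP[d0 dq].
rewrite leNgt; apply/negP => lt; have := q'min d; rewrite d0 (lt_trans lt) //.
by move=> /(_ isT); lia.
Qed.

Lemma sum_inv_sqrt_le q : \sum_(1 <= r < q.+1) (Num.sqrt r%:R)^-1 <= 2 * Num.sqrt q%:R :> R.
Proof.
elim: q => [|q IH]; first by rewrite big_geq // sqrtr0 mulr0.
rewrite big_nat_recr //=; apply: le_trans (lerD IH (lexx _)) _.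
set u := Num.sqrt q%:R; set v := Num.sqrt q.+1%:R.
have u0 : 0 <= u by exact: sqrtr_ge0.
have v0 : 0 < v by rewrite sqrtr_gt0 ltr0n.
have uv : v ^+ 2 = u ^+ 2 + 1 by rewrite !sqr_sqrtr // natr1.
rewrite -lerBrDl -[leLHS]mul1r ler_pdivrMr //.
have : u <= v by rewrite ler_wsqrtr // ler_nat.
nra.
Qed.

Lemma nd_frac_ge (r q : nat) : (0 < q)%N -> (r <= q)%N ->
  Num.min r%:R (q%:R - r%:R) / q%:R <= nd (r%:R / q%:R) :> R.
Proof.
move=> q0 rq; have qr : 0 < q%:R :> R by rewrite ltr0n.
rewrite ler_pdivrMr // /nd; set k := nint _.
have -> : `|r%:R / q%:R - k%:~R| * q%:R = `|r%:R - k%:~R * q%:R| :> R.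
  by rewrite -[X in _ * X](gtr0_norm qr) -normrM mulrBl divfK ?gt_eqF.
have [k0|k0] := leP k 0.
  rewrite ge_min; apply/orP; left; apply: le_trans (ler_norm _).
  rewrite lerBrDr gerDl; apply: mulr_le0_ge0 => //.
  by rewrite -(ler_int R) in k0.
rewrite ge_min; apply/orP; right; rewrite distrC; apply: le_trans (ler_norm _).
by rewrite lerD2r -[leLHS]mul1r ler_wpM2r // (ler_int _ 1) -gtz0_ge1.
Qed.

End Diophantine.

(** * Sums over blocks *)

Section Blocks.
Context {R : realType}.

Lemma sum_ltn_le (q t : nat) : \sum_(0 <= r < q) (r < t)%N%:R <= t%:R :> R.
Proof.
suff : \sum_(0 <= r < q) (r < t)%N%:R = (minn q t)%:R :> R.
  by move=> ->; rewrite ler_nat geq_minr.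
elim: q => [|q IH]; first by rewrite big_geq // min0n.
rewrite big_nat_recr //= IH -natrD; congr _%:R.
by case: (ltnP q t); lia.
Qed.

Lemma sum_sqrt_inv_le q : \sum_(1 <= r < q.+1) Num.sqrt (q%:R / r%:R) <= 2 * q%:R :> R.
Proof.
rewrite (eq_bigr (fun r => Num.sqrt q%:R * (Num.sqrt r%:R)^-1)); last first.
  by move=> r _; rewrite sqrtrM // sqrtrV.
rewrite -mulr_sumr; apply: le_trans (ler_wpM2l (sqrtr_ge0 _) (sum_inv_sqrt_le _)) _.
by rewrite mulrCA -expr2 sqr_sqrtr.
Qed.

(** [rho j] stands for the residue of the [j]-th element of a block. At most [2 t] residues lie
    within [t] of [0] modulo [q] and pay [U]; over the others [sqrt(q / r)] sums to at most [2 q],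
    from either end. *)
Lemma block_bound (q t : nat) (rho : 'I_q -> 'I_q) (F : nat -> R) (U V : R) :
  injective rho -> 0 <= U -> 0 <= V ->
  (forall j : 'I_q, ~~ ((t <= rho j) && (rho j + t <= q))%N -> F j <= U) ->
  (forall j : 'I_q, (t <= rho j)%N -> (rho j + t <= q)%N ->
     F j <= V * (Num.sqrt (q%:R / (rho j)%:R) + Num.sqrt (q%:R / (q - rho j)%:R))) ->
  \sum_(0 <= j < q) F j <= U * (2 * t%:R) + 4 * q%:R * V.
Proof.
move=> rinj U0 V0 FU FV.
pose G (r : nat) := U * ((r < t)%N%:R + (q - r < t)%N%:R)
  + V * (Num.sqrt (q%:R / r%:R) + Num.sqrt (q%:R / (q - r)%:R)).
apply: (@le_trans _ _ (\sum_(0 <= j < q) G j)).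
  rewrite !big_mkord [leRHS](reindex_inj rinj) /=; apply: ler_sum => j _.
  have [/andP[h1 h2]|h] := boolP ((t <= rho j) && (rho j + t <= q))%N.
    apply: le_trans (FV j h1 h2) _; by rewrite /G lerDr mulr_ge0 // addr_ge0.
  apply: le_trans (FU j h) _; rewrite /G -[leLHS]addr0 lerD //.
    rewrite ler_peMr // -natrD (ler_nat _ 1%N).
    have := ltn_ord (rho j); move: h; case: (ltnP (rho j) t) => //= _.
    by case: (ltnP (q - rho j) t) => //=; lia.
  by rewrite mulr_ge0 // addr_ge0 ?sqrtr_ge0.
rewrite big_split /= -!mulr_sumr !big_split /=; apply: lerD.
  rewrite ler_wpM2l // mulr_natl mulr2n lerD ?sum_ltn_le //.
  rewrite big_nat_rev /=; apply: le_trans (sum_ltn_le q t).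
  by apply: ler_sum_nat => r /andP[_ rq]; rewrite ler_nat; lia.
rewrite [leRHS](_ : _ = V * (2 * q%:R + 2 * q%:R)); last by ring.
rewrite ler_wpM2l // lerD //; apply: le_trans (sum_sqrt_inv_le q).
  case: q {rho rinj FU FV G} => [|q]; first by rewrite !big_geq.
  rewrite big_ltn // invr0 mulr0 sqrtr0 add0r [leRHS]big_nat_recr //=.
  by rewrite lerDl sqrtr_ge0.
rewrite big_nat_rev /= big_add1 /=.
apply: ler_sum_nat => r /andP[_ rq].
by rewrite (_ : (q - (0 + q - r.+1))%N = r.+1) //; lia.
Qed.

Lemma coprime_residues (q : nat) (a c : int) : (0 < q)%N -> coprimez a q%:Z ->
  exists2 rho : 'I_q -> 'I_q, injective rho &
    forall j : 'I_q, exists k : int, c + j%:Z * a = k * q%:Z + (rho j)%:Z.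
Proof.
move=> q0 aq; have qZ : q%:Z != 0 by rewrite eqz_nat -lt0n.
have lt (j : 'I_q) : (`|((c + j%:Z * a) %% q%:Z)%Z| < q)%N.
  rewrite -ltz_nat gez0_abs ?modz_ge0 // ltz_pmod // ltz_nat //.
exists (fun j => Ordinal (lt j)); last first.
  move=> j; exists ((c + j%:Z * a) %/ q%:Z)%Z => /=.
  by rewrite gez0_abs ?modz_ge0 // -divz_eq.
move=> i j /(congr1 val) /= h.
have {h} h : ((c + i%:Z * a) %% q%:Z = (c + j%:Z * a) %% q%:Z)%Z.
  by rewrite -(gez0_abs (modz_ge0 (c + i%:Z * a) qZ)) h gez0_abs ?modz_ge0.
move/eqP: h; rewrite eqz_mod_dvd opprD addrACA subrr add0r -mulrBl => h.
have {}h : (q%:Z %| i%:Z - j%:Z)%Z.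
  by rewrite Gauss_dvdzl 1?coprimez_sym // in h.
apply: val_inj => /=; apply/eqP; rewrite -eqz_nat -subr_eq0.
apply: contraLR h => ij; apply/negP => /dvdzP [k kE].
have := ltn_ord i; have := ltn_ord j.
have [k0|k0] := eqVneq k 0; first by rewrite kE k0 mul0r eqxx in ij.
have : (1 <= k) || (k <= -1) by move: k0; lia.
by case/orP => hk; nia.
Qed.

(** With [m = min(r, q - r) >= t], the point [y / q] has norm at least [m / q], and [x] is within
    [t / (2 q)] of it, so [||x|| >= m / (2 q)]. One of the two roots on the right is that of
    [q / m]. *)
Lemma inv_sqrt_nd_le (x : R) (q t r : nat) (y k : int) : (0 < q)%N -> (0 < t)%N ->
  y = k * q%:Z + r%:Z -> `|x - y%:~R / q%:R| <= t%:R / (2 * q%:R) ->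
  (t <= r)%N -> (r + t <= q)%N ->
  0 < nd x /\ (Num.sqrt (nd x))^-1 <=
    2 * (Num.sqrt (q%:R / r%:R) + Num.sqrt (q%:R / (q - r)%:R)).
Proof.
move=> q0 t0 yE xy tr rtq.
have qr : 0 < q%:R :> R by rewrite ltr0n.
have rq : (r <= q)%N by lia.
have nE : nd (r%:R / q%:R : R) = nd (y%:~R / q%:R).
  rewrite -[in RHS](ndDint _ (- k)); congr nd.
  by rewrite yE intrD intrM -!pmulrn mulrNz; field; rewrite gt_eqF.
have : nd (r%:R / q%:R : R) <= nd x + t%:R / (2 * q%:R).
  rewrite nE -[X in nd X](subrK x) addrC; apply: le_trans (ndD _ _) _.
  by rewrite lerD2l (le_trans (nd_norm _)) // distrC.
have := @nd_frac_ge R r q q0 rq; set m := Num.min _ _ => /le_trans h /h {h}.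
have tm : t%:R <= m.
  by rewrite /m le_min ler_nat tr lerBrDr -natrD ler_nat addnC.
have m0 : 0 < m by apply: lt_le_trans tm; rewrite ltr0n.
move=> hm; have {}hm : m / (2 * q%:R) <= nd x.
  rewrite -lerBlDr in hm; apply: le_trans hm.
  rewrite lerBrDr -mulrDl ler_pdivrMr ?mulr_gt0 // (_ : m / q%:R * (2 * q%:R) = 2 * m).
    by lra.
  by field; rewrite gt_eqF.
have x0 : 0 < nd x by apply: lt_le_trans hm; rewrite divr_gt0 // mulr_gt0.
split => //.
apply: (@le_trans _ _ (2 * Num.sqrt (q%:R / m))); last first.
  rewrite ler_wpM2l // /m natrB //.
  have s1 := sqrtr_ge0 (q%:R / r%:R : R); have s2 := sqrtr_ge0 (q%:R / (q%:R - r%:R) : R).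
  by case: (leP r%:R (q%:R - r%:R)) => _; rewrite ?lerDl ?lerDr.
rewrite -sqrtrV ?nd_ge0 // -[X in X * _](ger0_norm (_ : 0 <= 2)) // -sqrtr_sqr.
rewrite -sqrtrM ?sqr_ge0 // ler_wsqrtr //.
rewrite -[leLHS]mul1r ler_pdivrMr // mulrC.
have qm0 : 0 < q%:R / m by rewrite divr_gt0.
apply: (@le_trans _ _ (m / (2 * q%:R) * (2 ^+ 2 * (q%:R / m)))).
  rewrite (_ : _ * _ = 2); first by lra.
  by field; rewrite !gt_eqF.
by rewrite ler_wpM2r // mulr_ge0 ?sqr_ge0 // ltW.
Qed.

(** Fourth roots absorb logarithms through [ln u <= 4 u^(1/4)]: the geometric mean [u^(1/2) ln u]
    becomes [u^(3/4)], still summable over blocks without loss. *)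
Definition root4 (u : R) := Num.sqrt (Num.sqrt u).

Lemma root4_ge0 u : 0 <= root4 u. Proof. exact: sqrtr_ge0. Qed.

Lemma root4X u : 0 <= u -> root4 u ^+ 4 = u.
Proof. by move=> u0; rewrite (exprM _ 2 2) !sqr_sqrtr ?sqrtr_ge0. Qed.

Lemma root4X2 u : root4 u ^+ 2 = Num.sqrt u.
Proof. by rewrite sqr_sqrtr ?sqrtr_ge0. Qed.

Lemma ler_root4 u v : u <= v -> root4 u <= root4 v.
Proof. by move=> uv; rewrite !ler_wsqrtr. Qed.

Lemma root4M u v : 0 <= u -> root4 (u * v) = root4 u * root4 v.
Proof. by move=> u0; rewrite /root4 sqrtrM // sqrtrM ?sqrtr_ge0. Qed.

Lemma root4V u : 0 <= u -> root4 u^-1 = (root4 u)^-1.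
Proof. by move=> u0; rewrite /root4 sqrtrV // sqrtrV ?sqrtr_ge0. Qed.

Lemma ln_le_root4 u : 1 <= u -> ln u <= 4 * root4 u.
Proof.
move=> u1; have u0 : 0 <= u by apply: le_trans u1.
have r0 : 0 < root4 u by rewrite !sqrtr_gt0 (lt_le_trans _ u1).
rewrite -[X in ln X](root4X u0) lnXn // -[ln _ *+ _]mulr_natl ler_wpM2l //.
by rewrite ltW // ln_sublinear.
Qed.

(* A Riemann sum of [x^(-3/4)]. *)
Lemma sum_root4_le (Y K : R) (B : nat) : 0 <= Y -> 0 < K ->
  \sum_(0 <= b < B | K * b.+1%:R <= Y) root4 (Y / b.+1%:R) ^+ 3 <= 4 * Y / root4 K.
Proof.
move=> Y0 K0; have K00 := ltW K0.
have rK : 0 < root4 K by rewrite !sqrtr_gt0.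
(* The cap at [(Y / K)^(1/4)] lets the telescoping sum run over all [b < B]. The bound in [term]
   comes from [x ^ 4 - y ^ 4 = 1]. *)
pose c b : R := Num.min (root4 b%:R) (root4 (Y / K)).
have cmono b : c b <= c b.+1.
  by rewrite /c le_min ge_min ler_root4 ?ler_nat //= ge_min lexx orbT.
have term b : K * b.+1%:R <= Y -> (root4 b.+1%:R ^+ 3)^-1 <= 4 * (c b.+1 - c b).
  rewrite mulrC -ler_pdivlMr // => /ler_root4 h.
  have hb : root4 b%:R <= root4 b.+1%:R :> R by rewrite ler_root4 // ler_nat.
  rewrite /c !(min_idPl _) ?(le_trans hb) //.
  set x := root4 b.+1%:R in hb *; set y := root4 b%:R in hb *.
  have x0 : 0 < x by rewrite !sqrtr_gt0.
  have y0 : 0 <= y by exact: root4_ge0.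
  have xy : x ^+ 4 = y ^+ 4 + 1 by rewrite !root4X // natr1.
  rewrite -[leLHS]mul1r ler_pdivrMr ?exprn_gt0 //.
  have x2 : y ^+ 2 <= x ^+ 2 by rewrite ler_pXn2r ?nnegrE // ltW.
  have : y * (y ^+ 2 + x ^+ 2 + x * y) <= x * (x ^+ 2 + x ^+ 2 + x * x).
    rewrite ler_pM //; first by rewrite !addr_ge0 ?mulr_ge0 ?sqr_ge0 // ltW.
    by rewrite !lerD // ler_wpM2l // ltW.
  have d0 : 0 <= x - y by rewrite subr_ge0.
  move=> /(ler_wpM2l d0) h4.
  have one : 1 = (x - y) * x ^+ 3 + (x - y) * (y * (y ^+ 2 + x ^+ 2 + x * y)).
    have -> : 1 = x ^+ 4 - y ^+ 4 by rewrite xy addrC addKr.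
    by ring.
  rewrite [leLHS]one; apply: le_trans (lerD (lexx _) h4) _.
  by rewrite le_eqVlt; apply/orP; left; apply/eqP; ring.
apply: (@le_trans _ _ (\sum_(0 <= b < B) root4 Y ^+ 3 * (4 * (c b.+1 - c b)))).
  rewrite big_mkcond; apply: ler_sum => b _; case: ifP => [h|_].
    rewrite root4M // root4V // exprMn exprVn ler_wpM2l ?exprn_ge0 ?root4_ge0 //.
    exact: term.
  by rewrite !mulr_ge0 ?exprn_ge0 ?root4_ge0 // subr_ge0.
rewrite -!mulr_sumr telescope_sumr //.
have -> : 4 * Y / root4 K = root4 Y ^+ 3 * (4 * root4 (Y / K)).
  rewrite root4M // root4V // -[in LHS](root4X Y0); ring.
rewrite ler_wpM2l ?exprn_ge0 ?root4_ge0 // ler_wpM2l //.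
rewrite /c; set m := Num.min _ _; set m' := Num.min _ _.
have : m <= root4 (Y / K) by rewrite /m ge_min lexx orbT.
have : 0 <= m' by rewrite /m' le_min !root4_ge0.
lra.
Qed.

Lemma sum_blocks_le (F : nat -> R) (s D q B : nat) : (forall d, 0 <= F d) ->
  (D < s + B * q)%N ->
  \sum_(s <= d < D.+1) F d <= \sum_(0 <= b < B) \sum_(0 <= j < q) F (s + b * q + j)%N.
Proof.
move=> F0 DB; apply: (@le_trans _ _ (\sum_(s <= d < s + B * q) F d)).
  have [sD|Ds] := leqP s D.+1; last by rewrite big_geq ?(ltnW Ds) // sumr_ge0.
  by rewrite (@big_cat_nat _ _ _ D.+1 s (s + B * q)%N) //= lerDl sumr_ge0.
rewrite le_eqVlt; apply/orP; left; apply/eqP.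
elim: B {DB} => [|B IH]; first by rewrite mul0n addn0 !big_geq.
rewrite [RHS]big_nat_recr //= -IH (@big_cat_nat _ _ _ (s + B * q)%N) ?leq_addr //=.
  congr (_ + _); rewrite -{1}[(s + B * q)%N]add0n big_addn.
  rewrite (_ : (s + B.+1 * q - (s + B * q))%N = q); last by lia.
  by apply: eq_bigr => j _; rewrite addnC.
by rewrite mulSn; lia.
Qed.

End Blocks.

(** * The sums over [m > K] *)

Section TypeI.
Context {R : realType}.
Context (alpha : R) (N K : nat).

(** The part of the sum in which [m] is long enough to oscillate. It is empty once [N %/ d <= K],
    which confines [d] to values below [N / K]. *)
Definition log_tail (d : nat) : R[i] :=
  \sum_(K.+1 <= m < (N %/ d).+1) (ln m%:R)%:C%C * circ ((d * m)%:R * alpha).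

Lemma log_tail_eq0 d : (N %/ d <= K)%N -> log_tail d = 0.
Proof. by move=> NK; rewrite /log_tail big_geq. Qed.

Lemma log_tail_gt0 d : (0 < d)%N -> (K < N %/ d)%N -> 1 <= N%:R / d%:R :> R.
Proof.
move=> d0 KN; rewrite ler_pdivlMr ?ltr0n // mul1r ler_nat.
by rewrite -[leqLHS]mul1n -leq_divRL //; lia.
Qed.

Lemma log_tail_trivial d : (0 < d)%N ->
  cabs (log_tail d) <= 4 * root4 (N%:R / d%:R) ^+ 5.
Proof.
move=> d0; have [NK|KN] := leqP (N %/ d) K.
  by rewrite log_tail_eq0 // cabs0 mulr_ge0 // exprn_ge0 // root4_ge0.
have u1 := log_tail_gt0 d0 KN; set u := N%:R / d%:R in u1 *.
have u0 : 0 <= u by apply: le_trans u1.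
have lu : 0 <= ln u by rewrite ln_ge0.
apply: (@le_trans _ _ (u * ln u)); last first.
  rewrite (_ : 4 * _ = root4 u ^+ 4 * (4 * root4 u)); last by ring.
  by rewrite root4X // ler_wpM2l // ln_le_root4.
apply: le_trans (cabs_sum _ _ _) _.
apply: (@le_trans _ _ (\sum_(K.+1 <= m < (N %/ d).+1) ln u)).
  apply: ler_sum_nat => m /andP[Km mN].
  rewrite cabsM cabs_circ mulr1 cabs_real ger0_norm ?ln_nat_ge0 //.
  rewrite ler_ln ?posrE ?ltr0n //; [|lia|exact: lt_le_trans u1].
  apply: le_trans (natdiv_le _ _); rewrite ler_nat; lia.
rewrite sumr_const_nat -mulr_natl ler_wpM2r //.
by apply: le_trans (natdiv_le _ _); rewrite ler_nat; lia.
Qed.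

Lemma log_tail_nd d : (0 < d <= N)%N -> 0 < nd (d%:R * alpha) ->
  cabs (log_tail d) <= 2 * ln (N%:R / d%:R) / nd (d%:R * alpha).
Proof.
move=> /andP[d0 dN] nd0; have [NK|KN] := leqP (N %/ d) K.
  rewrite log_tail_eq0 // cabs0 mulr_ge0 ?invr_ge0 ?nd_ge0 // mulr_ge0 //.
  by rewrite ln_ge0 // ler_pdivlMr ?ltr0n // mul1r ler_nat.
have u1 := log_tail_gt0 d0 KN.
rewrite /log_tail; under eq_bigr do rewrite natrM [d%:R * _]mulrC -mulrA.
apply: le_trans (abel_bound KN _ _ (fun c => sum_circ_le K.+1 c nd0)) _.
- move=> m n mn; case: m mn => [|m] mn; first by rewrite ln0 // ln_nat_ge0.
  exact: ler_ln_nat.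
- exact: ln_nat_ge0.
rewrite mulrAC ler_wpM2r ?invr_ge0 ?nd_ge0 // ler_wpM2l //.
rewrite ler_ln ?posrE ?ltr0n; [exact: natdiv_le|lia|exact: lt_le_trans u1].
Qed.

(* [min (u, 1 / nd)] is at most the geometric mean [sqrt (u / nd)]. *)
Lemma log_tail_mixed d : (0 < d)%N -> 0 < nd (d%:R * alpha) ->
  cabs (log_tail d)
   <= 8 * root4 (N%:R / d%:R) ^+ 3 * (Num.sqrt (nd (d%:R * alpha)))^-1.
Proof.
move=> d0 nd0; set u := N%:R / d%:R; set w := (Num.sqrt _)^-1.
have w0 : 0 <= w by rewrite invr_ge0 sqrtr_ge0.
have r0 := @root4_ge0 R u.
have [dN|Nd] := leqP d N; last first.
  rewrite log_tail_eq0 ?divn_small // cabs0.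
  by rewrite !mulr_ge0 // exprn_ge0.
have u1 : 1 <= u by rewrite ler_pdivlMr ?ltr0n // mul1r ler_nat.
have u0 : 0 <= u by apply: le_trans u1.
have wE : (nd (d%:R * alpha))^-1 = w ^+ 2 by rewrite exprVn sqr_sqrtr // nd_ge0.
have [le|lt] := leP (root4 u ^+ 2) w.
  apply: le_trans (log_tail_trivial d0) _; rewrite -/u.
  rewrite (_ : 4 * _ = 4 * root4 u ^+ 3 * root4 u ^+ 2); last by ring.
  apply: ler_pM => //; [by rewrite mulr_ge0 ?exprn_ge0|exact: sqr_ge0|].
  by rewrite ler_wpM2r ?exprn_ge0 // ler_nat.
apply: le_trans (log_tail_nd _ nd0) _; first by rewrite d0.
rewrite -/u wE; have lnu := ln_le_root4 u1.
apply: (@le_trans _ _ (8 * root4 u * w ^+ 2)).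
  by rewrite ler_wpM2r ?sqr_ge0 //; lra.
rewrite (_ : 8 * _ ^+ 3 * w = 8 * root4 u * (root4 u ^+ 2 * w)); last by ring.
rewrite ler_wpM2l ?mulr_ge0 // expr2 ler_wpM2r // ltW //.
Qed.

(** In the [b]-th block [N / d] is at most [Y / (b + 1)], and the block contributes nothing once
    this drops below [K]. The estimate is [sum_root4_le] over the remaining blocks. *)
Lemma region_sum_le (F : nat -> R) (s q D : nat) (Y kappa : R) :
  (forall d, 0 <= F d) -> (0 < q)%N -> (0 < K)%N -> 0 <= Y -> 0 <= kappa ->
  (forall b, \sum_(0 <= j < q) F (s + b * q + j)%N <= kappa * root4 (Y / b.+1%:R) ^+ 3) ->
  (forall b, Y < K%:R * b.+1%:R -> \sum_(0 <= j < q) F (s + b * q + j)%N <= 0) ->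
  \sum_(s <= d < D.+1) F d <= kappa * (4 * Y / root4 K%:R).
Proof.
move=> F0 q0 K0 Y0 kap0 FY FK.
apply: le_trans (sum_blocks_le (B := D.+1) F0 (_ : D < s + D.+1 * q)%N) _.
  by nia.
apply: (@le_trans _ _ (kappa *
    \sum_(0 <= b < D.+1 | K%:R * b.+1%:R <= Y) root4 (Y / b.+1%:R) ^+ 3)).
  rewrite mulr_sumr [leRHS]big_mkcond; apply: ler_sum => b _.
  by case: (leP (K%:R * b.+1%:R) Y) => [_|/FK].
by rewrite ler_wpM2l // sum_root4_le // ltr0n.
Qed.

(** Here [g (b + 1)] is a lower bound for the [b]-th block; the scale [g] is [q] for small [d] and
    [q' / 4] for large [d]. *)
Lemma log_tail_far (g : R) (b d : nat) : 0 < g -> (0 < d)%N ->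
  g * b.+1%:R <= d%:R -> N%:R / g < K%:R * b.+1%:R -> log_tail d = 0.
Proof.
move=> g0 d0 gd; rewrite ltr_pdivrMr // => h; apply: log_tail_eq0.
rewrite -ltnS ltn_divLR // -(ltr_nat R).
apply: lt_le_trans h _; rewrite natrM -mulrA.
by apply: ler_pM => //; [rewrite mulr_ge0 // ltW|rewrite ler_nat|rewrite mulrC].
Qed.

Lemma root4_div_le (g : R) (b d : nat) : 0 < g -> (0 < d)%N ->
  g * b.+1%:R <= d%:R -> root4 (N%:R / d%:R) <= root4 (N%:R / g / b.+1%:R) :> R.
Proof.
move=> g0 d0 gd; apply: ler_root4.
by rewrite -mulrA -invfM ler_wpM2l // lef_pV2 ?posrE ?ltr0n // mulr_gt0.
Qed.

Context (K_gt0 : (0 < K)%N).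

(** * The range [d <= q' / 4], by means of [a / q] *)

Section Minor.
Context (q q' : nat) (a : int) (q_gt0 : (0 < q)%N) (aq : coprimez a q%:Z).
Context (aqE : `|q%:R * alpha - a%:~R| <= 2 / q'%:R).

Let F (D d : nat) : R :=
  if (d <= D)%N && ~~ (q %| d)%N then cabs (log_tail d) else 0.

Let F_ge0 D d : 0 <= F D d.
Proof. by rewrite /F; case: ifP => // _; exact: cabs_ge0. Qed.

(** [d alpha - d a / q = (d / q) (q alpha - a)], and [(d / q) (2 / q') <= 1 / (2 q)] because
    [4 d <= q']. Half the spacing [1 / q] keeps nonzero residues away from [0]. *)
Let approx D (d : nat) : (4 * D <= q')%N -> (0 < d <= D)%N ->
  `|d%:R * alpha - (d%:Z * a)%:~R / q%:R| <= 1%:R / (2 * q%:R).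
Proof.
move=> Dq' /andP[d0 dD].
have qr : 0 < q%:R :> R by rewrite ltr0n.
have q'r : 0 < q'%:R :> R by rewrite ltr0n; lia.
rewrite intrM -pmulrn.
rewrite (_ : d%:R * alpha - _ = d%:R / q%:R * (q%:R * alpha - a%:~R)); last first.
  by field; rewrite gt_eqF.
rewrite normrM ger0_norm ?divr_ge0 //.
apply: le_trans (ler_wpM2l _ aqE) _; first by rewrite divr_ge0.
rewrite (_ : d%:R / q%:R * (2 / q'%:R) = (4 * d%:R) / q'%:R * (1 / (2 * q%:R))); last first.
  by field; rewrite !gt_eqF.
rewrite ler_piMl //; first by rewrite divr_ge0 // mulr_ge0.
by rewrite ler_pdivrMr // mul1r -natrM ler_nat; lia.
Qed.

(** As [d a] is not [0] modulo [q], one has [1 / ||d alpha|| <= 16 q]. This serves the [d < q],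
    which precede the blocks starting at [(b + 1) q]. *)
Lemma minor_first_block D d : (4 * D <= q')%N -> (0 < d <= D)%N -> (d <= N)%N ->
  ~~ (q %| d)%N -> cabs (log_tail d) <= 32 * q%:R * ln N%:R.
Proof.
move=> Dq' dD dN qd; have d0 : (0 < d)%N by case/andP: dD.
have h := approx Dq' dD.
pose r := `|(d%:Z * a %% q%:Z)%Z|%N.
have qZ : q%:Z != 0 by rewrite eqz_nat -lt0n.
have rE : r%:Z = (d%:Z * a %% q%:Z)%Z by rewrite gez0_abs // modz_ge0.
have rq : (r < q)%N by rewrite -ltz_nat rE ltz_pmod // ltz_nat.
have r0 : (0 < r)%N.
  rewrite lt0n; apply: contra qd => /eqP r0.
  have : (q%:Z %| d%:Z * a)%Z by apply/dvdz_mod0P; rewrite -rE r0.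
  by rewrite Gauss_dvdzl // coprimez_sym.
have yE : d%:Z * a = (d%:Z * a %/ q%:Z)%Z * q%:Z + r%:Z by rewrite rE -divz_eq.
have r1q : (r + 1 <= q)%N by rewrite addn1.
have [n0 nle] := inv_sqrt_nd_le q_gt0 (ltnSn 0) yE h r0 r1q.
apply: le_trans (log_tail_nd _ n0) _; first by rewrite d0.
set w := (Num.sqrt _)^-1 in nle.
have w0 : 0 <= w by rewrite invr_ge0 sqrtr_ge0.
have wE : (nd (d%:R * alpha))^-1 = w ^+ 2 by rewrite exprVn sqr_sqrtr // nd_ge0.
have sq (m : nat) : (0 < m)%N -> Num.sqrt (q%:R / m%:R) <= Num.sqrt q%:R :> R.
  by move=> m0; rewrite ler_wsqrtr // ler_piMr // invf_le1 ?ltr0n // ler1n.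
have {}nle : w <= 4 * Num.sqrt q%:R.
  apply: le_trans nle _; have := sq r r0; have := sq (q - r)%N; rewrite subn_gt0 => /(_ rq).
  lra.
have w2 : w ^+ 2 <= 16 * q%:R.
  have := sqr_sqrtr (ler0n R q); nra.
have lnN : 0 <= ln (N%:R / d%:R) :> R.
  by rewrite ln_ge0 // ler_pdivlMr ?ltr0n // mul1r ler_nat.
have lnle : ln (N%:R / d%:R) <= ln N%:R :> R.
  rewrite ler_ln ?posrE ?divr_gt0 ?ltr0n ?(leq_trans d0) //.
  by rewrite ler_piMr // invf_le1 ?ltr0n // ler1n.
rewrite wE; apply: (@le_trans _ _ (2 * ln (N%:R / d%:R) * (16 * q%:R))).
  by rewrite ler_wpM2l // mulr_ge0.
rewrite (_ : 32 * _ * _ = 2 * ln N%:R * (16 * q%:R)); last by ring.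
by rewrite ler_wpM2r ?mulr_ge0 // ler_wpM2l.
Qed.

Lemma minor_block D b : (4 * D <= q')%N ->
  \sum_(0 <= j < q) F D (q + b * q + j)%N
    <= 64 * q%:R * root4 (N%:R / q%:R / b.+1%:R) ^+ 3.
Proof.
move=> Dq'; set s := (q + b * q)%N.
have [rho rinj rhoE] := coprime_residues (s%:Z * a) q_gt0 aq.
pose V : R := 16 * root4 (N%:R / q%:R / b.+1%:R) ^+ 3.
have V0 : 0 <= V by rewrite mulr_ge0 // exprn_ge0 // root4_ge0.
have qr : 0 < q%:R :> R by rewrite ltr0n.
(* With [t = 1] the only excluded residue is [0]; it means [q | d], where [F] vanishes, so [U = 0]
   will do. *)
apply: le_trans (block_bound (t := 1) rinj (lexx 0) V0 _ _) _.
- move=> j; have [k kE] := rhoE j; rewrite addn1 ltn_ord andbT lt0n negbK => /eqP r0.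
  rewrite /F ifF //; apply/negbTE; rewrite negb_and negbK; apply/orP; right.
  have : (q%:Z %| (s + j)%N%:Z * a)%Z.
    by apply/dvdzP; exists k; rewrite PoszD mulrDl kE r0 addr0.
  by rewrite Gauss_dvdzl // coprimez_sym.
- move=> j r1 r2; have [k kE] := rhoE j; rewrite /F; case: ifPn => [/andP[jD qj]|_]; last first.
    by rewrite mulr_ge0 // addr_ge0 ?sqrtr_ge0.
  have sj : (0 < s + j)%N by rewrite /s; lia.
  have h : `|(s + j)%:R * alpha - ((s + j)%N%:Z * a)%:~R / q%:R| <= 1%:R / (2 * q%:R).
    by apply: approx Dq' _; rewrite sj.
  have yE : (s + j)%N%:Z * a = k * q%:Z + (rho j)%:Z by rewrite PoszD mulrDl kE.
  have [n0 nle] := inv_sqrt_nd_le q_gt0 (ltnSn 0) yE h r1 r2.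
  apply: le_trans (log_tail_mixed sj n0) _.
  have r4le : root4 (N%:R / (s + j)%:R) <= root4 (N%:R / q%:R / b.+1%:R) :> R.
    by apply: root4_div_le => //; rewrite -natrM ler_nat /s; lia.
  rewrite (_ : V * _ = 8 * root4 (N%:R / q%:R / b.+1%:R) ^+ 3 *
    (2 * (Num.sqrt (q%:R / (rho j)%:R) + Num.sqrt (q%:R / (q - rho j)%:R)))); last first.
    by rewrite /V; ring.
  apply: ler_pM => //.
  + by rewrite mulr_ge0 // exprn_ge0 // root4_ge0.
  + by rewrite invr_ge0 sqrtr_ge0.
  + by rewrite ler_wpM2l // lerXn2r ?nnegrE ?root4_ge0.
by rewrite mul0r add0r /V le_eqVlt; apply/orP; left; apply/eqP; ring.
Qed.

Lemma minor_sum D : (4 * D <= q')%N ->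
  \sum_(1 <= d < D.+1 | ~~ (q %| d)%N) cabs (log_tail d)
  <= 32 * q%:R ^+ 2 * ln N%:R + 256 * N%:R / root4 K%:R.
Proof.
move=> Dq'; have qr : 0 < q%:R :> R by rewrite ltr0n.
have E d : (d < D.+1)%N -> (if ~~ (q %| d)%N then cabs (log_tail d) else 0) = F D d.
  by rewrite ltnS /F => ->.
rewrite big_mkcond (eq_big_nat _ _ (F2 := F D)); last first.
  by move=> d /andP[_ dD]; rewrite E.
have lnN := @ln_nat_ge0 R N.
apply: (@le_trans _ _ (\sum_(1 <= d < q) F D d + \sum_(q <= d < D.+1) F D d)).
  have [qD|Dq] := leqP q D.+1.
    by rewrite (@big_cat_nat _ _ _ q 1%N D.+1).
  rewrite [X in _ + X]big_geq ?addr0; last exact: ltnW.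
  rewrite (@big_cat_nat _ _ _ D.+1 1%N q) //=; last exact: ltnW.
  by rewrite lerDl sumr_ge0.
apply: lerD.
  apply: (@le_trans _ _ (\sum_(1 <= d < q) 32 * q%:R * ln N%:R)).
    apply: ler_sum_nat => d /andP[d0 dq].
    have M0 : 0 <= 32 * q%:R * ln N%:R :> R by rewrite !mulr_ge0.
    rewrite /F; case: ifP => // /andP[dD qd].
    have [dN|Nd] := leqP d N; last by rewrite log_tail_eq0 ?cabs0 // divn_small.
    by apply: minor_first_block Dq' _ dN qd; rewrite d0.
  rewrite sumr_const_nat -[_ *+ (q - 1)]mulr_natl.
  rewrite (_ : 32 * _ ^+ 2 * _ = q%:R * (32 * q%:R * ln N%:R)); last by ring.
  by rewrite ler_wpM2r ?mulr_ge0 // ler_nat leq_subr.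
apply: le_trans (@region_sum_le (F D) q q D (N%:R / q%:R) (64 * q%:R) _ _ _ _ _ _ _) _ => //.
- by rewrite divr_ge0.
- by rewrite mulr_ge0.
- by move=> b; exact: minor_block.
- move=> b h; rewrite big1 // => j _; rewrite /F; case: ifP => // _.
  rewrite (@log_tail_far q%:R b) ?cabs0 ?addn_gt0 ?q_gt0 //.
  by rewrite -natrM ler_nat; lia.
rewrite le_eqVlt; apply/orP; left; apply/eqP.
have : root4 K%:R != 0 :> R by rewrite gt_eqF // !sqrtr_gt0 ltr0n.
by move=> h; field; rewrite h gt_eqF.
Qed.
End Minor.

(** * The range [d > q' / 4], by means of [a' / q'] *)

Section Major.
Context (q' : nat) (a' : int) (q'_gt0 : (0 < q')%N) (aq' : coprimez a' q'%:Z).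
Context (aq'E : `|q'%:R * alpha - a'%:~R| <= 2 / q'%:R) (Nq' : (N <= q' ^ 3)%N).

Let start := (q' %/ 4).+1.

Let start_ge b j : (q'%:R / 4) * b.+1%:R <= (start + b * q' + j)%:R :> R.
Proof.
rewrite mulrAC ler_pdivrMr // -!natrM ler_nat /start.
by have := divn_eq q' 4; have := ltn_pmod q' (isT : 0 < 4)%N; nia.
Qed.

(* Up to 12 residues of [d * a'] modulo [q'] lie too close to [0] and are bounded
   trivially; [N <= q' ^ 3] makes their contribution harmless. *)
Lemma major_block b :
  \sum_(0 <= j < q') cabs (log_tail (start + b * q' + j)%N)
    <= 160 * q'%:R * root4 (N%:R / (q'%:R / 4) / b.+1%:R) ^+ 3.
Proof.
set s := (start + b * q')%N.
have qr : 0 < q'%:R :> R by rewrite ltr0n.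
pose x : R := s%:R * alpha; pose c := Num.floor (q'%:R * x).
have xc : `|x - c%:~R / q'%:R| <= 1 / q'%:R.
  rewrite (_ : x - _ = (q'%:R * x - c%:~R) / q'%:R); last by field; rewrite gt_eqF.
  rewrite normrM [`|_^-1|]gtr0_norm ?invr_gt0 // ler_wpM2r ?invr_ge0 ?ltW //.
  have := floor_le (q'%:R * x); have := floorD1_gt (q'%:R * x).
  by rewrite intrD -/c => h1 h2; rewrite ger0_norm ?subr_ge0 //; lra.
have [rho rinj rhoE] := coprime_residues c q'_gt0 aq'.
set u := N%:R / (q'%:R / 4) / b.+1%:R.
have u0 : 0 <= u by rewrite !divr_ge0 // ltW.
have r0 := @root4_ge0 R u.
pose V : R := 16 * root4 u ^+ 3.
pose U : R := 8 * q'%:R * root4 u ^+ 3.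
have V0 : 0 <= V by rewrite mulr_ge0 // exprn_ge0.
have U0 : 0 <= U by rewrite mulr_ge0 ?mulr_ge0 // exprn_ge0.
have sj j : (0 < s + j)%N by rewrite /s /start.
have r4le j : root4 (N%:R / (s + j)%:R) <= root4 u :> R.
  by apply: root4_div_le; rewrite ?divr_gt0.
(* [u <= 4 N / q' <= (2 q') ^ 2] by [N <= q' ^ 3], which brings the trivial bound [4 u^(5/4)] down
   to [8 q' u^(3/4) = U]. *)
have r4q : root4 u ^+ 2 <= 2 * q'%:R.
  rewrite root4X2 -[leRHS]ger0_norm ?mulr_ge0 // -sqrtr_sqr ler_wsqrtr //.
  apply: (@le_trans _ _ (N%:R / (q'%:R / 4))).
    by rewrite /u ler_piMr ?divr_ge0 // invf_le1 ?ltr0n // ler1n.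
  rewrite ler_pdivrMr ?divr_gt0 // (_ : _ * _ = q'%:R ^+ 3); last by field.
  by rewrite -natrX ler_nat.
(* Rounding [q' x] to [c] costs [1 / q'], and [j < q'] steps of [alpha - a' / q'] cost at most
   [2 / q']; the total is [6 / (2 q')], hence [t = 6]. *)
apply: le_trans (block_bound (t := 6) rinj U0 V0 _ _) _.
- move=> j _; apply: le_trans (log_tail_trivial (sj j)) _.
  apply: (@le_trans _ _ (4 * root4 u ^+ 5)).
    by rewrite ler_wpM2l // lerXn2r ?nnegrE ?root4_ge0.
  rewrite (_ : 4 * _ = 4 * root4 u ^+ 3 * root4 u ^+ 2); last by ring.
  rewrite (_ : U = 4 * root4 u ^+ 3 * (2 * q'%:R)); last by rewrite /U; ring.
  by rewrite ler_wpM2l // mulr_ge0 // exprn_ge0.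
- move=> j r1 r2; have [k kE] := rhoE j.
  have h : `|(s + j)%:R * alpha - (c + j%:Z * a')%:~R / q'%:R| <= 6%:R / (2 * q'%:R).
    rewrite intrD intrM -[(j%:Z)%:~R]pmulrn.
    rewrite (_ : (s + j)%:R * alpha - _ = (x - c%:~R / q'%:R)
      + j%:R / q'%:R * (q'%:R * alpha - a'%:~R)); last first.
      by rewrite /x natrD; field; rewrite gt_eqF.
    apply: le_trans (ler_normD _ _) _.
    apply: (@le_trans _ _ (1 / q'%:R + 1 * (2 / q'%:R))).
      rewrite lerD // normrM; apply: ler_pM => //.
      by rewrite ger0_norm ?divr_ge0 // ler_pdivrMr // mul1r ler_nat ltnW.
    by rewrite le_eqVlt; apply/orP; left; apply/eqP; field; rewrite gt_eqF.
  have [n0 nle] := inv_sqrt_nd_le q'_gt0 (isT : 0 < 6)%N kE h r1 r2.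
  apply: le_trans (log_tail_mixed (sj j) n0) _.
  rewrite (_ : V * _ = 8 * root4 u ^+ 3 *
    (2 * (Num.sqrt (q'%:R / (rho j)%:R) + Num.sqrt (q'%:R / (q' - rho j)%:R)))); last first.
    by rewrite /V; ring.
  apply: ler_pM => //.
  + by rewrite mulr_ge0 // exprn_ge0 // root4_ge0.
  + by rewrite invr_ge0 sqrtr_ge0.
  + by rewrite ler_wpM2l // lerXn2r ?nnegrE ?root4_ge0.
by rewrite /U /V le_eqVlt; apply/orP; left; apply/eqP; ring.
Qed.

Lemma major_sum D :
  \sum_((q' %/ 4).+1 <= d < D.+1) cabs (log_tail d) <= 2560 * N%:R / root4 K%:R.
Proof.
have qr : 0 < q'%:R :> R by rewrite ltr0n.
apply: le_trans (@region_sum_le (fun d => cabs (log_tail d)) start q' D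
  (N%:R / (q'%:R / 4)) (160 * q'%:R) _ _ _ _ _ _ _) _ => //.
- by move=> d; exact: cabs_ge0.
- by rewrite !divr_ge0.
- by rewrite mulr_ge0.
- by move=> b; exact: major_block.
- move=> b h; rewrite big1 // => j _.
  by rewrite (@log_tail_far (q'%:R / 4) b) ?cabs0 ?divr_gt0.
rewrite le_eqVlt; apply/orP; left; apply/eqP.
have : root4 K%:R != 0 :> R by rewrite gt_eqF // !sqrtr_gt0 ltr0n.
by move=> h; field; rewrite h gt_eqF.
Qed.
End Major.

End TypeI.

(** * Vinogradov's theorem *)

Section Vinogradov.
Context {R : realType}.

Lemma exchange_hyperbola (V : nmodType) (N : nat) (F : nat -> nat -> V) :
  \sum_(1 <= a < N.+1) \sum_(1 <= b < (N %/ a).+1) F a b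
  = \sum_(1 <= b < N.+1) \sum_(1 <= a < (N %/ b).+1) F a b.
Proof.
have E (G : nat -> V) (a : nat) : (0 < a)%N -> \sum_(1 <= b < (N %/ a).+1) G b =
    \sum_(1 <= b < N.+1 | (a * b <= N)%N) G b.
  move=> a0; rewrite (@big_cat_nat _ _ _ (N %/ a).+1 1%N N.+1) //=; last first.
    by rewrite ltnS leq_div.
  rewrite [X in _ = _ + X]big_nat_cond [X in _ = _ + X]big_pred0 ?addr0; last first.
    move=> b; apply/negbTE/negP => /andP[/andP[ab _]].
    by rewrite mulnC -leq_divRL // leqNgt ab.
  rewrite big_nat_cond [RHS]big_nat_cond; apply: eq_bigl => b.
  by rewrite mulnC -leq_divRL // ltnS; case: (_ < _)%N; case: (_ <= _)%N.
transitivity (\sum_(1 <= a < N.+1) \sum_(1 <= b < N.+1 | (a * b <= N)%N) F a b).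
  by apply: eq_big_nat => a /andP[a0 _]; exact: E.
rewrite (exchange_big_dep xpredT) //=.
apply: eq_big_nat => b /andP[b0 _]; rewrite E //.
by apply: eq_bigl => a; rewrite mulnC.
Qed.

(** The weight is general because both a sequence [G] and its dilate by [q] occur, the latter when
    [q] is factored out of [d]. *)
Definition log_sum (G : nat -> R[i]) (X d : nat) : R[i] :=
  \sum_(1 <= m < (X %/ d).+1) (ln m%:R)%:C%C * G (d * m)%N.

(* [mu 1_(., r) * ln = Lambda * (mu 1_(., r) * 1)], and the last factor is the
   indicator of the integers all of whose prime factors divide [r]. *)
Lemma sum_mobius_log (G : nat -> R[i]) (X r : nat) :
  \sum_(1 <= d < X.+1 | coprime d r) (mobius d)%:~R * log_sum G X d
  = \sum_(1 <= e < X.+1) (vonMangoldt e)%:C%C *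
     \sum_(1 <= s < (X %/ e).+1) (smooth r s)%:R * G (e * s)%N.
Proof.
pose H d e : R[i] := (coprime d r)%:R * (mobius d)%:~R * (vonMangoldt e)%:C%C *
   \sum_(1 <= f < (X %/ d %/ e).+1) G (d * e * f)%N.
transitivity (\sum_(1 <= d < X.+1) \sum_(1 <= e < (X %/ d).+1) H d e).
  rewrite big_mkcond; apply: eq_big_nat => d /andP[d0 _].
  transitivity ((coprime d r)%:R * (mobius d)%:~R * log_sum G X d).
    by case: (coprime d r); rewrite ?mul1r // !mul0r.
  rewrite /H; under [RHS]eq_bigr do rewrite -mulrA; rewrite -mulr_sumr; congr (_ * _).
  rewrite /log_sum.
  transitivity (\sum_(1 <= m < (X %/ d).+1) \sum_(1 <= e < m.+1 | (e %| m)%N)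
     (vonMangoldt e)%:C%C * G (d * e * (m %/ e))%N).
    apply: eq_big_nat => m /andP[m0 _].
    rewrite -(@sum_vonMangoldt_divisors R m m0) rmorph_sum /= mulr_suml.
    by apply: eq_bigr => e em; rewrite -mulnA [(e * _)%N]mulnC divnK.
  rewrite (sum_divisors _ (fun e f => (vonMangoldt e)%:C%C * G (d * e * f)%N)).
  by apply: eq_bigr => e _; rewrite mulr_sumr.
rewrite exchange_hyperbola; apply: eq_big_nat => e /andP[e0 _].
transitivity (\sum_(1 <= d < (X %/ e).+1) \sum_(1 <= f < (X %/ e %/ d).+1)
   (vonMangoldt e)%:C%C * ((coprime d r)%:R * (mobius d)%:~R * G (e * (d * f))%N)).
  apply: eq_bigr => d _; rewrite /H -!divnMA [(d * e)%N]mulnC mulr_sumr.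
  by apply: eq_bigr => f _; rewrite mulnA; ring.
rewrite -(sum_divisors _ (fun d f => (vonMangoldt e)%:C%C *
   ((coprime d r)%:R * (mobius d)%:~R * G (e * (d * f))%N))) mulr_sumr.
apply: eq_big_nat => s /andP[s0 _]; rewrite -mulr_sumr; congr (_ * _).
have -> : (smooth r s)%:R = (smooth r s)%:R%:~R :> R[i] by case: smooth.
rewrite -sum_mobius_coprime // rmorph_sum /= mulr_suml [RHS]big_mkcondr /=.
apply: eq_bigr => d ds; rewrite mulnC [(d * _)%N]mulnC divnK // mulnC.
by case: (coprime d r); rewrite ?mul1r // !mul0r.
Qed.

Definition vonMangoldt_sum (G : nat -> R[i]) (X : nat) : R[i] :=
  \sum_(1 <= n < X.+1) (vonMangoldt n)%:C%C * G n.

Lemma smooth1 s : (0 < s)%N -> smooth 1 s = (s == 1)%N.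
Proof.
move=> s0; have [->//|s1] := eqVneq s 1%N.
apply/negbTE/allPn; exists (pdiv s).
  by rewrite mem_primes pdiv_prime ?pdiv_dvd ?s0 //; lia.
by rewrite dvdn1 neq_ltn prime_gt1 ?orbT // pdiv_prime; lia.
Qed.

Lemma vonMangoldt_sumE (G : nat -> R[i]) (X : nat) :
  vonMangoldt_sum G X = \sum_(1 <= d < X.+1) (mobius d)%:~R * log_sum G X d.
Proof.
transitivity (\sum_(1 <= d < X.+1 | coprime d 1) (mobius d)%:~R * log_sum G X d).
  rewrite sum_mobius_log; apply: eq_big_nat => e /andP[e0 eX]; congr (_ * _).
  rewrite big_ltn ?ltnS ?divn_gt0 // mul1r muln1 big_nat big1 ?addr0 // => s /andP[s1 _].
  by rewrite smooth1 1?gtn_eqF ?mul0r //; lia.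
by apply: eq_bigl => d; rewrite coprimen1.
Qed.

(* The terms with [q | d], where [circ (d * m * alpha)] need not oscillate: no
   cancellation is used, only the sparsity of the [q]-smooth integers. *)
Lemma sum_multiples_mobius_log_le (G : nat -> R[i]) (N q : nat) : (0 < q)%N ->
  (forall n, cabs (G n) <= 1) ->
  cabs (\sum_(1 <= d < N.+1 | (q %| d)%N) (mobius d)%:~R * log_sum G N d)
   <= 4 * (N%:R / q%:R) * Num.sqrt (2 * q%:R).
Proof.
move=> q0 G1; rewrite sum_multiples //; set X := (N %/ q)%N.
have -> : \sum_(1 <= b < X.+1) (mobius (q * b))%:~R * log_sum G N (q * b) =
  (mobius q)%:~R * \sum_(1 <= b < X.+1 | coprime b q)
     (mobius b)%:~R * log_sum (fun n => G (q * n)%N) X b.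
  rewrite mulr_sumr [RHS]big_mkcond; apply: eq_big_nat => b /andP[b0 _].
  have E : log_sum G N (q * b) = log_sum (fun n => G (q * n)%N) X b.
    by rewrite /log_sum divnMA; apply: eq_bigr => m _; rewrite mulnA.
  rewrite E coprime_sym; case: ifPn => qb.
    by rewrite mobiusM // intrM mulrA.
  by rewrite mobiusM_ncoprime // mul0r.
rewrite sum_mobius_log; apply: le_trans (cabs_mobius_le _ _) _.
apply: (@le_trans _ _ (\sum_(1 <= e < X.+1) \sum_(1 <= s < (X %/ e).+1)
    vonMangoldt e * (smooth q s)%:R)).
  apply: le_trans (cabs_sum _ _ _) _; apply: ler_sum => e _.
  rewrite cabsM cabs_real ger0_norm ?vonMangoldt_ge0 // -mulr_sumr.
  rewrite ler_wpM2l ?vonMangoldt_ge0 //; apply: le_trans (cabs_sum _ _ _) _.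
  apply: ler_sum => s _; rewrite cabsM; case: (smooth q s); last by rewrite cabs0 mul0r.
  by rewrite cabs1 mul1r.
(* With [s] outermost, the sum over [e] is [chebyshev_psi (X %/ s) <= 4 X / s], and [1 / s] summed
   over the integers built from primes of [q] is at most [sqrt(2 q)]. *)
rewrite exchange_hyperbola.
apply: (@le_trans _ _ (\sum_(1 <= s < X.+1) 4 * X%:R * ((smooth q s)%:R * s%:R^-1))).
  apply: ler_sum => s _; rewrite -mulr_suml mulrCA mulrC ler_wpM2l //.
  apply: le_trans (chebyshev_psi_le _) _; rewrite -mulrA ler_wpM2l //.
  exact: natdiv_le.
rewrite -mulr_sumr; apply: ler_pM.
- by rewrite mulr_ge0.
- by apply: sumr_ge0 => s _; rewrite mulr_ge0 // invr_ge0.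
- by rewrite ler_wpM2l // natdiv_le.
apply: le_trans (@prod_primes_le R q q0).
have pq : all prime (primes q) by apply/allP => p; rewrite mem_primes => /andP[].
apply: le_trans (@sum_smooth_le R _ X pq).
rewrite [leRHS]big_mkcond; apply: ler_sum => s _.
have -> : smooth q s = all (mem (primes q)) (primes s).
  apply: eq_in_all => p; rewrite mem_primes => /andP[pp _] /=.
  by rewrite mem_primes pp q0.
by case: ifP; rewrite ?mul1r ?mul0r.
Qed.

End Vinogradov.

Section VinogradovBound.
Context {R : realType}.

Lemma aperiodicMn (alpha : R) m : (0 < m)%N -> aperiodic alpha ->
  aperiodic (m%:R * alpha).
Proof.
by move=> m0 irr k k0; rewrite mulrA -natrM irr // muln_gt0 k0.
Qed.

Definition rotation_sequence (alpha : R) (n : nat) : R[i] := circ (n%:R * alpha).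

(** The condition [d m <= N] is turned into a weight, so that [m] runs up to [K] for every [d] and
    the two sums can be exchanged. *)
Lemma log_sum_split (alpha : R) (N K d : nat) : (0 < d)%N ->
  log_sum (rotation_sequence alpha) N d =
  \sum_(1 <= m < K.+1) (d * m <= N)%N%:R *
     ((ln m%:R)%:C%C * rotation_sequence alpha (d * m)) + log_tail alpha N K d.
Proof.
move=> d0; rewrite /log_sum /log_tail.
set f := fun m => (ln m%:R)%:C%C * rotation_sequence alpha (d * m)%N.
have E m : (d * m <= N)%N = (m <= N %/ d)%N by rewrite mulnC -leq_divRL.
have [KN|NK] := leqP K (N %/ d).
  rewrite (@big_cat_nat _ _ _ K.+1 1%N (N %/ d).+1) //=; congr (_ + _).
  by apply: eq_big_nat => m /andP[_ mK]; rewrite E (leq_trans _ KN) ?mul1r.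
rewrite [X in _ = _ + X]big_geq ?addr0; last by rewrite ltnW.
rewrite (@big_cat_nat _ _ _ (N %/ d).+1 1%N K.+1) //=; last by rewrite ltnS ltnW.
rewrite [X in _ = _ + X]big_nat [X in _ = _ + X]big1 ?addr0; last first.
  by move=> m /andP[mN _]; rewrite E leqNgt mN mul0r.
by apply: eq_big_nat => m /andP[_ mK]; rewrite E -ltnS mK mul1r.
Qed.

(** The first term is for [q | d]. The second is for [m <= K], where omitting the multiples of [q]
    from the Mobius sum costs at most [N / q]. The rest comes from the two ranges of [d] for
    [m > K], with [2816 = 256 + 2560]. *)
Lemma vonMangoldt_sum_le (alpha : R) (N K q q' : nat) (a a' : int) :
  (0 < K)%N -> (0 < q)%N -> (0 < q')%N ->
  coprimez a q%:Z -> coprimez a' q'%:Z ->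
  `|q%:R * alpha - a%:~R| <= 2 / q'%:R -> `|q'%:R * alpha - a'%:~R| <= 2 / q'%:R ->
  (N <= q' ^ 3)%N ->
  cabs (vonMangoldt_sum (rotation_sequence alpha) N) <=
   4 * (N%:R / q%:R) * Num.sqrt (2 * q%:R)
   + \sum_(1 <= m < K.+1) ln m%:R *
       (cabs (mobius_sum (m%:R * alpha) (N %/ m)) + N%:R / q%:R)
   + 32 * q%:R ^+ 2 * ln N%:R + 2816 * N%:R / root4 K%:R.
Proof.
move=> K0 q0 q'0 aq aq' aE a'E Nq'.
rewrite vonMangoldt_sumE (bigID (fun d => q %| d)%N) /=.
apply: le_trans (cabsD _ _) _; rewrite -!addrA; apply: lerD.
  by apply: sum_multiples_mobius_log_le => // n; rewrite cabs_circ.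
have -> : \sum_(1 <= d < N.+1 | ~~ (q %| d)%N)
    (mobius d)%:~R * log_sum (rotation_sequence alpha) N d =
  \sum_(1 <= m < K.+1) (ln m%:R)%:C%C *
     (\sum_(1 <= d < (N %/ m).+1 | ~~ (q %| d)%N)
        (mobius d)%:~R * circ (d%:R * (m%:R * alpha)))
  + \sum_(1 <= d < N.+1 | ~~ (q %| d)%N) (mobius d)%:~R * log_tail alpha N K d.
  transitivity (\sum_(1 <= d < N.+1 | ~~ (q %| d)%N) (mobius d)%:~R *
    (\sum_(1 <= m < K.+1) (d * m <= N)%N%:R *
     ((ln m%:R)%:C%C * rotation_sequence alpha (d * m))
      + log_tail alpha N K d)).
    rewrite big_nat_cond [RHS]big_nat_cond.
    by apply: eq_bigr => d /andP[/andP[d0 _] _]; rewrite (@log_sum_split _ _ K).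
  under eq_bigr do rewrite mulrDr.
  rewrite big_split /=; congr (_ + _).
  under eq_bigr do rewrite mulr_sumr.
  rewrite exchange_big /=; apply: eq_big_nat => m /andP[m0 _].
  rewrite big_mkcond [in RHS]big_mkcond /= -(@sum_mul_le _ m) // mulr_sumr.
  apply: eq_bigr => d _; case: ifP => _; last by rewrite !mulr0.
  rewrite /rotation_sequence (_ : (d * m)%:R * alpha = d%:R * (m%:R * alpha)).
    by rewrite [(d * m)%N]mulnC; ring.
  by rewrite natrM mulrA.
apply: le_trans (cabsD _ _) _; apply: lerD.
  apply: le_trans (cabs_sum _ _ _) _; apply: ler_sum_nat => m /andP[m0 mK].
  rewrite cabsM cabs_real ger0_norm ?ln_nat_ge0 // ler_wpM2l ?ln_nat_ge0 //.
  rewrite (_ : \sum_(_ <= d < _ | _) _ = mobius_sum (m%:R * alpha) (N %/ m)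
    - \sum_(1 <= d < (N %/ m).+1 | (q %| d)%N)
        (mobius d)%:~R * circ (d%:R * (m%:R * alpha))); last first.
    by rewrite /mobius_sum [in RHS](bigID (fun d => q %| d)%N) /= addrAC subrr add0r.
  apply: le_trans (cabsB _ _) _; rewrite lerD2l.
  rewrite sum_multiples //; apply: le_trans (cabs_sum _ _ _) _.
  apply: (@le_trans _ _ (\sum_(1 <= b < (N %/ m %/ q).+1) 1)).
    by apply: ler_sum => b _; rewrite (le_trans (cabs_mobius_le _ _)) // cabs_circ.
  rewrite sumr_const_nat subn1 /=; apply: le_trans (natdiv_le _ _).
  by rewrite ler_nat leq_div2r // leq_div.
apply: le_trans (cabs_sum _ _ _) _.
apply: (@le_trans _ _ (\sum_(1 <= d < N.+1 | ~~ (q %| d)%N) cabs (log_tail alpha N K d))).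
  by apply: ler_sum => d _; exact: cabs_mobius_le.
have split : \sum_(1 <= d < N.+1 | ~~ (q %| d)%N) cabs (log_tail alpha N K d) <=
   \sum_(1 <= d < (q' %/ 4).+1 | ~~ (q %| d)%N) cabs (log_tail alpha N K d)
   + \sum_((q' %/ 4).+1 <= d < N.+1) cabs (log_tail alpha N K d).
  have [h|h] := leqP (q' %/ 4).+1 N.+1.
    rewrite (@big_cat_nat _ _ _ (q' %/ 4).+1 1%N N.+1) //= lerD2l big_mkcond.
    by apply: ler_sum => d _; case: ifP => // _; exact: cabs_ge0.
  rewrite [X in _ + X]big_geq ?addr0; last exact: ltnW.
  rewrite (@big_cat_nat _ _ _ N.+1 1%N (q' %/ 4).+1) //=; last exact: ltnW.
  by rewrite lerDl; apply: sumr_ge0 => d _; exact: cabs_ge0.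
apply: le_trans split _.
have q4 : (4 * (q' %/ 4) <= q')%N by rewrite mulnC leq_divM.
apply: le_trans (lerD (minor_sum N K0 q0 aq aE q4)
  (major_sum K0 q'0 aq' a'E Nq' N)) _.
by rewrite -addrA lerD2l -mulrDl -mulrDl ler_wpM2r ?invr_ge0 ?root4_ge0 // ler_wpM2r // -natrD.
Qed.

(** As [||q alpha|| <= 2 / q' < 2 / Q], a positive lower bound on small multiples forces the
    denominator [q] to grow with [Q], at no specified rate. *)
Lemma nd_uniform (alpha : R) (Q : nat) : aperiodic alpha ->
  exists2 eta : R, 0 < eta & forall k, (0 < k < Q)%N -> eta <= nd (k%:R * alpha).
Proof.
move=> irr; elim: Q => [|Q [eta eta0 IH]]; first by exists 1 => // k; rewrite andbF.
case: Q IH => [|Q] IH; first by exists 1 => // k; case: k.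
exists (Num.min eta (nd (Q.+1%:R * alpha))).
  by rewrite lt_min eta0 irr.
move=> k /andP[k0]; rewrite ltnS leq_eqVlt => /orP[/eqP ->|kQ].
  by rewrite ge_min lexx orbT.
by rewrite ge_min IH // k0.
Qed.

Lemma cube_root (N : nat) : exists Q, (Q ^ 3 <= N < Q.+1 ^ 3)%N.
Proof.
have exP : exists Q, (Q ^ 3 <= N)%N by exists 0%N.
have bnd Q : (Q ^ 3 <= N)%N -> (Q <= N)%N.
  by apply: leq_trans; rewrite -[leqLHS]expn1; case: Q => // Q; rewrite leq_pexp2l.
case: (ex_maxnP exP bnd) => Q QN Qmax; exists Q; rewrite QN /= ltnNge.
by apply/negP => /Qmax; rewrite ltnn.
Qed.

Theorem vonMangoldt_sum_littleo (alpha eps : R) : aperiodic alpha -> 0 < eps ->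
  exists N0, forall N, (N0 <= N)%N ->
    cabs (vonMangoldt_sum (rotation_sequence alpha) N) <= eps * N%:R.
Proof.
(* Of the five shares, one is for [q | d], two for [m <= K], one for [d < q] and one for [m > K]. *)
move=> irr eps0; pose e := eps / 5; have e0 : 0 < e by rewrite divr_gt0.
have [K K0 Ke] : exists2 K, (0 < K)%N & 2816 <= e * root4 K%:R.
  exists (Num.truncn ((2816 / e) ^+ 4)).+1 => //.
  rewrite -ler_pdivrMl // mulrC; set x := 2816 / e.
  have x0 : 0 <= x by rewrite divr_ge0 // ltW.
  rewrite -[leLHS]ger0_norm // -sqrtr_sqr -[X in Num.sqrt X]ger0_norm ?sqr_ge0 //.
  by rewrite -sqrtr_sqr -exprM; apply: ler_root4; rewrite ltW // truncnS_gt.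
have lnK m : (0 < m < K.+1)%N -> ln m%:R <= K%:R :> R.
  move=> /andP[m0 mK]; apply: (@le_trans _ _ (ln K%:R)); first exact: ler_ln_nat.
  by rewrite ltW // ln_sublinear // ltr0n.
have Kr : 0 < K%:R :> R by rewrite ltr0n.
(* There are [K] values of [m], each weighted by [ln m <= K]. *)
pose e' := e / K%:R ^+ 2; have e'0 : 0 < e' by rewrite divr_gt0 // exprn_gt0.
have [N1 N1P] : exists N1, forall N m, (0 < m < K.+1)%N -> (N1 <= N)%N ->
    cabs (mobius_sum (m%:R * alpha) (N %/ m)) <= e' * N%:R.
  suff : forall L, exists N1, forall N m, (0 < m < L)%N -> (N1 <= N)%N ->
    cabs (mobius_sum (m%:R * alpha) (N %/ m)) <= e' * N%:R by apply.
  elim=> [|L [N1 IH]]; first by exists 0%N => N m; rewrite andbF.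
  case: L IH => [|L] IH; first by exists 0%N => N [].
  have [N2 N2P] := davenport (aperiodicMn (ltn0Sn L) irr) e'0.
  exists (maxn N1 (N2 * L.+1)) => N m /andP[m0 mL]; rewrite geq_max => /andP[h1 h2].
  move: mL; rewrite ltnS leq_eqVlt => /orP[/eqP ->|mL]; last by apply: IH; rewrite ?m0.
  apply: le_trans (N2P _ _) _; first by rewrite leq_divRL.
  by rewrite (ler_wpM2l (ltW e'0)) // ler_nat leq_div.
(* For [q >= Qm] the terms with [q | d] are controlled by [8 / sqrt q <= e], and the multiples of
   [q] omitted from the Mobius sums by [K ^ 2 / q <= e]. *)
pose Qm := (Num.truncn (Num.max ((8 / e) ^+ 2) (K%:R ^+ 2 / e))).+1.
have Q0P q : (Qm <= q)%N -> 8 / e <= Num.sqrt q%:R /\ K%:R ^+ 2 / e <= q%:R.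
  move=> qQ.
  have : Num.max ((8 / e) ^+ 2) (K%:R ^+ 2 / e) <= q%:R.
    by apply: le_trans (ltW (truncnS_gt _)) _; rewrite ler_nat.
  rewrite ge_max => /andP[h1 h2]; split => //.
  have x0 : 0 <= 8 / e by rewrite divr_ge0 // ltW.
  by rewrite -[leLHS]ger0_norm // -sqrtr_sqr ler_wsqrtr.
have [eta eta0 etaP] := nd_uniform Qm irr.
(* [2 / eta < Q] rules out denominators below [Qm]. [400 / e <= sqrt Q] is for
   [32 Q ^ 2 ln N <= 384 Q^(5/2)], to be compared with [e Q ^ 3 <= e N]. *)
pose Q1 := maxn 1 (maxn (Num.truncn (2 / eta)).+1 (Num.truncn ((400 / e) ^+ 2)).+1).
exists (maxn N1 (Q1 ^ 3)) => N; rewrite geq_max => /andP[N1N QN].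
have [Q /andP[Q3N NQ3]] := cube_root N.
have Q1Q : (Q1 <= Q)%N.
  by rewrite -ltnS -(ltn_exp2r _ _ (isT : 0 < 3)%N) (leq_ltn_trans QN).
move: Q1Q; rewrite !geq_max => /and3P[Q0 Qeta Qe].
have Qr : 0 < Q%:R :> R by rewrite ltr0n.
have {}Qeta : 2 / eta < Q%:R.
  by apply: lt_le_trans (truncnS_gt _) _; rewrite ler_nat.
have {}Qe : 400 / e <= Num.sqrt Q%:R.
  have x0 : 0 <= 400 / e by rewrite divr_ge0 // ltW.
  rewrite -[leLHS]ger0_norm // -sqrtr_sqr ler_wsqrtr //.
  by apply: le_trans (ltW (truncnS_gt _)) _; rewrite ler_nat.
have [q [q' [a [a' [[/andP[q0 qQ] Qq' aq aq'] [aE a'E]]]]]] :=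
  best_approximations irr Q0.
have q'0 : (0 < q')%N by apply: leq_trans Qq'.
have Nq' : (N <= q' ^ 3)%N.
  by apply: leq_trans (ltnW NQ3) _; rewrite leq_exp2r.
have Q0q : (Qm <= q)%N.
  rewrite leqNgt; apply/negP => qQ0; have := etaP q; rewrite q0 qQ0 => /(_ isT).
  apply/negP; rewrite -ltNge; apply: le_lt_trans (nd_le _ a) _.
  apply: le_lt_trans aE _; apply: (@lt_trans _ _ (2 / Q%:R)).
    by rewrite ltr_pM2l // ltf_pV2 ?posrE ?ltr0n // ltr_nat.
  by rewrite ltr_pdivrMr // mulrC -ltr_pdivrMr.
have [sq K2q] := Q0P q Q0q.
have qr : 0 < q%:R :> R by rewrite ltr0n.
have N0 : 0 <= N%:R :> R by [].
have T1 : 4 * (N%:R / q%:R) * Num.sqrt (2 * q%:R) <= e * N%:R.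
  have sq0 : 0 < Num.sqrt q%:R :> R by rewrite sqrtr_gt0.
  have s2 : Num.sqrt (2 * q%:R) <= 2 * Num.sqrt q%:R :> R.
    rewrite -[X in X * Num.sqrt _](ger0_norm (_ : 0 <= 2)) // -sqrtr_sqr -sqrtrM ?sqr_ge0 //.
    by rewrite ler_wsqrtr // ler_wpM2r // expr2; lra.
  apply: (@le_trans _ _ (4 * (N%:R / q%:R) * (2 * Num.sqrt q%:R))).
    by rewrite ler_wpM2l // mulr_ge0 // divr_ge0.
  rewrite -[X in N%:R / X](sqr_sqrtr (ltW qr)).
  rewrite (_ : _ * _ = 8 / Num.sqrt q%:R * N%:R); last by field; rewrite gt_eqF.
  by rewrite ler_wpM2r // ler_pdivrMr // mulrC -ler_pdivrMr.
have T2 : \sum_(1 <= m < K.+1) ln m%:R *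
    (cabs (mobius_sum (m%:R * alpha) (N %/ m)) + N%:R / q%:R) <= 2 * e * N%:R.
  apply: (@le_trans _ _ (\sum_(1 <= m < K.+1) K%:R * (e' * N%:R + N%:R / q%:R))).
    apply: ler_sum_nat => m mK; apply: ler_pM.
    - exact: ln_nat_ge0.
    - by rewrite addr_ge0 ?cabs_ge0 // divr_ge0.
    - exact: lnK.
    - by rewrite lerD2r N1P.
  rewrite sumr_const_nat subn1 /= -[_ *+ K]mulr_natl mulrA -expr2 mulrDr.
  have E1 : K%:R ^+ 2 * (e' * N%:R) = e * N%:R.
    by rewrite mulrA /e' mulrCA mulfV ?mulr1 // expf_neq0 // gt_eqF.
  have E2 : K%:R ^+ 2 * (N%:R / q%:R) <= e * N%:R.
    by rewrite mulrCA mulrC ler_wpM2r // ler_pdivrMr // mulrC -ler_pdivrMr.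
  by rewrite E1 (_ : 2 * e * N%:R = e * N%:R + e * N%:R) ?lerD2l //; ring.
have T3 : 32 * q%:R ^+ 2 * ln N%:R <= e * N%:R.
  set s := Num.sqrt Q%:R in Qe.
  have s0 : 0 < s by rewrite sqrtr_gt0.
  have sE : s ^+ 2 = Q%:R by rewrite sqr_sqrtr // ltW.
  have lnN : ln N%:R <= 12 * s.
    have N1' : (0 < N)%N by apply: leq_trans Q3N; rewrite expn_gt0 Q0.
    apply: (@le_trans _ _ (ln (Q.+1 ^ 3)%:R)); first by rewrite ler_ln_nat // ltnW.
    rewrite natrX lnXn ?ltr0n //.
    have r0 : 0 < Num.sqrt Q.+1%:R :> R by rewrite sqrtr_gt0 ltr0n.
    rewrite -[X in ln X](@sqr_sqrtr _ Q.+1%:R) // lnXn // -mulrnA.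
    have : ln (Num.sqrt Q.+1%:R) <= 2 * s :> R.
      apply: le_trans (ltW (ln_sublinear r0)) _.
      rewrite /s -[X in X * Num.sqrt _](ger0_norm (_ : 0 <= 2)) // -sqrtr_sqr -sqrtrM ?sqr_ge0 //.
      by rewrite ler_wsqrtr // -natrX -natrM ler_nat; move: Q0; clear; lia.
    by move=> h; rewrite -[_ *+ _]mulr_natl; clear -h; lra.
  have qQr : q%:R ^+ 2 <= Q%:R ^+ 2 :> R by rewrite lerXn2r ?nnegrE ?ler_nat.
  apply: (@le_trans _ _ (32 * Q%:R ^+ 2 * (12 * s))).
    apply: ler_pM => //; first by rewrite mulr_ge0 // sqr_ge0.
      exact: ln_nat_ge0.
    by rewrite ler_wpM2l.
  apply: (@le_trans _ _ (e * Q%:R ^+ 3)); last first.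
    by rewrite (ler_wpM2l (ltW e0)) // -natrX ler_nat.
  rewrite -sE (_ : e * _ = (s ^+ 5) * (e * s)); last by ring.
  rewrite (_ : 32 * _ * _ = s ^+ 5 * 384); last by ring.
  rewrite ler_wpM2l //; first by rewrite exprn_ge0 // ltW.
  move: Qe; rewrite ler_pdivrMr // => Qe; rewrite [e * s]mulrC.
  by apply: le_trans Qe; rewrite ler_nat.
have T4 : 2816 * N%:R / root4 K%:R <= e * N%:R.
  have rK : 0 < root4 K%:R :> R by rewrite !sqrtr_gt0.
  by rewrite ler_pdivrMr // mulrAC ler_wpM2r.
apply: le_trans (vonMangoldt_sum_le K0 q0 q'0 aq aq' aE a'E Nq') _.
have -> : eps * N%:R = e * N%:R + 2 * e * N%:R + e * N%:R + e * N%:R.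
  by rewrite /e; field.
by rewrite !lerD.
Qed.

End VinogradovBound.

(** * From the von Mangoldt function to the primes *)

Section PrimeSums.
Context {R : realType}.

Lemma ln2_ge_half : 2^-1 <= ln 2 :> R.
Proof.
have := @le_ln1Dx R (- 2^-1); rewrite (_ : 1 + - 2^-1 = 2^-1); last by lra.
by rewrite lnV ?posrE // lerN2; apply; lra.
Qed.

(** Chebyshev's lower bound, which turns errors [o(N)] into [o(pi(N) ln N)]. The [6] comes from
    [N <= 3 * N./2] and [ln 2 >= 1/2]. *)
Lemma prime_pi_ln_ge N : (2 <= N)%N -> N%:R <= 6 * ((prime_pi N)%:R * ln N%:R) :> R.
Proof.
move=> N2; apply: (@le_trans _ _ (6 * (N./2%:R * 2^-1))).
  have : (N <= 3 * N./2)%N by lia.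
  by rewrite -(ler_nat R) natrM; lra.
rewrite ler_wpM2l //; apply: le_trans (chebyshev_psi_prime_pi N).
by apply: le_trans (chebyshev_psi_ge N); rewrite ler_wpM2l // ln2_ge_half.
Qed.

Lemma sqrt_ln_littleo (eps : R) : 0 < eps -> exists N0, forall N, (N0 <= N)%N ->
  Num.sqrt N%:R * ln N%:R <= eps * N%:R.
Proof.
move=> e0; exists (Num.truncn ((4 / eps) ^+ 4)).+1 => N NN.
have x0 : 0 <= 4 / eps by rewrite divr_ge0 // ltW.
have h : (4 / eps) ^+ 4 <= N%:R.
  by apply: le_trans (ltW (truncnS_gt _)) _; rewrite ler_nat.
have N1 : 1 <= N%:R :> R by rewrite ler1n; apply: leq_trans NN.
have N0 : 0 <= N%:R :> R by [].
have r4 : 4 / eps <= root4 N%:R.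
  by rewrite -(ler_pXn2r (isT : 0 < 4)%N) ?nnegrE ?root4_ge0 // root4X.
apply: (@le_trans _ _ (Num.sqrt N%:R * (4 * root4 N%:R))).
  by rewrite ler_wpM2l ?sqrtr_ge0 // ln_le_root4.
rewrite -root4X2 -[X in _ <= eps * X](root4X N0).
rewrite (_ : eps * _ = root4 N%:R ^+ 3 * (eps * root4 N%:R)); last by ring.
rewrite (_ : _ * _ = root4 N%:R ^+ 3 * 4); last by ring.
by rewrite ler_wpM2l ?exprn_ge0 ?root4_ge0 // mulrC -ler_pdivrMr.
Qed.

Lemma sqrt_floor (N : nat) : exists s, (N < s.+1 ^ 2)%N /\ s%:R <= Num.sqrt N%:R :> R.
Proof.
exists (Num.truncn (Num.sqrt N%:R : R)); split; last by rewrite truncn_le sqrtr_ge0.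
rewrite -(ltr_nat R) natrX -[X in X < _](@sqr_sqrtr _ N%:R) //.
by rewrite ltrXn2r ?nnegrE ?sqrtr_ge0 // truncnS_gt.
Qed.

(** Primes up to about [sqrt N] are counted trivially; beyond, [ln N <= 2 ln p], and
    [2 chebyshev_psi y <= 8 y]. *)
Lemma prime_pi_le y N : (0 < N)%N -> (y <= N)%N ->
  (prime_pi y)%:R * ln N%:R <= Num.sqrt N%:R * ln N%:R + 8 * y%:R :> R.
Proof.
move=> N0 yN; have [s [Ns sN]] := sqrt_floor N.
have lnN := @ln_nat_ge0 R N.
apply: (@le_trans _ _ (\sum_(1 <= p < s.+1) ln N%:R
    + \sum_(1 <= p < y.+1) 2 * vonMangoldt p)).
  rewrite prime_piE mulr_suml.
  apply: (@le_trans _ _ (\sum_(1 <= p < y.+1)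
     ((if (p <= s)%N then ln N%:R else 0) + 2 * vonMangoldt p))).
    rewrite big_mkcond; apply: ler_sum_nat => p /andP[p0 _].
    have vp := @vonMangoldt_ge0 R p.
    case: ifP => pp; last by rewrite addr_ge0 ?mulr_ge0 //; case: ifP.
    rewrite mul1r; case: leqP => [_|sp]; first by rewrite lerDl mulr_ge0.
    rewrite add0r vonMangoldt_prime // mulr_natl -lnXn ?ltr0n // -natrX.
    rewrite ler_ln_nat //; apply: ltnW; apply: leq_trans Ns _.
    by rewrite leq_exp2r.
  rewrite big_split /= lerD2r -big_mkcond /=.
  have [ys|sy] := leqP y s.
    rewrite (@big_cat_nat _ _ _ y.+1 1%N s.+1) //= -[leLHS]addr0 lerD ?sumr_ge0 //.
    by rewrite big_mkcond; apply: ler_sum => p _; case: ifP.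
  rewrite (@big_cat_nat _ _ _ s.+1 1%N y.+1) //=; last by rewrite ltnS ltnW.
  rewrite [X in _ + X]big_nat_cond [X in _ + X]big_pred0 ?addr0; last by move=> p; lia.
  by rewrite big_mkcond; apply: ler_sum => p _; case: ifP.
apply: lerD.
  by rewrite sumr_const_nat subn1 /= -[ln _ *+ s]mulr_natl ler_wpM2r.
rewrite -mulr_sumr -/(chebyshev_psi y).
by have := @chebyshev_psi_le R y; lra.
Qed.

Definition theta_sum (alpha : R) (N : nat) : R[i] :=
  \sum_(1 <= p < N.+1 | prime p) (ln p%:R)%:C%C * circ (p%:R * alpha).

Lemma theta_sum_littleo (alpha eps : R) : aperiodic alpha -> 0 < eps ->
  exists N0, forall N, (N0 <= N)%N -> cabs (theta_sum alpha N) <= eps * N%:R.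
Proof.
move=> irr e0; have e2 : 0 < eps / 2 by rewrite divr_gt0.
have [N1 N1P] := vonMangoldt_sum_littleo irr e2.
have [N2 N2P] := sqrt_ln_littleo e2.
exists (maxn N1 N2) => N; rewrite geq_max => /andP[h1 h2].
have -> : theta_sum alpha N = vonMangoldt_sum (rotation_sequence alpha) N
   - \sum_(1 <= n < N.+1 | ~~ prime n) (vonMangoldt n)%:C%C * circ (n%:R * alpha).
  rewrite /vonMangoldt_sum [in RHS](bigID prime) /= -addrA subrr addr0.
  by apply: eq_bigr => p pp; rewrite vonMangoldt_prime.
apply: le_trans (cabsB _ _) _; rewrite [eps]splitr mulrDl lerD ?N1P //.
apply: le_trans (N2P _ h2).
have [s [Ns sN]] := sqrt_floor N.
apply: (@le_trans _ _ (s%:R * ln N%:R)); last by rewrite ler_wpM2r ?ln_nat_ge0.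
apply: le_trans (sum_vonMangoldt_nonprime_le Ns).
apply: le_trans (cabs_sum _ _ _) _; apply: ler_sum => n _.
by rewrite cabsM cabs_circ mulr1 cabs_real ger0_norm ?vonMangoldt_ge0.
Qed.

(** The weight [ln p] is removed by a cut at [y = delta N]: few primes lie below [y], and above it
    [ln N - ln p <= - ln delta], a constant against [ln N]. *)
Theorem prime_circ_sum_littleo (alpha eps : R) : aperiodic alpha -> 0 < eps ->
  exists N0, forall N, (N0 <= N)%N ->
   cabs (\sum_(1 <= p < N.+1 | prime p) circ (p%:R * alpha)) <= eps * (prime_pi N)%:R.
Proof.
(* The terms [3 e' N] and [8 delta N] are each at most [eps N / 24]; by [N <= 6 pi(N) ln N] together
   they use half of [eps pi(N) ln N]. *)
move=> irr e0; pose delta := Num.min 1 (eps / 192); pose e' := eps / 72.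
have e'0 : 0 < e' by rewrite divr_gt0.
have d0 : 0 < delta by rewrite lt_min ltr01 divr_gt0.
have d1 : delta <= 1 by rewrite ge_min lexx.
have de : delta <= eps / 192 by rewrite ge_min lexx orbT.
have [N1 N1P] := theta_sum_littleo irr e'0.
have [N2 N2P] := sqrt_ln_littleo e'0.
pose N3 := (Num.truncn (N1%:R / delta)).+1.
pose N4 := (Num.truncn (expR (2 / eps * - ln delta))).+1.
exists (maxn 2 (maxn N1 (maxn N2 (maxn N3 N4)))) => N.
rewrite !geq_max => /and5P[h2 hN1 hN2 hN3 hN4].
have N0' : (0 < N)%N by apply: ltn_trans h2.
have N0 : 0 < N%:R :> R by rewrite ltr0n.
have lnN : 0 < ln N%:R :> R by rewrite ln_gt0 // ltr1n.
pose y := Num.truncn (delta * N%:R).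
have yd : y%:R <= delta * N%:R by rewrite truncn_le mulr_ge0 // ltW.
have yN : (y <= N)%N by rewrite -(ler_nat R) (le_trans yd) // ler_piMl // ltW.
have N1y : (N1 <= y)%N.
  rewrite /y truncn_ge_nat; last by rewrite mulr_ge0 ?ltW.
  rewrite mulrC -ler_pdivrMr //.
  by apply: le_trans (ltW (truncnS_gt _)) _; rewrite ler_nat.
have lnd : - ln delta <= eps / 2 * ln N%:R.
  rewrite -ler_pdivrMl ?divr_gt0 // invf_div -ler_expR [leRHS]lnK ?posrE //.
  by apply: le_trans (ltW (truncnS_gt _)) _; rewrite ler_nat.
set u := fun p : nat => circ (p%:R * alpha).
rewrite -(ler_pM2r lnN).
have -> : cabs (\sum_(1 <= p < N.+1 | prime p) u p) * ln N%:R =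
   cabs ((ln N%:R)%:C%C * \sum_(1 <= p < N.+1 | prime p) u p).
  by rewrite cabsM cabs_real gtr0_norm // mulrC.
have -> : (ln N%:R)%:C%C * \sum_(1 <= p < N.+1 | prime p) u p =
   (ln N%:R)%:C%C * \sum_(1 <= p < y.+1 | prime p) u p
   + (theta_sum alpha N - theta_sum alpha y)
   + \sum_(y.+1 <= p < N.+1 | prime p) (ln N%:R - ln p%:R)%:C%C * u p.
  rewrite /theta_sum !(@big_cat_nat _ _ _ y.+1 1%N N.+1) //= mulrDr -!addrA; congr (_ + _).
  rewrite addrCA [X in _ = _ + X]addrA subrr add0r mulr_sumr -big_split /=.
  by apply: eq_bigr => p _; rewrite -mulrDl -rmorphD /= subrKC.
have pi0 : 0 <= (prime_pi N)%:R :> R by [].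
have b1 : cabs ((ln N%:R)%:C%C * \sum_(1 <= p < y.+1 | prime p) u p)
    <= e' * N%:R + 8 * (delta * N%:R).
  apply: (@le_trans _ _ (Num.sqrt N%:R * ln N%:R + 8 * y%:R)); last first.
    by rewrite lerD ?N2P // ler_wpM2l.
  apply: le_trans (prime_pi_le N0' yN).
  rewrite cabsM cabs_real gtr0_norm // mulrC ler_wpM2r ?(ltW lnN) // prime_piE.
  by apply: le_trans (cabs_sum _ _ _) _; apply: ler_sum => p _; rewrite cabs_circ.
have b2 : cabs (theta_sum alpha N - theta_sum alpha y) <= 2 * (e' * N%:R).
  apply: le_trans (cabsB _ _) _; rewrite mulr_natl mulr2n lerD ?N1P //.
  by apply: le_trans (N1P _ N1y) _; rewrite (ler_wpM2l (ltW e'0)) // ler_nat.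
have b3 : cabs (\sum_(y.+1 <= p < N.+1 | prime p) (ln N%:R - ln p%:R)%:C%C * u p)
   <= (prime_pi N)%:R * (eps / 2 * ln N%:R).
  apply: le_trans (cabs_sum _ _ _) _.
  apply: (@le_trans _ _ (\sum_(y.+1 <= p < N.+1 | prime p) eps / 2 * ln N%:R)).
    rewrite big_nat_cond [leRHS]big_nat_cond.
    apply: ler_sum => p /andP[/andP[yp pN] pp].
    have p0 : 0 < p%:R :> R by rewrite ltr0n prime_gt0.
    rewrite cabsM cabs_circ mulr1 cabs_real ger0_norm; last first.
      by rewrite subr_ge0 ler_ln_nat ?prime_gt0.
    apply: le_trans lnd; rewrite lerBlDr addrC lerBrDr -lnM ?posrE //.
    rewrite ler_ln ?posrE ?mulr_gt0 // mulrC ltW //.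
    by apply: lt_le_trans (truncnS_gt _) _; rewrite ler_nat.
  rewrite prime_piE mulr_suml (@big_cat_nat _ _ _ y.+1 1%N N.+1) //=.
  under [X in _ <= _ + X]eq_bigr do rewrite mul1r.
  rewrite lerDr; apply: sumr_ge0 => p _; rewrite mul1r mulr_ge0 ?(ltW lnN) //.
  by rewrite divr_ge0 ?(ltW e0).
apply: le_trans (cabsD _ _) _; apply: le_trans (lerD (cabsD _ _) (lexx _)) _.
apply: le_trans (lerD (lerD b1 b2) b3) _.
have pl := prime_pi_ln_ge h2.
set P := (prime_pi N)%:R in pi0 pl *; set L := ln N%:R in lnN pl *.
have b4 := ler_wpM2r (ltW N0) de.
have b5 := ler_wpM2l (ltW e0) pl.
rewrite /e'; move: b4 b5; clear.
set n := N%:R; move: P L delta n => P L delta n b4 b5.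
nra.
Qed.

End PrimeSums.

(** * Equidistribution *)

Section Equidistribution.
Context {R : realType}.

(** Stated without division by [prime_pi N], which may be [0]. The sum is over [p < N] but
    [prime_pi N] counts [p <= N], as in [satisfies_PNT]; the one possible extra prime is negligible
    since [prime_pi] is unbounded. *)
Definition prime_mean (u : nat -> R) (c : R) := forall eps, 0 < eps ->
  exists N0, forall N, (N0 <= N)%N ->
   `|\sum_(0 <= p < N | prime p) u p - c * (prime_pi N)%:R| <= eps * (prime_pi N)%:R.

Lemma prime_pi_unbounded (M : R) : exists N0, forall N, (N0 <= N)%N -> M <= (prime_pi N)%:R.
Proof.
have [N1 N1P] := @sqrt_ln_littleo R 1 ltr01.
exists (maxn 2 (maxn N1 (Num.truncn ((6 * `|M|) ^+ 2)).+1)) => N.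
rewrite !geq_max => /and3P[h2 h1 hM].
have N0 : 0 < N%:R :> R by rewrite ltr0n; apply: ltn_trans h2.
have s0 : 0 < Num.sqrt N%:R :> R by rewrite sqrtr_gt0.
have sM : 6 * `|M| <= Num.sqrt N%:R.
  rewrite -[leLHS]ger0_norm ?mulr_ge0 // -sqrtr_sqr ler_wsqrtr //.
  by apply: le_trans (ltW (truncnS_gt _)) _; rewrite ler_nat.
have := N1P N h1; rewrite mul1r => sl.
have := @prime_pi_ln_ge R N h2; set P := (prime_pi N)%:R => pl.
have P0 : 0 <= P by [].
have : Num.sqrt N%:R <= 6 * P.
  rewrite -(ler_pM2r N0) -mulrA.
  apply: le_trans (ler_wpM2l (ltW s0) pl) _.
  rewrite (_ : _ * (6 * _) = 6 * (P * (Num.sqrt N%:R * ln N%:R))); last by ring.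
  by rewrite ler_wpM2l // ler_wpM2l.
by have := ler_norm M; move: sM; clear; lra.
Qed.

Lemma prime_mean_ext (u v : nat -> R) c : u =1 v -> prime_mean u c -> prime_mean v c.
Proof. by move=> /funext ->. Qed.

Lemma prime_meanD u v c d : prime_mean u c -> prime_mean v d ->
  prime_mean (fun p => u p + v p) (c + d).
Proof.
move=> uc vd eps e0; have e2 : 0 < eps / 2 by rewrite divr_gt0.
have [N1 h1] := uc _ e2; have [N2 h2] := vd _ e2.
exists (maxn N1 N2) => N; rewrite geq_max => /andP[l1 l2].
rewrite big_split /= mulrDl opprD addrACA [eps]splitr mulrDl.
by apply: le_trans (ler_normD _ _) _; rewrite lerD ?h1 ?h2.
Qed.

Lemma prime_meanZ u c a : prime_mean u c -> prime_mean (fun p => a * u p) (a * c).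
Proof.
move=> uc eps e0; have a0 : 0 < `|a| + 1 by rewrite ltr_wpDl.
have [N1 h1] := uc (eps / (`|a| + 1)) (divr_gt0 e0 a0).
exists N1 => N /h1 {}h1; rewrite -mulr_sumr -mulrA -mulrBr normrM.
apply: le_trans (ler_wpM2l (normr_ge0 _) h1) _.
rewrite mulrA ler_wpM2r // mulrCA ler_piMr ?(ltW e0) // ler_pdivrMr // mul1r.
by rewrite lerDl.
Qed.

Lemma prime_mean_sum (I : Type) (r : seq I) (u : I -> nat -> R) (c : I -> R) :
  (forall i, prime_mean (u i) (c i)) ->
  prime_mean (fun p => \sum_(i <- r) u i p) (\sum_(i <- r) c i).
Proof.
move=> uc; elim: r => [|i r IH].
  apply: (@prime_mean_ext (fun=> 0)) => [p|eps e0]; first by rewrite big_nil.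
  by exists 0%N => N _; rewrite big1 // big_nil mul0r subr0 normr0 mulr_ge0 // ltW.
rewrite big_cons; apply: prime_mean_ext (prime_meanD (uc i) IH) => p.
by rewrite big_cons.
Qed.

Lemma sum_primes_lt (V : zmodType) (u : nat -> V) N :
  \sum_(0 <= p < N | prime p) u p =
  \sum_(1 <= p < N.+1 | prime p) u p - (if prime N then u N else 0).
Proof.
case: N => [|N]; first by rewrite !big_geq // subr0.
rewrite [LHS]big_mkcond [X in _ = X - _]big_mkcond [LHS]big_ltn //= add0r.
by rewrite [in RHS]big_nat_recr //= addrK.
Qed.

Lemma prime_mean1 : prime_mean (fun=> 1) 1.
Proof.
move=> eps e0; have [N0 h] := prime_pi_unbounded eps^-1.
exists N0 => N /h {}h; rewrite sum_primes_lt -prime_piE mul1r addrAC subrr add0r normrN.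
apply: (@le_trans _ _ 1); first by case: ifP; rewrite ?normr1 ?normr0.
by rewrite mulrC -ler_pdivrMr // mul1r.
Qed.

Lemma prime_mean_circ (x beta : R) : aperiodic beta ->
  prime_mean (fun p => complex.Re (circ (x + p%:R * beta))) 0.
Proof.
move=> irr eps e0; have e2 : 0 < eps / 2 by rewrite divr_gt0.
have [N1 h1] := prime_circ_sum_littleo irr e2.
have [N2 h2] := prime_pi_unbounded (eps / 2)^-1.
exists (maxn N1 N2) => N; rewrite geq_max => /andP[/h1 {}h1 /h2 {}h2].
rewrite mul0r subr0.
have -> : \sum_(0 <= p < N | prime p) complex.Re (circ (x + p%:R * beta)) =
   complex.Re (circ x * \sum_(0 <= p < N | prime p) circ (p%:R * beta)).
  rewrite mulr_sumr raddf_sum; apply: eq_bigr => p _.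
  by rewrite circD.
apply: le_trans (Re_le_cabs _) _; rewrite cabsM cabs_circ mul1r sum_primes_lt.
apply: le_trans (cabsB _ _) _; rewrite [eps]splitr mulrDl lerD //.
apply: (@le_trans _ _ 1); first by case: ifP; rewrite ?cabs_circ ?cabs0.
by rewrite mulrC -ler_pdivrMr // mul1r.
Qed.

Lemma aperiodic_diff (alpha : R) (k l : nat) : aperiodic alpha -> k != l ->
  aperiodic ((k%:R - l%:R) * alpha).
Proof.
move=> irr kl; have [lk|kl'] := leqP l k.
  by rewrite -natrB //; apply: aperiodicMn => //; rewrite subn_gt0 ltn_neqAle eq_sym kl.
move=> n n0; rewrite -ndN -mulrN -mulNr opprB -natrB ?(ltnW kl') //.
by apply: aperiodicMn => //; rewrite subn_gt0.
Qed.

(** Fejer's kernel, of mean [1]. Written as a square it is visibly nonnegative and decays like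
    [1 / (K ||t||^2)]. *)
Definition fejer (K : nat) (t : R) : R :=
  cabs (\sum_(0 <= k < K) circ (k%:R * t)) ^+ 2 / K%:R.

Lemma fejer_ge0 K t : 0 <= fejer K t.
Proof. by rewrite divr_ge0 // sqr_ge0. Qed.

Lemma fejerE K t : fejer K t = K%:R^-1 * \sum_(0 <= k < K) \sum_(0 <= l < K)
  complex.Re (circ ((k%:R - l%:R) * t)).
Proof.
rewrite /fejer mulrC; congr (_ * _).
transitivity (complex.Re ((cabs (\sum_(0 <= k < K) circ (k%:R * t)) ^+ 2)%:C%C)) => //.
rewrite cabs_sqr mulr_suml raddf_sum; apply: eq_bigr => k _.
rewrite [X in _ * X]rmorph_sum mulr_sumr raddf_sum; apply: eq_bigr => l _.
by rewrite mulrBl circD circN.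
Qed.

Lemma fejer_le K t : 0 < nd t -> fejer K t <= (K%:R * nd t ^+ 2)^-1.
Proof.
move=> t0; rewrite /fejer mulrC invfM ler_wpM2l ?invr_ge0 // -exprVn.
by rewrite lerXn2r ?nnegrE ?cabs_ge0 ?invr_ge0 ?nd_ge0 // sum_circ_le.
Qed.

(** In the expansion [fejerE] the terms [k != l] have mean [0] by Vinogradov's theorem at
    [(k - l) alpha]; the [K] diagonal terms, divided by [K], leave [1]. *)
Lemma prime_mean_fejer (alpha x : R) K : aperiodic alpha -> (0 < K)%N ->
  prime_mean (fun p => fejer K (x + p%:R * alpha)) 1.
Proof.
move=> irr K0.
have E : 1 = K%:R^-1 * \sum_(0 <= k < K) \sum_(0 <= l < K) (k == l)%:R :> R.
  rewrite (eq_big_nat _ _ (F2 := fun=> 1)) => [|k /andP[_ kK]].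
    by rewrite sumr_const_nat subn0 mulVf // pnatr_eq0 -lt0n.
  rewrite (bigD1_seq k) ?iota_uniq ?mem_index_iota //= eqxx big1 ?addr0 // => l lk.
  by rewrite eq_sym (negbTE lk).
rewrite [X in prime_mean _ X]E.
apply: (@prime_mean_ext (fun p => K%:R^-1 * \sum_(0 <= k < K) \sum_(0 <= l < K)
  complex.Re (circ ((k%:R - l%:R) * (x + p%:R * alpha))))) => [p|].
  by rewrite fejerE.
apply: prime_meanZ; apply: prime_mean_sum => k; apply: prime_mean_sum => l.
have [->|kl] := eqVneq k l.
  by apply: prime_mean_ext prime_mean1 => p; rewrite subrr mul0r circ0.
apply: prime_mean_ext (prime_mean_circ ((k%:R - l%:R) * x) (aperiodic_diff irr kl)) => p.
by rewrite mulrDr [in RHS]mulrCA.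
Qed.

Lemma sum_circ_grid (K k l : nat) (t : R) : (k < K)%N -> (l < K)%N -> k != l ->
  \sum_(0 <= m < K) circ ((k%:R - l%:R) * (t - m%:R / K%:R)) = 0.
Proof.
move=> kK lK kl; have K0 : 0 < K%:R :> R by rewrite ltr0n (leq_ltn_trans _ kK).
pose s : R := - (k%:R - l%:R) / K%:R.
transitivity (circ ((k%:R - l%:R) * t) * \sum_(0 <= m < K) circ (m%:R * s)).
  rewrite mulr_sumr; apply: eq_bigr => m _; rewrite -circD; congr circ.
  by rewrite /s; ring.
have E : (circ s - 1) * \sum_(0 <= m < K) circ (m%:R * s) = 0.
  rewrite mulr_sumr (eq_bigr (fun m => circ (m.+1%:R * s) - circ (m%:R * s))); last first.
    by move=> m _; rewrite mulrBl mul1r -circD -natr1 mulrDl mul1r [s + _]addrC.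
  rewrite telescope_sumr // mul0r circ0 (_ : K%:R * s = (l%:Z - k%:Z)%:~R).
    by rewrite circ_int subrr.
  by rewrite /s intrB -!pmulrn; field; rewrite gt_eqF.
have s0 : 0 < nd s.
  rewrite lt_def nd_ge0 andbT; apply/eqP => /nd_eq0 [j sj].
  have : (l%:Z - k%:Z = j * K%:Z).
    apply/eqP; rewrite -(eqr_int R) intrB intrM -!pmulrn -sj /s divfK ?(gt_eqF K0) //.
    by rewrite opprB.
  move: kl kK lK; clear => /eqP kl kK lK jE.
  have [j0|[j1|j1]] : j = 0 \/ 1 <= j \/ j <= -1 by lia.
  - by rewrite j0 in jE; lia.
  - have : K%:Z <= j * K%:Z by rewrite -[leLHS]mul1r ler_wpM2r.
    by lia.
  have : j * K%:Z <= -1 * K%:Z by rewrite ler_wpM2r.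
  by lia.
move/eqP: E; rewrite mulf_eq0 => /orP[/eqP c0|/eqP ->]; last by rewrite mulr0.
exfalso; have := circ_sub1_ge s; rewrite c0 cabs0 => h; move: s0 h; clear; lra.
Qed.

(** The frequencies [k - l] are below [K] in absolute value, so summing over the grid kills all of
    them except [0]. The finite grid takes the place of the integral in the usual convolution. *)
Lemma sum_fejer_grid (K : nat) (t : R) :
  \sum_(0 <= m < K) fejer K (t - m%:R / K%:R) = K%:R.
Proof.
have [->|K0] := posnP K; first by rewrite big_geq.
have Kn : K%:R != 0 :> R by rewrite pnatr_eq0 -lt0n.
under eq_bigr do rewrite fejerE.
rewrite -mulr_sumr exchange_big.
transitivity (K%:R^-1 * \sum_(0 <= k < K) K%:R : R); last first.
  by rewrite sumr_const_nat subn0 -[K%:R *+ K]mulr_natl mulrA mulVf ?mul1r.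
congr (_ * _); apply: eq_big_nat => k /andP[_ kK]; rewrite exchange_big.
rewrite (bigD1_seq k) ?iota_uniq ?mem_index_iota // -[RHS]addr0; congr (_ + _).
  rewrite (eq_bigr (fun=> 1)) ?sumr_const_nat ?subn0 // => m _.
  by rewrite subrr mul0r circ0.
rewrite big_seq_cond big1 // => l lP; have [+ lk] := andP lP.
rewrite mem_index_iota => /andP[_ lK].
by rewrite -raddf_sum sum_circ_grid // eq_sym.
Qed.

Lemma circ_near1 (eta : R) : 0 < eta ->
  exists2 delta, 0 < delta & forall t, nd t < delta -> cabs (circ t - 1) <= eta.
Proof.
move=> eta0; have h0 : 0 < eta ^+ 2 / 2 by rewrite divr_gt0 // exprn_gt0.
have := @continuous_cos R 0; move=> /cvgrPdist_lt /(_ _ h0).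
rewrite cos0 => /nbhs_ballP [d /= d0 dP].
have pi2 : 0 < 2 * pi :> R by rewrite mulr_gt0 // pi_gt0.
exists (d / (2 * pi)); first by rewrite divr_gt0.
move=> t td; set s := t - (nint t)%:~R.
have -> : circ t = circ s by rewrite /s -mulrNz circDint.
have : `|1 - cos (2 * pi * s)| < eta ^+ 2 / 2.
  apply: dP; rewrite /ball /= sub0r normrN normrM gtr0_norm // mulrC -ltr_pdivlMr //.
have c1 := cos_le1 (2 * pi * s); rewrite ger0_norm ?subr_ge0 // => hc.
rewrite -(ler_pXn2r (isT : 0 < 2)%N) ?nnegrE ?cabs_ge0 ?ltW //.
rewrite /cabs normc_def /= sqr_sqrtr ?addr_ge0 ?sqr_ge0 //.
have := cos2Dsin2 (2 * pi * s); set c := cos _ in hc c1 *; set i := sin _ => ci.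
rewrite subr0; move: hc ci; clear; set e := eta ^+ 2; nra.
Qed.

(** Near [0] the kernel is close to its peak value [L], so [(2 / L) fejer L] majorises the indicator
    of a neighbourhood of [0] although its mean is only [2 / L]. *)
Lemma fejer_peak (L : nat) : (0 < L)%N ->
  exists2 delta, 0 < delta & forall t, nd t < delta -> 1 <= 2 / L%:R * fejer L t.
Proof.
move=> L0; have Lr : 0 < L%:R :> R by rewrite ltr0n.
have L4 : 0 < (4 * L%:R)^-1 :> R by rewrite invr_gt0 mulr_gt0.
have [d d0 dP] := circ_near1 L4.
exists d => // t /dP {}dP.
have circk k : cabs (circ (k%:R * t) - 1) <= k%:R * cabs (circ t - 1).
  elim: k => [|k IH]; first by rewrite mul0r circ0 subrr cabs0 mul0r.
  rewrite -natr1 mulrDl mul1r circD (_ : _ - 1 = circ (k%:R * t) * (circ t - 1)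
    + (circ (k%:R * t) - 1)); last by ring.
  apply: le_trans (cabsD _ _) _; rewrite cabsM cabs_circ mul1r addrC mulrDl mul1r.
  by rewrite lerD2r.
set S := \sum_(0 <= k < L) circ (k%:R * t).
have : cabs (L%:R - S) <= L%:R / 4.
  have -> : L%:R - S = \sum_(0 <= k < L) (1 - circ (k%:R * t)).
    by rewrite sumrB sumr_const_nat subn0.
  apply: le_trans (cabs_sum _ _ _) _.
  apply: (@le_trans _ _ (\sum_(0 <= k < L) 4^-1)).
    apply: ler_sum_nat => k /andP[_ kL]; rewrite cabs_distrC.
    apply: le_trans (circk k) _.
    apply: (@le_trans _ _ (L%:R * (4 * L%:R)^-1)).
      by apply: ler_pM => //; [exact: cabs_ge0|rewrite ler_nat ltnW].
    by rewrite invfM mulrCA mulfV ?mulr1 // gt_eqF.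
  by rewrite sumr_const_nat subn0 -[_ *+ L]mulr_natl.
have : L%:R <= cabs (L%:R - S) + cabs S.
  have := cabsD (L%:R - S) S; rewrite subrK.
  by rewrite -[X in cabs X <= _](rmorph_nat (real_complex R)) cabs_real ger0_norm.
move=> h1 h2; have h3 : 3 / 4 * L%:R <= cabs S by move: h1 h2; clear; lra.
rewrite /fejer -/S (_ : 2 / _ * _ = 2 * (cabs S / L%:R) ^+ 2); last first.
  by field; rewrite gt_eqF.
have h4 : 3 / 4 <= cabs S / L%:R by rewrite ler_pdivlMr.
by move: h4; clear; set y := cabs S / _; nra.
Qed.

(** Grid points near [t] contribute the oscillation of [h], distant ones the decay of the kernel. If
    [t] is near some [c] in [D], only the bound [2 B] is available; the majorant of [fejer_peak]
    around [c] pays for it. *)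
Lemma fejer_approx (h : R -> R) (B eps : R) (D : seq R) : 0 < B -> 0 < eps ->
  (forall t, `|h t| <= B) ->
  (forall delta, 0 < delta -> forall t t', (forall c, c \in D -> delta <= nd (t - c)) ->
     nd (t - t') < delta -> `|h t - h t'| <= eps) ->
  exists K L : nat, [/\ (0 < K)%N, (0 < L)%N, 2 * B * (size D)%:R * (2 / L%:R) <= eps &
    forall t, `|h t - K%:R^-1 * \sum_(0 <= m < K) h (m%:R / K%:R) * fejer K (t - m%:R / K%:R)|
      <= 2 * eps + 2 * B * \sum_(c <- D) 2 / L%:R * fejer L (t - c)].
Proof.
move=> B0 e0 hB osc.
(* [L] depends on the number of exceptional points, [delta] on [L], and [K] on [delta]. *)
pose L := (Num.truncn (4 * B * (size D)%:R / eps)).+1.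
have Lr : 0 < L%:R :> R by rewrite ltr0n.
have [delta d0 peak] := @fejer_peak L isT.
pose K := (Num.truncn (2 * B / (eps * delta ^+ 2))).+1.
have Kr : 0 < K%:R :> R by rewrite ltr0n.
have dd : 0 < eps * delta ^+ 2 by rewrite mulr_gt0 // exprn_gt0.
have Kle : 2 * B * (K%:R * delta ^+ 2)^-1 <= eps.
  have : 2 * B / (eps * delta ^+ 2) <= K%:R by rewrite ltW // truncnS_gt.
  rewrite ler_pdivrMr // => hK; rewrite ler_pdivrMr ?mulr_gt0 ?exprn_gt0 //.
  by rewrite (_ : eps * _ = K%:R * (eps * delta ^+ 2)) //; ring.
exists K, L; split => //.
  have : 4 * B * (size D)%:R / eps <= L%:R by rewrite ltW // truncnS_gt.
  rewrite ler_pdivrMr // => hL; rewrite mulrA ler_pdivrMr //.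
  by rewrite [eps * _]mulrC; move: hL; clear; lra.
move=> t.
have tail0 : 0 <= 2 * B * \sum_(c <- D) 2 / L%:R * fejer L (t - c).
  rewrite mulr_ge0 ?mulr_ge0 ?(ltW B0) //; apply: sumr_ge0 => c _.
  by rewrite mulr_ge0 ?fejer_ge0 // divr_ge0.
have -> : h t - K%:R^-1 * \sum_(0 <= m < K) h (m%:R / K%:R) * fejer K (t - m%:R / K%:R)
  = K%:R^-1 * \sum_(0 <= m < K) (h t - h (m%:R / K%:R)) * fejer K (t - m%:R / K%:R).
  under [in RHS]eq_bigr do rewrite mulrBl.
  by rewrite sumrB -[in RHS]mulr_sumr sum_fejer_grid mulrBr mulrCA mulVf ?mulr1 // gt_eqF.
rewrite normrM ger0_norm ?invr_ge0 // mulrC ler_pdivrMr //.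
apply: le_trans (ler_norm_sum _ _ _) _.
have h2B m : `|h t - h (m%:R / K%:R)| <= 2 * B.
  apply: le_trans (ler_normB _ _) _.
  by rewrite (_ : 2 * B = B + B) ?lerD //; ring.
have [|far] := pselect (exists2 c, c \in D & nd (t - c) < delta).
  move=> [c cD ct].
  apply: (@le_trans _ _ (\sum_(0 <= m < K) 2 * B * fejer K (t - m%:R / K%:R))).
    by apply: ler_sum => m _; rewrite normrM [X in _ * X]ger0_norm ?fejer_ge0 // ler_wpM2r ?fejer_ge0.
  rewrite -mulr_sumr sum_fejer_grid ler_wpM2r //.
  apply: (@le_trans _ _ (2 * B * \sum_(c <- D) 2 / L%:R * fejer L (t - c))); last first.
    by rewrite lerDr mulr_ge0 // ltW.
  rewrite -[leLHS]mulr1 ler_wpM2l ?mulr_ge0 ?(ltW B0) //.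
  apply: le_trans (peak _ ct) _.
  rewrite (big_rem c) //= lerDl; apply: sumr_ge0 => i _.
  by rewrite mulr_ge0 ?fejer_ge0 // divr_ge0.
have {}far c : c \in D -> delta <= nd (t - c).
  by move=> cD; rewrite leNgt; apply/negP => ct; apply: far; exists c.
apply: (@le_trans _ _ (\sum_(0 <= m < K) (eps * fejer K (t - m%:R / K%:R) + eps))).
  apply: ler_sum => m _; rewrite normrM [X in _ * X]ger0_norm ?fejer_ge0 //.
  have [close|apart] := ltP (nd (t - m%:R / K%:R)) delta.
    apply: (@le_trans _ _ (eps * fejer K (t - m%:R / K%:R))).
      by rewrite ler_wpM2r ?fejer_ge0 // (osc delta).
    by rewrite lerDl ltW.
  apply: (@le_trans _ _ eps); last by rewrite lerDr mulr_ge0 ?fejer_ge0 // ltW.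
  apply: le_trans Kle; apply: ler_pM => //; first exact: fejer_ge0.
  have n0 := lt_le_trans d0 apart; apply: le_trans (fejer_le _ n0) _.
  rewrite lef_pV2 ?posrE ?(mulr_gt0 Kr) ?exprn_gt0 //.
  by rewrite ler_wpM2l // lerXn2r ?nnegrE ?nd_ge0 // ltW.
rewrite big_split /= -mulr_sumr sum_fejer_grid sumr_const_nat subn0 -[eps *+ K]mulr_natr.
rewrite -mulrDl ler_wpM2r // (_ : eps + eps = 2 * eps); last by ring.
by rewrite lerDl.
Qed.

(** The constant [c] is a mean of [h] over a grid and depends on [eps]; the actual limit arises
    later from completeness. The set [D] may also depend on [eps], as for functions of infinitely
    many coordinates. *)
Theorem prime_equidistribution (alpha x B : R) (h : R -> R) : aperiodic alpha ->
  (forall t, `|h t| <= B) ->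
  (forall eps, 0 < eps -> exists D : seq R, forall delta, 0 < delta ->
     forall t t', (forall c, c \in D -> delta <= nd (t - c)) ->
     nd (t - t') < delta -> `|h t - h t'| <= eps) ->
  forall eps, 0 < eps -> exists c : R, exists N0, forall N, (N0 <= N)%N ->
    `|\sum_(0 <= p < N | prime p) h (x + p%:R * alpha) - c * (prime_pi N)%:R|
      <= eps * (prime_pi N)%:R.
Proof.
move=> irr hB osc eps eps0; pose e := eps / 5.
have e0 : 0 < e by rewrite divr_gt0.
have [D DP] := osc _ e0.
have B0 : 0 < `|B| + 1 by rewrite ltr_wpDl.
have hB1 t : `|h t| <= `|B| + 1.
  by apply: le_trans (hB t) _; apply: le_trans (ler_norm _) _; rewrite lerDl.
have [K [L [K0 L0 De approx]]] := fejer_approx B0 e0 hB1 DP.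
pose g t := K%:R^-1 * \sum_(0 <= m < K) h (m%:R / K%:R) * fejer K (t - m%:R / K%:R).
pose w t := 2 * e + 2 * (`|B| + 1) * \sum_(c <- D) 2 / L%:R * fejer L (t - c).
pose u t p := t + p%:R * alpha.
have fm (M : nat) (c : R) : (0 < M)%N -> prime_mean (fun p => fejer M (u x p - c)) 1.
  move=> M0; apply: prime_mean_ext (prime_mean_fejer (x - c) irr M0) => p.
  by rewrite /u addrAC.
pose cg := K%:R^-1 * \sum_(0 <= m < K) h (m%:R / K%:R) * 1.
have gm : prime_mean (fun p => g (u x p)) cg.
  apply: prime_meanZ; apply: prime_mean_sum => m; apply: prime_meanZ; exact: fm.
pose cw := 2 * e * 1 + 2 * (`|B| + 1) * \sum_(c <- D) 2 / L%:R * 1.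
have wm : prime_mean (fun p => w (u x p)) cw.
  apply: (@prime_mean_ext (fun p => 2 * e * 1
      + 2 * (`|B| + 1) * \sum_(c <- D) 2 / L%:R * fejer L (u x p - c))).
    by move=> p; rewrite mulr1.
  apply: prime_meanD; first exact: (prime_meanZ _ prime_mean1).
  apply: prime_meanZ; apply: prime_mean_sum => c; apply: prime_meanZ; exact: fm.
have cw3 : cw <= 3 * e.
  have -> : cw = 2 * e + 2 * (`|B| + 1) * (size D)%:R * (2 / L%:R).
    rewrite /cw; have -> : \sum_(c <- D) 2 / L%:R * 1 = (size D)%:R * (2 / L%:R) :> R; last first.
      by ring.
    elim: D {DP De approx w cw wm} => [|c D IH]; first by rewrite big_nil mul0r.
    by rewrite big_cons IH /= -natr1; ring.
  by move: De; clear; set z := 2 * _ * _ * _; lra.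
have [N1 h1] := gm _ e0; have [N2 h2] := wm _ e0.
exists cg, (maxn N1 N2) => N; rewrite geq_max => /andP[/h1 {}h1 /h2 {}h2].
set P := (prime_pi N)%:R in h1 h2 *; have P0 : 0 <= P by [].
set H := \sum_(_ <= p < N | _) _; set G := \sum_(_ <= p < N | _) _ in h1.
set W := \sum_(_ <= p < N | _) _ in h2.
have HG : `|H - G| <= W.
  rewrite /H /G -sumrB; apply: le_trans (ler_norm_sum _ _ _) _.
  by apply: ler_sum => p _; exact: approx.
have cwP : cw * P <= 3 * e * P by rewrite ler_wpM2r.
have e5 : eps * P = 5 * (e * P) by rewrite /e; field.
have h3 := le_trans (ler_norm _) h2.
have := ler_distD G H (cg * P).
rewrite e5; move: HG h1 h3 cwP; rewrite -[3 * e * P]mulrA.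
set a1 := `|H - G|; set a2 := `|G - _|; set a3 := `|H - _|; set y := cw * P.
set z := e * P; clear.
by lra.
Qed.

End Equidistribution.

(** * The subshift *)

Section Symbolic.
Local Open Scope classical_set_scope.

Definition agree (M : nat) (y z : full_shift) :=
  forall k : int, (`|k| <= M)%N -> y k = z k.

Lemma agree_sub m n y z : (m <= n)%N -> agree n y z -> agree m y z.
Proof. by move=> mn yz k km; apply: yz; exact: leq_trans mn. Qed.

Lemma nbhs_coord (p : full_shift) (k : int) : nbhs p [set q : full_shift | p k = q k].
Proof.
have h := @proj_continuous int (fun=> bool) k p.
have {}h : nbhs p (proj k @^-1` [set p k]).
  by apply: h; exact: discrete_set1.
by apply: filterS h => q pq; exact: esym pq.
Qed.

Lemma nbhs_agree (p : full_shift) (M : nat) : nbhs p [set q | agree M p q].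
Proof.
elim: M => [|M IH].
  by apply: filterS (nbhs_coord p 0) => q /= pq k; rewrite leqn0 absz_eq0 => /eqP ->.
have h : nbhs p ([set q | agree M p q] `&`
    ([set q : full_shift | p M.+1%:Z = q M.+1%:Z] `&`
     [set q : full_shift | p (- M.+1%:Z) = q (- M.+1%:Z)])).
  by apply: filterI IH (filterI _ _); exact: nbhs_coord.
apply: filterS h => q [pq [q1 q2]] k; rewrite leq_eqVlt => /orP[/eqP kM|kM].
  have [->//|->//] : k = M.+1%:Z \/ k = - M.+1%:Z by lia.
exact: pq.
Qed.

(** The sets that contain a cylinder around [p] form a filter converging to [p] in each coordinate,
    hence in the product topology. *)
Lemma agree_base (p : full_shift) (U : set full_shift) : nbhs p U ->
  exists M, [set q | agree M p q] `<=` U.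
Proof.
pose G : set_system full_shift := [set U | exists M, [set q | agree M p q] `<=` U].
have GF : Filter G.
  split.
  - by exists 0%N.
  - move=> A B [m mA] [n nB]; exists (maxn m n) => q pq; split.
      by apply: mA; apply: agree_sub pq; exact: leq_maxl.
    by apply: nB; apply: agree_sub pq; exact: leq_maxr.
  - by move=> A B AB [m mA]; exists m => q /mA /AB.
suff : G --> p by apply.
apply/cvg_sup => k V [W [[Z oZ <-]] /= Zp ZV]; exists `|k|%N => q pq.
have E : proj k q = proj k p := esym (pq k (leqnn _)).
apply: ZV; rewrite -[(_ @^-1` Z) q]/(Z (proj k q)) E; exact: Zp.
Qed.

Lemma full_shift_compact : compact [set: full_shift].
Proof.
have := @tychonoff int (fun=> bool) (fun=> setT) (fun=> bool_compact).
by congr (compact _); apply/seteqP; split.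
Qed.

Lemma full_shift_cluster (z : nat -> full_shift) : exists p : full_shift,
  forall M m0, exists m, (m0 <= m)%N /\ agree M p (z m).
Proof.
have [p [_ pc]] := @full_shift_compact (z n @[n --> \oo]) _ filterT.
exists p => M m0.
have [|q [[m mm <-] pq]] := pc (z @` [set n | (m0 <= n)%N]) _ _ (nbhs_agree p M).
  by exists m0 => // n /= nm; exists n.
by exists m.
Qed.

Section Xset_functions.
Context {R : realType} (alpha beta : R).
Let X := set_type (Xset alpha beta).

Lemma Xset_agree (p : full_shift) :
  (forall M, exists2 q, Xset alpha beta q & agree M p q) -> Xset alpha beta p.
Proof.
move=> h B /agree_base [M MB].
have [q Xq pq] := h M.
have [x [cx qx]] := Xq _ (nbhs_agree q M).
exists x; split => //; apply: MB => k kM.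
by rewrite (pq k kM) (qx k kM).
Qed.

Lemma X_cluster (z : nat -> X) : exists p : X,
  forall M m0, exists m, (m0 <= m)%N /\ agree M (val p) (val (z m)).
Proof.
have [p pc] := full_shift_cluster (fun n => val (z n)).
have Xp : Xset alpha beta p.
  apply: Xset_agree => M; have [m [_ pm]] := pc M 0%N.
  by exists (val (z m)) => //; exact: set_valP.
by exists (exist _ p (mem_set Xp)).
Qed.

(** Continuity expressed by coordinates, which keeps the subspace topology on [X] out of the
    compactness arguments. *)
Definition cylinder_continuous (u : X -> R) := forall (z : X) (eps : R), 0 < eps ->
  exists M, forall z' : X, agree M (val z) (val z') -> `|u z - u z'| <= eps.

(** Heine-Cantor: the first components of counterexamples on growing windows cluster at some [p];
    the second components agree with [p] on the same windows, against continuity at [p]. *)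
Lemma cylinder_uniform (u : X -> R) : cylinder_continuous u ->
  forall eps, 0 < eps -> exists M, forall z z' : X,
    agree M (val z) (val z') -> `|u z - u z'| <= eps.
Proof.
move=> uc eps e0; apply: contrapT => /forallNP h.
have {}h M : exists zz : X * X, agree M (val zz.1) (val zz.2) /\
    eps < `|u zz.1 - u zz.2|.
  apply: contrapT => h'; apply: (h M) => z z' zz'; rewrite leNgt; apply/negP => lt.
  by apply: h'; exists (z, z').
have [zz zzP] := choice h.
have [p pc] := X_cluster (fun n => (zz n).1).
have e2 : 0 < eps / 2 by rewrite divr_gt0.
have [M MP] := uc p _ e2.
have [m [Mm pm]] := pc M M.
have [ag lt] := zzP m.
have := MP _ pm; have : agree M (val p) (val (zz m).2).
  move=> k kM; rewrite (pm k kM); exact: (agree_sub Mm ag).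
move=> /MP h1 h2; move: lt; rewrite ltNge => /negP; apply.
apply: le_trans (ler_distD (u p) _ _) _; rewrite [eps]splitr lerD //.
by rewrite distrC.
Qed.

Lemma cylinder_bounded (u : X -> R) : cylinder_continuous u ->
  exists B, forall z, `|u z| <= B.
Proof.
move=> uc; apply: contrapT => /forallNP h.
have {}h (n : nat) : exists z : X, n%:R < `|u z|.
  apply: contrapT => h'; apply: (h n%:R) => z; rewrite leNgt; apply/negP => lt.
  by apply: h'; exists z.
have [z zP] := choice h.
have [p pc] := X_cluster z.
have [M MP] := uc p 1 ltr01.
have [m [mm pm]] := pc M (Num.truncn (`|u p| + 1)).+1.
have := MP _ pm; have := zP m; have : `|u p| + 1 < m%:R.
  by apply: lt_le_trans (truncnS_gt _) _; rewrite ler_nat.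
have : `|u (z m)| <= `|u p| + `|u p - u (z m)|.
  by rewrite (distrC (u p)) -[X in `|X| <= _](addrNK (u p)) addrC ler_normD.
set a := `|u (z m)|; set b := `|u p - _|; set c := `|u p|; set d := m%:R; clear.
by lra.
Qed.

End Xset_functions.
End Symbolic.

(* The other imports define constants with the same names. *)
Local Notation frac := Defs.frac.
Local Notation code := Defs.code.

(** * Codes of rotation orbits *)

Section RotationCode.
Context {R : realType}.
Local Open Scope classical_set_scope.
Local Open Scope ring_scope.

Lemma aperiodic_irrational (alpha : R) : irrational alpha -> aperiodic alpha.
Proof.
move=> irr k k0; rewrite lt_def nd_ge0 andbT; apply/eqP => /nd_eq0 [j kj].
apply: irr; apply/rationalP; exists j, k.
by rewrite -kj [k%:R * alpha]mulrC mulfK // pnatr_eq0 -lt0n.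
Qed.

Lemma frac_ge0 (x : R) : 0 <= frac x.
Proof. by rewrite /frac subr_ge0 floor_le. Qed.

Lemma frac_lt1 (x : R) : frac x < 1.
Proof. by rewrite /frac ltrBlDl -intrD1 floorD1_gt. Qed.

Lemma frac_fracD (x y : R) : frac (frac x + y) = frac (x + y).
Proof.
by rewrite -(fracDz (x + y) (- Num.floor x)) mulrNz [x + y - _]addrAC.
Qed.

Lemma rotation_iterE (alpha x : R) (k : int) : x \in `[0, 1[ ->
  rotation_iter alpha k x = frac (x + k%:~R * alpha).
Proof.
move=> x01.
have it (a : R) n : iter n (rotation a) x = frac (x + n%:R * a).
  elim: n => [|n IH]; first by rewrite /= mul0r addr0 (frac_id x01).
  by rewrite iterS IH /rotation frac_fracD -natr1 mulrDl mul1r addrA.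
case: k => n; first by rewrite /= it.
by rewrite /rotation_iter it NegzE mulrNz mulrN mulNr.
Qed.

Lemma codeE (alpha beta x : R) (k : int) : x \in `[0, 1[ ->
  code alpha beta x k = (beta <= frac (x + k%:~R * alpha)).
Proof.
by move=> x01; rewrite /code rotation_iterE // in_itv /= frac_lt1 andbT.
Qed.

Lemma frac_itv (x : R) : frac x \in `[0, 1[.
Proof. by rewrite in_itv /= frac_ge0 frac_lt1. Qed.

(** On the circle the indicator of [[beta, 1)] jumps only at [0] and [beta]. If [s] keeps distance
    [delta] from both, the lift [f - e] of [s'] stays in [[0, 1)] and on the same side of [beta]. *)
Lemma frac_ge_stable (beta delta s s' : R) : 0 <= beta < 1 -> delta <= nd s ->
  delta <= nd (s - beta) -> nd (s - s') < delta ->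
  (beta <= frac s) = (beta <= frac s').
Proof.
move=> /andP[b0 b1] ds dsb ss'.
set f := frac s; have f0 := frac_ge0 s; have f1 := frac_lt1 s; rewrite -/f in f0 f1.
have df : delta <= f.
  apply: le_trans ds _; apply: le_trans (nd_le _ (Num.floor s)) _.
  by rewrite -/(frac s) ger0_norm.
have df1 : delta <= 1 - f.
  apply: le_trans ds _; apply: le_trans (nd_le _ (Num.floor s + 1)) _.
  by rewrite intrD opprD addrA -/(frac s) -/f distrC ger0_norm // subr_ge0 ltW.
have dfb : delta <= `|f - beta|.
  apply: le_trans dsb _; apply: le_trans (nd_le _ (Num.floor s)) _.
  by rewrite addrAC.
pose j := nint (s - s'); pose e := s - s' - j%:~R.
have e1 : `|e| < delta by [].
have fs' : frac s' = f - e.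
  rewrite -(frac_id (_ : f - e \in `[0, 1[)); last first.
    by move: e1; rewrite in_itv /= ltr_norml => /andP[? ?]; apply/andP; split; lra.
  rewrite (_ : f - e = s' + (j - Num.floor s)%:~R) ?fracDz //.
  by rewrite /f /frac /e intrB; ring.
rewrite fs'; move: dfb e1; rewrite ltr_norml => dfb /andP[e1 e2].
have [fb|fb] := leP beta f.
  move: dfb; rewrite ger0_norm ?subr_ge0 // => dfb; symmetry; lra.
move: dfb; rewrite ltr0_norm ?subr_lt0 // => dfb; apply/esym/negbTE; rewrite -ltNge; lra.
Qed.

(** [x] is a cluster point of points whose codes agree with [y] on growing windows. When its orbit
    meets [0] or [beta], the coordinate of [y] depends on the side of approach, so these times are
    excluded. *)
Lemma base_point (alpha beta : R) (y : full_shift) : 0 <= beta < 1 ->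
  Xset alpha beta y -> exists x : R, forall k : int,
  0 < nd (x + k%:~R * alpha) -> 0 < nd (x + k%:~R * alpha - beta) ->
  y k = (beta <= frac (x + k%:~R * alpha)).
Proof.
move=> b01 Xy.
have h (n : nat) : exists x : R, (x \in `[0, 1[) /\ agree n y (code alpha beta x).
  by have [_ [[x x01 <-] yx]] := Xy _ (nbhs_agree y n); exists x.
have [x xP] := choice h.
have xF : (x n @[n --> \oo]) [set` `[0, 1]].
  exists 0%N => // n _ /=; have [+ _] := xP n.
  by rewrite !in_itv /= => /andP[-> /ltW ->].
have [p [_ pc]] := @segment_compact R 0 1 _ _ xF.
exists p => k k1 k2.
set d := Num.min (nd (p + k%:~R * alpha)) (nd (p + k%:~R * alpha - beta)).
have d0 : 0 < d by rewrite lt_min k1.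
have [|q [[n /= kn <-] pq]] :=
    pc (x @` [set n | (`|k| <= n)%N]) (ball p d) _ (nbhsx_ballx p d d0).
  by exists `|k|%N => // n /= nk; exists n.
have [x01 ag] := xP n.
rewrite (ag k kn) codeE //; symmetry; apply: (@frac_ge_stable _ d) => //.
- by rewrite ge_min lexx.
- by rewrite ge_min lexx orbT.
by rewrite opprD addrACA subrr addr0 (le_lt_trans (nd_norm _)).
Qed.

(** Two integers [x + n alpha] and [x + m alpha] would make [(m - n) alpha] an integer; so there is
    at most one bad time. *)
Lemma nd_eventually_gt0 (alpha x : R) : aperiodic alpha ->
  exists n0, forall n, (n0 <= n)%N -> 0 < nd (x + n%:R * alpha).
Proof.
move=> irr; have [[n nz]|nz] := pselect (exists n, nd (x + n%:R * alpha) = 0).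
  exists n.+1 => m nm; rewrite lt_def nd_ge0 andbT; apply/eqP => mz.
  have := irr (m - n)%N; rewrite subn_gt0 => /(_ nm); apply/negP; rewrite -leNgt.
  have -> : (m - n)%:R * alpha = (x + m%:R * alpha) - (x + n%:R * alpha).
    by rewrite natrB 1?ltnW //; ring.
  by apply: le_trans (ndB _ _) _; rewrite mz nz addr0.
exists 0%N => n _; rewrite lt_def nd_ge0 andbT; apply/eqP => h.
by apply: nz; exists n.
Qed.

Lemma rotation_tail (alpha beta : R) (y : full_shift) : 0 <= beta < 1 ->
  aperiodic alpha -> Xset alpha beta y -> exists (x : R) (n0 : nat),
  forall n : nat, (n0 <= n)%N -> y n%:Z = (beta <= frac (x + n%:R * alpha)).
Proof.
move=> b01 irr Xy; have [x xP] := base_point b01 Xy.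
have [n1 h1] := nd_eventually_gt0 x irr.
have [n2 h2] := nd_eventually_gt0 (x - beta) irr.
exists x, (maxn n1 n2) => n; rewrite geq_max => /andP[/h1 {}h1 /h2 {}h2].
by apply: xP; rewrite -pmulrn // addrAC.
Qed.

Context (alpha beta : R) (b01 : 0 <= beta < 1).
Let X := set_type (Xset alpha beta).

Lemma Xset_code (t : R) : Xset alpha beta (code alpha beta (frac t)).
Proof. by apply: subset_closure; exists (frac t) => //; exact: frac_itv. Qed.

(** A point of the subshift for every real [t]: composing with it turns a function on [X] into the
    function on the circle that is averaged along [x + p alpha]. *)
Definition coded (t : R) : X :=
  exist (fun y => y \in Xset alpha beta) _ (mem_set (@Xset_code t)).

Lemma codedE t (k : int) : val (coded t) k = (beta <= frac (t + k%:~R * alpha)).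
Proof. by rewrite /= codeE ?frac_itv // frac_fracD. Qed.

(** [D] collects the points that a rotation by [k alpha], [|k| <= M], sends to [0] or [beta]; away
    from them every coordinate of the window is locally constant. *)
Lemma coded_osc (u : X -> R) : cylinder_continuous u ->
  forall eps, 0 < eps -> exists D : seq R, forall delta, 0 < delta ->
     forall t t', (forall c, c \in D -> delta <= nd (t - c)) ->
     nd (t - t') < delta -> `|u (coded t) - u (coded t')| <= eps.
Proof.
move=> uc eps e0; have [M MP] := cylinder_uniform uc e0.
pose ks := [seq j%:Z | j <- iota 0 M.+1] ++ [seq - j%:Z | j <- iota 0 M.+1].
exists ([seq - (k%:~R * alpha) | k <- ks] ++ [seq beta - k%:~R * alpha | k <- ks]).
move=> delta d0 t t' far tt'; apply: MP => k kM; rewrite !codedE.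
have kks : k \in ks.
  rewrite mem_cat; case: k kM => j jM.
    by apply/orP; left; apply: map_f; rewrite mem_iota add0n ltnS.
  apply/orP; right; rewrite NegzE; apply: (map_f (fun i : nat => - i%:Z)).
  by rewrite mem_iota add0n ltnS.
apply: (@frac_ge_stable _ delta) => //.
- rewrite -[k%:~R * alpha]opprK; apply: far.
  by rewrite mem_cat (map_f (fun k : int => - (k%:~R * alpha))).
- rewrite -addrA -[_ - beta]opprK opprB; apply: far.
  by rewrite mem_cat orbC (map_f (fun k : int => beta - k%:~R * alpha)).
by rewrite opprD addrACA subrr addr0.
Qed.

Lemma iter_shift_on (y : X) (p : nat) (k : int) :
  val (iter p (@shift_on R alpha beta) y) k = val y (p%:Z + k).
Proof.
elim: p k => [|p IH] k; first by rewrite add0r.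
by rewrite iterS /= /Defs.shift -/(val _) IH -addn1 PoszD addrAC addrA.
Qed.

Lemma prime_averages_cauchy (u : X -> R) (y : X) : aperiodic alpha ->
  cylinder_continuous u -> forall eps, 0 < eps ->
  exists c : R, exists N0, forall N, (N0 <= N)%N ->
    `|\sum_(0 <= p < N | prime p) u (iter p (@shift_on R alpha beta) y)
       - c * (prime_pi N)%:R| <= eps * (prime_pi N)%:R.
Proof.
move=> irr uc eps eps0; pose e := eps / 3; have e0 : 0 < e by rewrite divr_gt0.
have [B uB] := cylinder_bounded uc.
have [M MP] := cylinder_uniform uc e0.
have [x [n0 xP]] := rotation_tail b01 irr (set_valP y).
(* From [n0 + M] on, the whole window around coordinate [p] lies where [y] is a code; the finitely
   many earlier primes cost at most [2 B] each. *)
have close p : (n0 + M <= p)%N ->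
    `|u (iter p (@shift_on R alpha beta) y) - u (coded (x + p%:R * alpha))| <= e.
  move=> np; apply: MP => k kM; rewrite iter_shift_on codedE.
  have [m mE] : exists m : nat, p%:Z + k = m%:Z by exists (absz (p%:Z + k)); lia.
  rewrite mE xP; last by lia.
  congr (_ <= frac _); rewrite -addrA -mulrDl; congr (_ + _ * _).
  by rewrite -[m%:R]/(m%:Z%:~R) -mE intrD.
have [c [N1 h1]] := prime_equidistribution x irr (fun t => uB (coded t)) (coded_osc uc) e0.
have [N2 h2] := @prime_pi_unbounded R ((n0 + M)%:R * (2 * B) / e).
have B0 : 0 <= B by apply: le_trans (uB y).
exists c, (maxn (n0 + M) (maxn N1 N2)) => N.
rewrite !geq_max => /and3P[hN /h1 {}h1 /h2 {}h2].
set P := (prime_pi N)%:R in h1 h2 *.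
set H := \sum_(_ <= p < N | _) u (coded _) in h1.
set S := \sum_(_ <= p < N | _) _.
suff SH : `|S - H| <= 2 * (e * P).
  apply: le_trans (ler_distD H _ _) _; apply: le_trans (lerD SH h1) _.
  by rewrite le_eqVlt; apply/orP; left; apply/eqP; rewrite /e; field.
rewrite /S /H -sumrB (@big_cat_nat _ _ _ (n0 + M)%N 0%N N) //=.
apply: le_trans (ler_normD _ _) _; rewrite mulr_natl mulr2n; apply: lerD.
  apply: (@le_trans _ _ (\sum_(0 <= p < n0 + M) 2 * B)).
    apply: le_trans (ler_norm_sum _ _ _) _; rewrite big_mkcond.
    apply: ler_sum => p _; case: ifP => _; last by rewrite mulr_ge0.
    apply: le_trans (ler_normB _ _) _.
    by rewrite (_ : 2 * B = B + B) ?lerD //; ring.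
  rewrite sumr_const_nat subn0 -[_ *+ _]mulr_natl.
  by move: h2; rewrite ler_pdivrMr // mulrC [P * e]mulrC.
apply: (@le_trans _ _ (\sum_(n0 + M <= p < N | prime p) e)).
  apply: le_trans (ler_norm_sum _ _ _) _.
  rewrite big_nat_cond [leRHS]big_nat_cond; apply: ler_sum => p /andP[/andP[np _] _].
  exact: close.
rewrite /P prime_piE mulr_sumr.
apply: (@le_trans _ _ (\sum_(1 <= p < N.+1 | prime p) e)); last first.
  by apply: ler_sum => p _; rewrite mulr1.
have := sum_primes_lt (fun=> e) N => E.
apply: (@le_trans _ _ (\sum_(0 <= p < N | prime p) e)); last first.
  by rewrite E gerBl; case: ifP => // _; exact: ltW.
rewrite [leRHS](@big_cat_nat _ _ _ (n0 + M)%N 0%N N) //= lerDr.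
by apply: sumr_ge0 => p _; exact: ltW.
Qed.

(** Having an approximate limit for every [eps] makes the averages a Cauchy sequence in the complete
    field [R]. *)
Lemma prime_averages_cvg (u : X -> R) (y : X) : aperiodic alpha ->
  cylinder_continuous u -> exists l : R, forall eps, 0 < eps ->
  exists N0, forall N, (N0 <= N)%N ->
    `|(prime_pi N)%:R^-1 *
       \sum_(0 <= p < N | prime p) u (iter p (@shift_on R alpha beta) y) - l| <= eps.
Proof.
move=> irr uc.
set A := fun N : nat => (prime_pi N)%:R^-1 *
  \sum_(0 <= p < N | prime p) u (iter p (@shift_on R alpha beta) y).
have AP eps : 0 < eps -> exists c N0, forall N, (N0 <= N)%N -> `|A N - c| <= eps.
  move=> e0; have [c [N1 h1]] := prime_averages_cauchy y irr uc e0.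
  have [N2 h2] := @prime_pi_unbounded R 1.
  exists c, (maxn N1 N2) => N; rewrite geq_max => /andP[/h1 {}h1 /h2 {}h2].
  have P0 : 0 < (prime_pi N)%:R :> R by apply: lt_le_trans h2.
  rewrite -(ler_pM2r P0); apply: le_trans h1.
  rewrite -[X in _ * X](gtr0_norm P0) -normrM mulrBl mulrAC mulVf ?gt_eqF //.
  by rewrite mul1r.
have cA : cvgn A.
  apply/cauchy_cvgP/cauchy_ballP => eps e0.
  have e2 : 0 < eps / 4 by rewrite divr_gt0.
  have [c [N0 h]] := AP _ e2.
  exists ([set A n | n in [set n | (N0 <= n)%N]], [set A n | n in [set n | (N0 <= n)%N]]).
    by split; exists N0 => // n /= nn; exists n.
  move=> [a b] [[n /= nn <-] [m /= mm <-]]; rewrite /ball /=.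
  apply: le_lt_trans (ler_distD c _ _) _.
  have hm : `|c - A m| <= eps / 4 by rewrite distrC h.
  by apply: le_lt_trans (lerD (h n nn) hm) _; lra.
exists (limn A) => eps e0; move/cvgrPdist_le: cA => /(_ eps e0) [N0 _ h].
by exists N0 => N NN; rewrite distrC; exact: h.
Qed.

End RotationCode.

(** * Complex-valued functions and the conclusion *)

Lemma cabs_le_ReDIm (R : realType) (z : R[i]) :
  cabs z <= `|complex.Re z| + `|complex.Im z|.
Proof.
case: z => a b /=.
have -> : Complex a b = a%:C%C + Complex 0 1 * b%:C%C by simpc.
apply: le_trans (cabsD _ _) _; rewrite cabsM !cabs_real lerD2l ler_piMl //.
by rewrite /cabs normc_def /= expr0n expr1n add0r sqrtr1.
Qed.

Theorem theoremB1 (R : realType) (alpha beta : R)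
  (alphaT : alpha \in `[0, 1[) (betaT : beta \in `[0, 1[)
  (alpha_irr : irrational alpha) (beta_neq0 : beta != 0) :
  satisfies_PNT R (@shift_on R alpha beta).
Proof.
move=> y f fc.
have irr := aperiodic_irrational alpha_irr.
have b01 : 0 <= beta < 1 by move: betaT; rewrite in_itv.
have fcyl (z : set_type (Xset alpha beta)) (eps : R) : 0 < eps ->
    exists M, forall z', agree M (val z) (val z') -> cabs (f z - f z') <= eps.
  move=> e0; have e0C : 0 < eps%:C%C :> R[i] by rewrite ltcR.
  have /cvgrPdist_le /(_ _ e0C) := fc z.
  (* A neighbourhood in the subspace is the trace of an open set of the full shift, which contains a
     cylinder. *)
  move=> [U [[W oW <-] /= Wz WU]].
  have [M MW] := agree_base (open_nbhs_nbhs (conj oW Wz)).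
  exists M => z' zz'; have := WU z' (MW _ zz').
  by rewrite /= -lecR cabsE.
have Rec : cylinder_continuous (fun z => complex.Re (f z)).
  move=> z eps /(fcyl z) [M h]; exists M => z' /h; apply: le_trans.
  by rewrite -raddfB Re_le_cabs.
have Imc : cylinder_continuous (fun z => complex.Im (f z)).
  move=> z eps /(fcyl z) [M h]; exists M => z' /h; apply: le_trans.
  by rewrite -raddfB Im_le_cabs.
have [a ha] := prime_averages_cvg b01 y irr Rec.
have [b hb] := prime_averages_cvg b01 y irr Imc.
exists (Complex a b); apply/cvgrPdist_le => eps eps0.
(* Convergence in [R[i]] quantifies over positive elements of [R[i]], and these are real. *)
have eE : eps = (complex.Re eps)%:C%C by rewrite RRe_real // gtr0_real.
have r0 : 0 < complex.Re eps / 2 by rewrite divr_gt0 // -ltcR -eE.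
have [N1 h1] := ha _ r0; have [N2 h2] := hb _ r0.
exists (maxn N1 N2) => // N; rewrite /= geq_max => /andP[/h1 {}h1 /h2 {}h2].
set S := \sum_(0 <= p < N | prime p) f (iter p (@shift_on R alpha beta) y).
have -> : (prime_pi N)%:R^-1 * S =
    Complex ((prime_pi N)%:R^-1 * complex.Re S) ((prime_pi N)%:R^-1 * complex.Im S).
  rewrite -[(prime_pi N)%:R](rmorph_nat (real_complex R)) -fmorphV.
  by case: S => c d /=; simpc.
rewrite eE -cabsE lecR (le_trans (cabs_le_ReDIm _)) // [complex.Re eps]splitr lerD //.
  by apply: le_trans h1; rewrite /= raddf_sum distrC.
by apply: le_trans h2; rewrite /= raddf_sum distrC.
Qed.
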